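(* Fix a random variable $R$ with $R\in(0,C]$ almost surely for some $C<\infty$, and fix $\epsilon\in(0,\pi/2)$. For $\lambda\ge0$ let $\alpha=\alpha(\lambda)=2\lambda\,\mathbf E[\sinh(R)]$ and let $\lambda_{gv}=\frac1{2\mathbf E[\sinh(R)]}$. Let $Y_\infty(\epsilon)$ be the set of directions $\theta\in[0,\epsilon]$ such that the geodesic ray from the origin in direction $\theta$ is contained in the vacant set $\mathcal W$ of the Poisson Boolean model in $\mathbb H^2$ with intensity $\lambda$ and radius distribution $R$. Then there exist constants $0<c\le c'<\infty$, depending on $\epsilon$ and the law of $R$ but not on $\lambda$, such that for all $\lambda\in[0,\lambda_{gv}]$, $$c\,(1-\alpha)\le \mathbf P[Y_\infty(\epsilon)\ne\emptyset]\le c'\,(1-\alpha).$$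
   Context: $\mathbb H^2$ is the hyperbolic plane in the Poincaré disc model: the unit disc $\{|z|<1\}$ with metric $ds^2=4\frac{dx^2+dy^2}{(1-(x^2+y^2))^2}$ and area measure $\mu(dx,dy)=\frac{4}{(1-(x^2+y^2))^2}\,dx\,dy$. Let $X$ be a Poisson point process in $\mathbb H^2$ with intensity measure $\lambda\mu$ (empty if $\lambda=0$), and let $\{R_x\}_{x\in X}$ be i.i.d. copies of $R$, independent of $X$. The occupied set is $\mathcal C=\bigcup_{x\in X}B(x,R_x)$, where $B(x,r)$ is the closed hyperbolic ball of radius $r$ centered at $x$; the vacant set is $\mathcal W=\overline{\mathbb H^2\setminus\mathcal C}$. $L_\infty(\theta)$ denotes the geodesic ray starting at the origin and hitting the boundary of the disc at $e^{i\theta}$, and $Y_\infty(\epsilon)=\{\theta\in[0,\epsilon]:L_\infty(\theta)\subset\mathcal W\}$. $\lambda_{gv}$ is the critical intensity for visibility to infinity from the origin, at which $\alpha=1$. *)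

(* Defs.v *)
From HB Require Import structures.
From mathcomp Require Import all_boot all_order all_algebra.
From mathcomp Require Import all_classical all_reals all_analysis.
From mathcomp Require Import measurable_realfun.

Set Implicit Arguments.
Unset Strict Implicit.
Unset Printing Implicit Defensive.

Import Order.TTheory GRing.Theory Num.Theory.
Import numFieldNormedType.Exports.

Local Open Scope classical_set_scope.
Local Open Scope ring_scope.

Definition sinh {R : realType} (r : R) : R := (expR r - expR (- r)) / 2.

Section poincare_disc.
Context {R : realType}.
Implicit Types (z w : R * R) (A : set (R * R)) (x y : R -> R).

Definition H2 : set (R * R) := [set z | z.1 ^+ 2 + z.2 ^+ 2 < 1].

Definition hyp_area A : \bar R :=
  (\int[lebesgue_measure \x lebesgue_measure]_(z in A `&` H2)
     (4 / (1 - (z.1 ^+ 2 + z.2 ^+ 2)) ^+ 2)%:E)%E.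

Definition is_C1 x : Prop := (forall t, derivable x t 1) /\ continuous (derive1 x).

(* Length of the path t |-> (x t, y t), t in [0, 1], for the metric
   ds^2 = 4 (dx^2 + dy^2) / (1 - (x^2 + y^2))^2. *)
Definition hyp_length x y : R :=
  \int[lebesgue_measure]_(t in `[0, 1])
     Num.sqrt (4 * ((derive1 x t) ^+ 2 + (derive1 y t) ^+ 2) /
               (1 - (x t ^+ 2 + y t ^+ 2)) ^+ 2).

(* A C^1 path on [0, 1] is the restriction of a C^1 map on the whole line; only
   its restriction to [0, 1] is required to stay in the disc. *)
Definition is_path z w x y : Prop :=
  [/\ is_C1 x, is_C1 y,
      forall t, 0 <= t <= 1 -> H2 (x t, y t),
      (x 0, y 0) = z & (x 1, y 1) = w].

Definition hyp_dist z w : R :=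
  inf [set l | exists x y, is_path z w x y /\ l = hyp_length x y].

Definition hyp_ball z (r : R) : set (R * R) :=
  [set w | H2 w /\ hyp_dist z w <= r].

(* g restricted to [0, +oo[ is a unit-speed geodesic ray from the origin to the
   boundary point e^(i theta). *)
Definition is_geodesic_ray (theta : R) (g : R -> R * R) : Prop :=
  [/\ g 0 = (0, 0),
      forall t, 0 <= t -> H2 (g t),
      forall s t, 0 <= s -> 0 <= t -> hyp_dist (g s) (g t) = `|s - t|
    & g t @[t --> +oo] --> (cos theta, sin theta)].

(* There is exactly one such ray, so the union over g has a single member. *)
Definition L_infty (theta : R) : set (R * R) :=
  [set z | exists g, is_geodesic_ray theta g /\ exists2 t, 0 <= t & z = g t].

End poincare_disc.

Section independence.
Context {d} {T : measurableType d} {R : realType} (P : probability T R).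

Definition mutually_independent {I : eqType} {d'} {U : measurableType d'}
    (X : I -> T -> U) : Prop :=
  forall (s : seq I) (B : I -> set U), uniq s ->
    (forall i, measurable (B i)) ->
    P (\big[setI/setT]_(i <- s) (X i @^-1` B i)) =
    (\prod_(i <- s) P (X i @^-1` B i))%E.

Definition sigma_generated {d'} {U : measurableType d'} (X : nat -> T -> U) :
    set (set T) :=
  <<s [set A | exists n B, measurable B /\ A = X n @^-1` B] >>.

Definition independent_sequences {d1 d2} {U1 : measurableType d1}
    {U2 : measurableType d2} (X : nat -> T -> U1) (Y : nat -> T -> U2) : Prop :=
  forall A B, sigma_generated X A -> sigma_generated Y B ->
    (P (A `&` B) = P A * P B)%E.

(* The Poisson law with mean m in [0, +oo]; the one with mean +oo is the point
   mass at +oo.  The library's [poisson_pmf] is not used because it does not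
   give the point mass at 0 when the mean is 0. *)
Definition has_poisson_law (N : T -> \bar R) (m : \bar R) : Prop :=
  match m with
  | r%:E => forall k : nat,
      P [set w | N w = k%:R%:E] = (r ^+ k / k`!%:R * expR (- r))%:E
  | +oo%E => P [set w | N w = +oo%E] = 1%E
  | -oo%E => False
  end.

End independence.

Section boolean_model.
Context {d} {T : measurableType d} {R : realType} (P : probability T R).

(* A point process on the disc is given by an enumeration xi: its points are
   the xi n w lying in H2.  A value outside H2 means that there is no n-th
   point, so that finite and empty configurations are covered. *)
Definition point_count (xi : nat -> T -> R * R) (A : set (R * R)) (w : T) :
    \bar R :=
  (\sum_(0 <= n <oo) (\1_(A `&` H2) (xi n w))%:E)%E.

(* The points are counted with multiplicity; as hyp_area is diffuse, they are
   almost surely distinct. *)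
Definition is_poisson_process (lambda : R) (xi : nat -> T -> R * R) : Prop :=
  [/\ forall n, measurable_fun setT (xi n),
      forall A, measurable A ->
        has_poisson_law P (point_count xi A) (lambda%:E * hyp_area A)%E
    & forall (m : nat) (A : 'I_m -> set (R * R)),
        (forall i, measurable (A i)) -> trivIset setT A ->
        mutually_independent P (fun i => point_count xi (A i))].

(* rho n is the radius attached to the point xi n; law is the distribution of
   the radius. *)
Definition is_boolean_model (lambda : R) (law : probability R R)
    (xi : nat -> T -> R * R) (rho : nat -> T -> R) : Prop :=
  [/\ is_poisson_process lambda xi,
      forall n, measurable_fun setT (rho n),
      forall n B, measurable B -> P (rho n @^-1` B) = law B,
      mutually_independent P rho
    & independent_sequences P xi rho].

Definition occupied_set (xi : nat -> T -> R * R) (rho : nat -> T -> R) (w : T) :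
    set (R * R) :=
  \bigcup_(n in [set n | H2 (xi n w)]) hyp_ball (xi n w) (rho n w).

(* The closure is taken in the disc, whose topology is the Euclidean one. *)
Definition vacant_set (xi : nat -> T -> R * R) (rho : nat -> T -> R) (w : T) :
    set (R * R) :=
  H2 `&` closure (H2 `\` occupied_set xi rho w).

Definition Y_infty (epsilon : R) (xi : nat -> T -> R * R) (rho : nat -> T -> R)
    (w : T) : set R :=
  [set theta | 0 <= theta <= epsilon /\ L_infty theta `<=` vacant_set xi rho w].

End boolean_model.

Section parameters.
Context {R : realType} (law : probability R R).

(* The expectation is finite when the law has bounded support. *)
Definition mean_sinh : R := fine ('E_law[sinh])%E.

Definition alpha (lambda : R) : R := 2 * lambda * mean_sinh.

Definition lambda_gv : R := 1 / (2 * mean_sinh).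

End parameters.

(* P has the value p at the event A, for the completion of P: A is measurable up
   to a P-null set.  The visibility events are uncountable unions over
   directions, measurable only in this sense when T is not complete. *)
Definition completed_prob {d} {T : measurableType d} {R : realType}
    (P : probability T R) (A : set T) (p : R) : Prop :=
  exists E, [/\ measurable E, P.-negligible (A `+` E) & P E = p%:E].

(* Main.v *)
From HB Require Import structures.
Require Import Defs.
From mathcomp Require Import all_boot all_order all_algebra.
From mathcomp Require Import all_classical all_reals all_analysis.
From mathcomp Require Import measurable_realfun ring lra.

Set Implicit Arguments.
Unset Strict Implicit.
Unset Printing Implicit Defensive.

Import Order.TTheory GRing.Theory Num.Theory.
Import numFieldNormedType.Exports.

Local Open Scope classical_set_scope.
Local Open Scope ring_scope.

(* Let [t_theta x] be the hyperbolic sine of the distance from [x] to the ray of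
   direction [theta]. Up to tangencies [theta] is visible iff
   [sinh R_x <= t_theta x] for all points [x]. Since [theta |-> t_theta x] is
   quasi-convex, there is a visible direction iff at every scale [k] some cell
   [[s_j, s_(j+1)]] of the dyadic grid [s_j = eps j / 2^k] satisfies [V_j]: no
   ball meets both of its sides. The area of the points at distance at most [r]
   from two rays with angle [d] is [2 sinh r ln (1/d) + O(1)]; hence [P(V_j)] is
   of order [2^(- k alpha)] and [P(V_i and V_j) / P(V_i)] of order
   [(j - i + 1)^(- alpha)]. By quasi-convexity, given [V_i] the events [V_l]
   with [l < i] are independent of the events [V_j] with [j > i], so splitting
   the union of the [V_j] according to the first one that occurs shows that its
   probability is of the order of the sum of the [P(V_j)] over the sum of
   [n^(- alpha)] for [n <= 2^k], which is of order [1 - alpha] as [k] grows.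
   The directions tangent to a ball are negligible: the union bound over the
   cells telescopes. *)

(** * Calculus *)

(** Every event is encoded by a function [g] on the disc, as [sinh R_x <= g x] for all points [x],
    and has probability [exp (- lambda * load g)], where [load g] averages the area of
    [{g < sinh R}] over the law of [R]. Intersecting events takes minima of functions, and
    inclusion-exclusion reads [load (min g1 g2) + load (max g1 g2) = load g1 + load g2]; a joint
    probability is thus explicit once a pointwise maximum is known. Quasi-convexity computes these
    maxima, so the conditional independence is an exact identity. With [M] cells the sum of the
    [P(V_j)] is of order [M^(1 - alpha)] and the sum of the [n^(- alpha)] of order
    [M^(1 - alpha) / (1 - alpha)], whence the factor [1 - alpha]; at [alpha = 1] the second sum is
    harmonic and the probability vanishes. Area errors enter the exponents multiplied by
    [lambda <= lambda_gv], which makes the constants uniform. For the tangencies the area near a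
    whole ray is infinite, so only centres in a compact disc are counted, and the discs exhaust the
    plane. The resulting bound decays like [2^(- k alpha)]; hence [lambda = 0] is treated apart. *)

Section calculus.
Context {R : realType}.
Local Notation mu := (@lebesgue_measure R).

Lemma is_derive_FTC2 (f F : R -> R) (a b : R) : a < b ->
  (forall t, a <= t <= b -> {for t, continuous f}) ->
  (forall t, a <= t <= b -> is_derive t 1 F (f t)) ->
  (\int[mu]_(x in `[a, b]) (f x)%:E = (F b - F a)%:E)%E.
Proof.
move=> ab cf dF.
have dF1 t : a <= t <= b -> derivable F t 1 by move=> /dF [].
have cF t : a <= t <= b -> {for t, continuous F}.
  by move=> /dF1 /derivable1_diffP/differentiable_continuous.
rewrite (@continuous_FTC2 _ f F a b)//.
- by apply: continuous_in_subspaceT => t; rewrite inE/= in_itv/=; exact: cf.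
- split.
  + by move=> t; rewrite in_itv/= => /andP[? ?]; apply: dF1; rewrite !ltW.
  + by apply: cvg_at_right_filter; apply: cF; rewrite lexx ltW.
  + by apply: cvg_at_left_filter; apply: cF; rewrite lexx ltW.
- move=> t; rewrite in_itv/= => /andP[? ?]; rewrite derive1E.
  by have /dF [_ ->] : a <= t <= b by rewrite !ltW.
Qed.

Lemma is_derive_le_integral (f F v : R -> R) (a b : R) : a < b ->
  (forall t, a <= t <= b -> {for t, continuous f}) ->
  (forall t, a <= t <= b -> {for t, continuous v}) ->
  (forall t, a <= t <= b -> is_derive t 1 F (f t)) ->
  (forall t, a <= t <= b -> f t <= v t) ->
  F b - F a <= \int[mu]_(x in `[a, b]) v x.
Proof.
move=> ab cf cv dF fv.
have -> : F b - F a = \int[mu]_(x in `[a, b]) f x.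
  by rewrite /Rintegral (is_derive_FTC2 ab cf dF).
have ci (g : R -> R) : (forall t, a <= t <= b -> {for t, continuous g}) ->
    mu.-integrable `[a, b] (EFin \o g).
  move=> cg; apply: continuous_compact_integrable; first exact: segment_compact.
  by apply: continuous_in_subspaceT => t; rewrite inE/= in_itv/=; exact: cg.
apply: le_Rintegral => //; try exact: ci.
Qed.

Lemma is_derive_funD (f g : R -> R) (t df dg : R) :
  is_derive t 1 f df -> is_derive t 1 g dg ->
  is_derive t 1 (fun s => f s + g s) (df + dg).
Proof. by move=> ? ?; exact: is_deriveD. Qed.

Lemma is_derive_funB (f g : R -> R) (t df dg : R) :
  is_derive t 1 f df -> is_derive t 1 g dg ->
  is_derive t 1 (fun s => f s - g s) (df - dg).
Proof. by move=> ? ?; exact: is_deriveB. Qed.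

Lemma is_derive_funN (f : R -> R) (t df : R) :
  is_derive t 1 f df -> is_derive t 1 (fun s => - f s) (- df).
Proof. by move=> ?; exact: is_deriveN. Qed.

Lemma is_derive_funM (f g : R -> R) (t df dg : R) :
  is_derive t 1 f df -> is_derive t 1 g dg ->
  is_derive t 1 (fun s => f s * g s) (f t * dg + g t * df).
Proof. by move=> ? ?; exact: is_deriveM. Qed.

Lemma is_derive_funX2 (f : R -> R) (t df : R) :
  is_derive t 1 f df -> is_derive t 1 (fun s => f s ^+ 2) (2 * f t * df).
Proof.
move=> fd; have := is_derive_funM fd fd.
by rewrite -mulrDl => H; apply: is_derive_eq; ring.
Qed.

Lemma is_derive_funV (f : R -> R) (t df : R) : f t != 0 ->
  is_derive t 1 f df -> is_derive t 1 (fun s => (f s)^-1) (- (f t) ^- 2 * df).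
Proof. by move=> ft fd; exact: is_deriveV. Qed.

Lemma is_derive_comp (f g : R -> R) (t df dg : R) :
  is_derive (g t) 1 f df -> is_derive t 1 g dg ->
  is_derive t 1 (fun s => f (g s)) (df * dg).
Proof. by move=> fd gd; have := is_derive1_comp fd gd; apply. Qed.

Lemma is_derive_const (c t : R) : is_derive t 1 (fun=> c) 0.
Proof. exact: is_derive_cst. Qed.

Lemma is_derive_ident (t : R) : is_derive t 1 (fun s : R => s) 1.
Proof. exact: is_derive_id. Qed.

Lemma derivable_is_derive1 (f : R -> R) (t : R) :
  derivable f t 1 -> is_derive t 1 f (f^`()%classic t).
Proof. by move=> df; rewrite derive1E; exact: derivableP. Qed.

Lemma is_derive_continuous (f : R -> R) (t df : R) :
  is_derive t 1 f df -> {for t, continuous f}.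
Proof. by move=> [df1 _]; exact/differentiable_continuous/derivable1_diffP. Qed.

Lemma is_derive_transport (f g : R -> R) (t df dg : R) :
  is_derive t 1 f df -> f = g -> df = dg -> is_derive t 1 g dg.
Proof. by move=> ? <- <-. Qed.

Section continuous_fun.
Context {T : topologicalType}.

Lemma continuous_funD (f g : T -> R) (t : T) :
  {for t, continuous f} -> {for t, continuous g} ->
  {for t, continuous (fun s => f s + g s)}.
Proof. by move=> ? ?; exact: continuousD. Qed.

Lemma continuous_funB (f g : T -> R) (t : T) :
  {for t, continuous f} -> {for t, continuous g} ->
  {for t, continuous (fun s => f s - g s)}.
Proof. by move=> ? ?; exact: continuousB. Qed.

Lemma continuous_funN (f : T -> R) (t : T) :
  {for t, continuous f} -> {for t, continuous (fun s => - f s)}.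
Proof. by move=> ?; exact: continuousN. Qed.

Lemma continuous_funM (f g : T -> R) (t : T) :
  {for t, continuous f} -> {for t, continuous g} ->
  {for t, continuous (fun s => f s * g s)}.
Proof. by move=> ? ?; exact: continuousM. Qed.

Lemma continuous_funX2 (f : T -> R) (t : T) :
  {for t, continuous f} -> {for t, continuous (fun s => f s ^+ 2)}.
Proof. by move=> ?; exact: continuousM. Qed.

Lemma continuous_funV (f : T -> R) (t : T) : f t != 0 ->
  {for t, continuous f} -> {for t, continuous (fun s => (f s)^-1)}.
Proof. by move=> ? ?; exact: continuousV. Qed.

Lemma continuous_fun_comp (f : R -> R) (g : T -> R) (t : T) :
  continuous f -> {for t, continuous g} -> {for t, continuous (fun s => f (g s))}.
Proof. by move=> cf cg; apply: (@continuous_comp _ _ _ g f t) => //; exact: cf. Qed.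

Lemma continuous_const (c : R) (t : T) : {for t, continuous (fun=> c : R)}.
Proof. exact: cvg_cst. Qed.

Lemma continuous_fun_sqrt (f : T -> R) (t : T) :
  {for t, continuous f} -> {for t, continuous (fun s => Num.sqrt (f s))}.
Proof. by apply: continuous_fun_comp; exact: sqrt_continuous. Qed.

End continuous_fun.

Lemma continuous_ident (t : R) : {for t, continuous (fun s : R => s)}.
Proof. exact: cvg_id. Qed.

End calculus.

(** A body that ignores its variable has syntactically equal values at 0 and 1. The test comes
    before the structural rules, so that constant subterms are not decomposed and create no side
    conditions such as nonvanishing denominators. *)
Ltac is_constant f :=
  let a := eval cbv beta in (f 0) in
  let b := eval cbv beta in (f 1) in constr_eq a b.

Ltac continuous_tac := match goal with
  | |- {for _, continuous ?f} => is_constant f; exact: continuous_const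
  | _ => lazymatch goal with
  | |- {for _, continuous (fun s => s)} => exact: continuous_ident
  | |- {for _, continuous (fun s => GRing.add (@?f s) (GRing.opp (@?g s)))} =>
    apply: continuous_funB; continuous_tac
  | |- {for _, continuous (fun s => GRing.add (@?f s) (@?g s))} =>
    apply: continuous_funD; continuous_tac
  | |- {for _, continuous (fun s => GRing.mul (@?f s) (@?g s))} =>
    apply: continuous_funM; continuous_tac
  | |- {for _, continuous (fun s => GRing.opp (@?f s))} =>
    apply: continuous_funN; continuous_tac
  | |- {for _, continuous (fun s => GRing.exp (@?f s) 2)} =>
    apply: continuous_funX2; continuous_tac
  | |- {for _, continuous (fun s => GRing.inv (@?f s))} =>
    apply: continuous_funV; continuous_tac
  | |- {for _, continuous (fun s => Num.sqrt (@?f s))} =>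
    apply: continuous_fun_sqrt; continuous_tac
  | |- _ => try eassumption
  end end.

Ltac derive_tac := match goal with
  | |- is_derive _ _ ?f _ => is_constant f; exact: is_derive_const
  | _ => lazymatch goal with
  | |- is_derive _ _ (fun s => s) _ => exact: is_derive_ident
  | |- is_derive _ _ (fun s => GRing.add (@?f s) (GRing.opp (@?g s))) _ =>
    apply: is_derive_funB; derive_tac
  | |- is_derive _ _ (fun s => GRing.add (@?f s) (@?g s)) _ =>
    apply: is_derive_funD; derive_tac
  | |- is_derive _ _ (fun s => GRing.mul (@?f s) (@?g s)) _ =>
    apply: is_derive_funM; derive_tac
  | |- is_derive _ _ (fun s => GRing.opp (@?f s)) _ =>
    apply: is_derive_funN; derive_tac
  | |- is_derive _ _ (fun s => GRing.exp (@?f s) 2) _ =>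
    apply: is_derive_funX2; derive_tac
  | |- is_derive _ _ (fun s => GRing.inv (@?f s)) _ =>
    apply: is_derive_funV; derive_tac
  | |- _ => try eassumption
  end end.

(** * Hyperbolic distance *)

Section cosh.
Context {R : realType}.
Implicit Types (u v g : R).

Definition cosh u : R := (expR u + expR (- u)) / 2.

Lemma cosh2Bsinh2 u : cosh u ^+ 2 - sinh u ^+ 2 = 1.
Proof.
rewrite /cosh /sinh.
have e : expR u * expR (- u) = 1 by exact: expRxMexpNx_1.
have -> : ((expR u + expR (- u)) / 2) ^+ 2 - ((expR u - expR (- u)) / 2) ^+ 2
  = expR u * expR (- u) by field.
by [].
Qed.

Lemma cosh0 : cosh 0 = 1 :> R.
Proof. by rewrite /cosh oppr0 expR0; field. Qed.

Lemma sinh0 : sinh 0 = 0 :> R.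
Proof. by rewrite /sinh oppr0 subrr mul0r. Qed.

Lemma coshN u : cosh (- u) = cosh u.
Proof. by rewrite /cosh opprK addrC. Qed.

Lemma sinhN u : sinh (- u) = - sinh u.
Proof. by rewrite /sinh opprK -mulNr opprB. Qed.

Lemma lt_sinh : {mono (@sinh R) : u v / u < v}.
Proof.
apply: leW_mono; apply: le_mono => u v uv.
rewrite /sinh ltr_pM2r ?invr_gt0// ltrB ?ltr_expR// ltrN2//.
Qed.

Lemma le_sinh : {mono (@sinh R) : u v / u <= v}.
Proof. by move=> u v; rewrite !leNgt lt_sinh. Qed.

Lemma sinh_gt0 u : (0 < sinh u) = (0 < u).
Proof. by rewrite -{1}sinh0 lt_sinh. Qed.

Lemma sinh_ge0 u : (0 <= sinh u) = (0 <= u).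
Proof. by rewrite -{1}sinh0 le_sinh. Qed.

Lemma cosh_gt0 u : 0 < cosh u.
Proof. by rewrite /cosh divr_gt0// addr_gt0// expR_gt0. Qed.

Lemma cosh_ge1 u : 1 <= cosh u.
Proof.
have := cosh2Bsinh2 u; have := cosh_gt0 u; have := sqr_ge0 (sinh u); nra.
Qed.

Lemma cosh_sqrt u : cosh u = Num.sqrt (1 + sinh u ^+ 2).
Proof.
by rewrite -(cosh2Bsinh2 u) subrK sqrtr_sqr ger0_norm// ltW ?cosh_gt0.
Qed.

Lemma le_cosh u v : 0 <= u -> 0 <= v -> (cosh u <= cosh v) = (u <= v).
Proof.
move=> u0 v0; rewrite !cosh_sqrt ler_psqrt ?nnegrE ?addr_ge0 ?sqr_ge0//.
rewrite lerD2l ler_pXn2r ?nnegrE ?sinh_ge0// le_sinh//.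
Qed.

Lemma lt_cosh u v : 0 <= u -> 0 <= v -> (cosh u < cosh v) = (u < v).
Proof. by move=> u0 v0; rewrite !ltNge le_cosh. Qed.

Lemma coshD u v : cosh (u + v) = cosh u * cosh v + sinh u * sinh v.
Proof. by rewrite /cosh /sinh opprD !expRD; field. Qed.

Lemma coshB u v : cosh (u - v) = cosh u * cosh v - sinh u * sinh v.
Proof. by rewrite coshD coshN sinhN mulrN. Qed.

Global Instance is_derive_cosh u : is_derive u 1 cosh (sinh u).
Proof.
rewrite /cosh /sinh.
have -> : (fun v : R => (expR v + expR (- v)) / 2)
  = (2^-1 : R) *: (expR + (expR \o -%R)) :> (R -> R).
  by apply/funext => v; rewrite /GRing.scale/= mulrC.
apply: is_derive_eq; rewrite /GRing.scale/=; ring.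
Qed.

Global Instance is_derive_sinh u : is_derive u 1 (@sinh R) (cosh u).
Proof.
rewrite /cosh /sinh.
have -> : (fun v : R => (expR v - expR (- v)) / 2)
  = (2^-1 : R) *: (expR - (expR \o -%R)) :> (R -> R).
  by apply/funext => v; rewrite /GRing.scale/= mulrC.
apply: is_derive_eq; rewrite /GRing.scale/=; ring.
Qed.

Lemma continuous_cosh : continuous cosh.
Proof. by move=> u; apply/differentiable_continuous/derivable1_diffP. Qed.

Lemma continuous_sinh : continuous (@sinh R).
Proof. by move=> u; apply/differentiable_continuous/derivable1_diffP. Qed.

Definition acosh g := ln (g + Num.sqrt (g ^+ 2 - 1)).

Lemma acosh_arg_gt0 g : 1 <= g -> 0 < g + Num.sqrt (g ^+ 2 - 1).
Proof. by move=> g1; rewrite ltr_pwDl ?sqrtr_ge0// (lt_le_trans _ g1). Qed.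

Lemma acoshK g : 1 <= g -> cosh (acosh g) = g.
Proof.
move=> g1; rewrite /cosh /acosh expRN lnK ?posrE ?acosh_arg_gt0//.
have s2 : Num.sqrt (g ^+ 2 - 1) ^+ 2 = g ^+ 2 - 1 by rewrite sqr_sqrtr//; nra.
have := acosh_arg_gt0 g1; move: s2; set s := Num.sqrt _ => s2 gs.
have -> : (g + s)^-1 = g - s by apply: (mulfI (lt0r_neq0 gs)); rewrite divff ?gt_eqF//; lra.
by field.
Qed.

Lemma acosh_ge0 g : 1 <= g -> 0 <= acosh g.
Proof. by move=> g1; rewrite ln_ge0// (le_trans g1)// lerDl sqrtr_ge0. Qed.

Lemma coshK u : 0 <= u -> acosh (cosh u) = u.
Proof.
move=> u0; have c1 := cosh_ge1 u; have a0 := acosh_ge0 c1.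
by apply/le_anti; rewrite -(le_cosh a0 u0) -(le_cosh u0 a0) acoshK// lexx.
Qed.

Lemma is_derive_acosh g : 1 < g -> is_derive g 1 acosh (Num.sqrt (g ^+ 2 - 1))^-1.
Proof.
move=> g1.
have g21 : 0 < g ^+ 2 - 1 by nra.
have sg : is_derive g 1 (fun h : R => Num.sqrt (h ^+ 2 - 1)) (g / Num.sqrt (g ^+ 2 - 1)).
  have := @is_derive1_comp _ Num.sqrt (fun h : R => h ^+ 2 - 1) g _ _
    (is_derive1_sqrt g21).
  move=> /(_ (g *+ 2)) H.
  apply: is_derive_eq; first apply: H.
    apply: is_derive_eq; rewrite /GRing.scale/=; ring.
  rewrite -mulr_natr; field.
  by rewrite sqrtr_eq0 -ltNge.
have ag := acosh_arg_gt0 (ltW g1).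
have := @is_derive_comp R (@ln R) (fun h => h + Num.sqrt (h ^+ 2 - 1)) g _ _
  (is_derive1_ln ag) (is_derive_funD (is_derive_ident g) sg).
move=> /is_derive_transport; apply => //.
have s0 : 0 < Num.sqrt (g ^+ 2 - 1) by rewrite sqrtr_gt0.
field; rewrite !gt_eqF//.
Qed.

End cosh.

Section hyp_dist.
Context {R : realType}.
Implicit Types (z w : R * R).

Definition cosh_dist z w : R :=
  1 + 2 * ((w.1 - z.1) ^+ 2 + (w.2 - z.2) ^+ 2) /
      ((1 - (z.1 ^+ 2 + z.2 ^+ 2)) * (1 - (w.1 ^+ 2 + w.2 ^+ 2))).

Lemma cosh_dist_ge1 z w : H2 z -> H2 w -> 1 <= cosh_dist z w.
Proof.
rewrite /H2/= => z1 w1; rewrite /cosh_dist lerDl divr_ge0//.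
  by rewrite mulr_ge0// addr_ge0// sqr_ge0.
by rewrite mulr_ge0// subr_ge0 ltW.
Qed.

(* The gradient of [cosh_dist z] at [(x, y)] is [4 / (d m ^ 2)] times the vector
   whose squared norm is computed here. *)
Lemma cosh_dist_gradient (a b x y : R) :
  let N := (x - a) ^+ 2 + (y - b) ^+ 2 in
  let m := 1 - (x ^+ 2 + y ^+ 2) in
  let d := 1 - (a ^+ 2 + b ^+ 2) in
  ((x - a) * m + N * x) ^+ 2 + ((y - b) * m + N * y) ^+ 2 = N * (N + d * m).
Proof. by rewrite /=; ring. Qed.

(** Along a path, [acosh] of the hyperbolic cosine of the distance to [z] grows at most at unit rate
    with respect to length. That cosine equals 1 at the start, where [acosh] is not differentiable;
    adding [cosh u - 1] keeps it above 1. *)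
Lemma hyp_length_ge z w (x y : R -> R) (u : R) : 0 < u -> H2 z ->
  is_path z w x y ->
  cosh_dist z w + cosh u - 1 <= cosh (hyp_length x y + u).
Proof.
move=> u0 Hz [[dx cx] [dy cy] H2xy xy0 xy1].
have [a0 b0] : x 0 = z.1 /\ y 0 = z.2 by rewrite -xy0.
have [a1 b1] : x 1 = w.1 /\ y 1 = w.2 by rewrite -xy1.
set d := 1 - (z.1 ^+ 2 + z.2 ^+ 2).
have d0 : 0 < d by rewrite subr_gt0.
pose N (t : R) : R := (x t - z.1) ^+ 2 + (y t - z.2) ^+ 2.
pose m (t : R) : R := 1 - (x t ^+ 2 + y t ^+ 2).
have m0 (t : R) : 0 <= t <= 1 -> 0 < m t.
  by move=> /H2xy; rewrite /H2/= /m subr_gt0.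
have N0 (t : R) : 0 <= N t by rewrite addr_ge0// sqr_ge0.
pose F (t : R) : R := cosh u + 2 / d * (N t * (m t)^-1).
pose x' : R -> R := derive1 x; pose y' : R -> R := derive1 y.
pose N' (t : R) : R := 2 * (x t - z.1) * (x' t - 0) + 2 * (y t - z.2) * (y' t - 0).
pose m' (t : R) : R := 0 - (2 * x t * x' t + 2 * y t * y' t).
pose F' (t : R) : R := 0 + (2 / d * (N t * (- (m t) ^- 2 * m' t) + (m t)^-1 * N' t)
   + (N t * (m t)^-1) * 0).
have dF (t : R) : 0 <= t <= 1 -> is_derive t 1 F (F' t).
  move=> t01; have := m0 _ t01 => mt0.
  have ddx := derivable_is_derive1 (dx t).
  have ddy := derivable_is_derive1 (dy t).
  rewrite /F /F' /N' /m' /N /m /x' /y'.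
  derive_tac.
  by rewrite lt0r_neq0.
have cu : 1 < cosh u by rewrite -(@cosh0 R) lt_cosh// ltW.
have F1 (t : R) : 0 <= t <= 1 -> 1 < F t.
  move=> t01; rewrite /F ltr_wpDr// mulr_ge0// ?divr_ge0// ?(ltW d0)//.
  by rewrite ltW// m0.
pose v (t : R) : R := Num.sqrt (4 * (x' t ^+ 2 + y' t ^+ 2) / (m t) ^+ 2).
have cxt (t : R) : {for t, continuous x} by exact: is_derive_continuous (derivable_is_derive1 (dx t)).
have cyt (t : R) : {for t, continuous y} by exact: is_derive_continuous (derivable_is_derive1 (dy t)).
have cx't (t : R) : {for t, continuous x'} by exact: cx.
have cy't (t : R) : {for t, continuous y'} by exact: cy.
have mn0 (t : R) : 0 <= t <= 1 -> m t != 0 by move=> /m0 /lt0r_neq0.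
have main : acosh (F 1) - acosh (F 0) <= hyp_length x y.
  rewrite /hyp_length -/x' -/y'.
  apply: (@is_derive_le_integral _ (fun t => (Num.sqrt (F t ^+ 2 - 1))^-1 * F' t)
     (fun t => acosh (F t)) v 0 1) => //.
  - move=> t t01; have Ft := F1 _ t01; have mt := mn0 _ t01.
    have sF : Num.sqrt (F t ^+ 2 - 1) != 0 by rewrite gt_eqF// sqrtr_gt0; nra.
    have cF : {for t, continuous F} by exact: is_derive_continuous (dF t t01).
    have := cxt t; have := cyt t; have := cx't t; have := cy't t => c1 c2 c3 c4.
    rewrite /F' /N' /m'.
    have cm : {for t, continuous m} by rewrite /m; continuous_tac.
    have cN : {for t, continuous N} by rewrite /N; continuous_tac.
    continuous_tac; first [assumption | exact: expf_neq0].
  - move=> t t01; have mt := mn0 _ t01.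
    have := cxt t; have := cyt t; have := cx't t; have := cy't t => c1 c2 c3 c4.
    by rewrite /v /m; continuous_tac; exact: expf_neq0.
  - by move=> t t01; apply: is_derive_comp (dF _ t01); exact/is_derive_acosh/F1.
  - move=> t t01; have mt := m0 _ t01; have Ft := F1 _ t01.
    have sF : 0 < Num.sqrt (F t ^+ 2 - 1) by rewrite sqrtr_gt0; nra.
    rewrite ler_pdivrMl// /v -sqrtrM; last by nra.
    apply: (le_trans (ler_norm _)); rewrite -sqrtr_sqr ler_wsqrtr//.
    (* [F0] is the cosine before the shift. Its gradient has hyperbolic norm exactly
       [sqrt (F0 ^ 2 - 1)], at most [sqrt (F t ^ 2 - 1)]; it remains to apply Cauchy-Schwarz to
       gradient and velocity. *)
    pose F0 := 1 + 2 * N t / (d * m t).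
    have F00 : 1 <= F0.
      by rewrite lerDl divr_ge0// ?mulr_ge0// ?(ltW d0)// ltW.
    have F0F : F0 <= F t.
      by rewrite /F0 /F lerD ?(ltW cu)// le_eqVlt; apply/orP; left; apply/eqP; field; rewrite !gt_eqF.
    pose gx := (x t - z.1) * m t + N t * x t.
    pose gy := (y t - z.2) * m t + N t * y t.
    have F'E : F' t = 4 / (d * m t ^+ 2) * (gx * x' t + gy * y' t).
      by rewrite /F' /N' /m' /gx /gy; field; rewrite !gt_eqF.
    have gE : gx ^+ 2 + gy ^+ 2 = N t * (N t + d * m t) by exact: cosh_dist_gradient.
    have F0E : F0 ^+ 2 - 1 = 4 / (d * m t) ^+ 2 * (gx ^+ 2 + gy ^+ 2).
      by rewrite gE /F0; field; rewrite !gt_eqF.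
    apply: (@le_trans _ _ ((F0 ^+ 2 - 1) * (4 * (x' t ^+ 2 + y' t ^+ 2) / m t ^+ 2))); last first.
      apply: ler_wpM2r; last by nra.
      by rewrite divr_ge0 ?sqr_ge0// mulr_ge0// addr_ge0// sqr_ge0.
    rewrite F0E F'E exprMn.
    have -> : 4 / (d * m t) ^+ 2 * (gx ^+ 2 + gy ^+ 2) *
      (4 * (x' t ^+ 2 + y' t ^+ 2) / m t ^+ 2) =
      (4 / (d * m t ^+ 2)) ^+ 2 * ((gx ^+ 2 + gy ^+ 2) * (x' t ^+ 2 + y' t ^+ 2)).
      by field; rewrite !gt_eqF.
    apply: ler_wpM2l; first exact: sqr_ge0.
    have := sqr_ge0 (gx * y' t - gy * x' t); nra.
have F0E : F 0 = cosh u.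
  by rewrite /F /N a0 b0 !subrr expr0n/= addr0 mul0r mulr0 addr0.
have F1E : F 1 = cosh_dist z w + cosh u - 1.
  rewrite /F /N /m /cosh_dist a1 b1 -/d.
  have := mn0 1; rewrite /m a1 b1 lexx ler01 => /(_ isT) mm.
  by field; rewrite mm gt_eqF.
have F1gt : 1 <= F 1 by rewrite ltW// F1// ler01 lexx.
rewrite -F1E -{1}(acoshK F1gt).
have h0 : 0 <= hyp_length x y.
  by apply: Rintegral_ge0 => t _; exact: sqrtr_ge0.
rewrite le_cosh ?acosh_ge0// ?addr_ge0 ?(ltW u0)//.
by move: main; rewrite F0E coshK ?(ltW u0)// lerBlDr.
Qed.

End hyp_dist.

Section geodesic_path.
Context {R : realType}.

(* Unit-speed geodesics of the hyperboloid, through [(Z0, Z1, Z2)] with unit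
   tangent vector [(U0, U1, U2)], projected to the disc. *)
Lemma geodesic_path (Z0 Z1 Z2 U0 U1 U2 D : R) :
  Z0 ^+ 2 = 1 + Z1 ^+ 2 + Z2 ^+ 2 -> 0 < Z0 ->
  U1 ^+ 2 + U2 ^+ 2 = 1 + U0 ^+ 2 -> Z0 * U0 = Z1 * U1 + Z2 * U2 -> 0 <= D ->
  let X (Zi Ui : R) := cosh D * Zi + sinh D * Ui in
  exists f g : R -> R,
  is_path (Z1 / (1 + Z0), Z2 / (1 + Z0))
       (X Z1 U1 / (1 + X Z0 U0), X Z2 U2 / (1 + X Z0 U0)) f g
   /\ hyp_length f g = D.
Proof.
move=> hZ Z0gt0 hU hZU D0 X1.
pose X (Zi Ui t : R) : R := cosh (t * D) * Zi + sinh (t * D) * Ui.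
pose V (Zi Ui t : R) : R := sinh (t * D) * Zi + cosh (t * D) * Ui.
have dX (Zi Ui t : R) : is_derive t 1 (X Zi Ui) (D * V Zi Ui t).
  have dt : is_derive t 1 (fun s : R => s * D) D.
    by apply: is_derive_transport (is_derive_funM (is_derive_ident t) (is_derive_const D t)) _ _ => //; ring.
  have dc := @is_derive_comp R _ (fun s => s * D) t _ _ (is_derive_cosh (t * D)) dt.
  have ds := @is_derive_comp R _ (fun s => s * D) t _ _ (is_derive_sinh (t * D)) dt.
  apply: is_derive_transport (is_derive_funD (is_derive_funM dc (is_derive_const Zi t))
    (is_derive_funM ds (is_derive_const Ui t))) _ _ => //.
  by rewrite /V; ring.
have cX (Zi Ui t : R) : {for t, continuous (X Zi Ui)} by exact: is_derive_continuous (dX Zi Ui t).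
have cV (Zi Ui t : R) : {for t, continuous (V Zi Ui)}.
  have ct : {for t, continuous (fun s : R => s * D)} by continuous_tac.
  have cs := continuous_fun_comp (@continuous_sinh R) ct.
  have cc := continuous_fun_comp (@continuous_cosh R) ct.
  by rewrite /V; continuous_tac.
have U02 : U0 ^+ 2 = U1 ^+ 2 + U2 ^+ 2 - 1 by lra.
have X_hyperboloid (t : R) : X Z0 U0 t ^+ 2 = 1 + X Z1 U1 t ^+ 2 + X Z2 U2 t ^+ 2.
  have := cosh2Bsinh2 (t * D); rewrite /X.
  move: (cosh _) (sinh _) => c s c2.
  transitivity (c ^+ 2 * Z0 ^+ 2 + 2 * c * s * (Z0 * U0) + s ^+ 2 * U0 ^+ 2); first by ring.
  rewrite U02 hZ hZU; have c2' : c ^+ 2 = 1 + s ^+ 2 by lra.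
  by rewrite !(sqrrD (c * _)) !exprMn c2'; ring.
have V_unit (t : R) : V Z1 U1 t ^+ 2 + V Z2 U2 t ^+ 2 = 1 + V Z0 U0 t ^+ 2.
  have := cosh2Bsinh2 (t * D); rewrite /V.
  move: (cosh _) (sinh _) => c s c2.
  transitivity (s ^+ 2 * (Z1 ^+ 2 + Z2 ^+ 2) + 2 * c * s * (Z1 * U1 + Z2 * U2) +
     c ^+ 2 * (U1 ^+ 2 + U2 ^+ 2)); first by ring.
  have -> : Z1 ^+ 2 + Z2 ^+ 2 = Z0 ^+ 2 - 1 by lra.
  rewrite hU -hZU; have c2' : c ^+ 2 = 1 + s ^+ 2 by lra.
  by rewrite !(sqrrD (s * _)) !exprMn c2'; ring.
have X_V (t : R) : X Z0 U0 t * V Z0 U0 t = X Z1 U1 t * V Z1 U1 t + X Z2 U2 t * V Z2 U2 t.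
  rewrite /X /V; move: (cosh _) (sinh _) => c s.
  transitivity (c * s * Z0 ^+ 2 + (c ^+ 2 + s ^+ 2) * (Z0 * U0) + c * s * U0 ^+ 2); first by ring.
  by rewrite U02 hZ hZU; ring.
have X0_gt0 (t : R) : 0 < X Z0 U0 t.
  (* By Cauchy-Schwarz on the spatial parts. Then [|sinh * U0| < cosh * Z0], and the geodesic stays
     on the upper sheet of the hyperboloid. *)
  have BA : U0 ^+ 2 <= Z0 ^+ 2 - 1.
    have h : (Z0 * U0) ^+ 2 <= (Z0 ^+ 2 - 1) * (1 + U0 ^+ 2).
      rewrite hZU; have := sqr_ge0 (Z1 * U2 - Z2 * U1); rewrite hZ -hU; nra.
    nra.
  rewrite /X; have := cosh2Bsinh2 (t * D); have := cosh_gt0 (t * D).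
  move: (cosh _) (sinh _) => c s c0 c2.
  have p0 : 0 < c * Z0 by rewrite mulr_gt0.
  have : (s * U0) ^+ 2 < (c * Z0) ^+ 2.
    rewrite !exprMn.
    have -> : c ^+ 2 = 1 + s ^+ 2 by lra.
    have := sqr_ge0 s; have := sqr_ge0 U0; nra.
  rewrite -[_ < _ ^+ 2]ltr_sqrt ?exprn_gt0// !sqrtr_sqr (gtr0_norm p0) ltr_norml => /andP[]; lra.
have q0 (t : R) : 0 < 1 + X Z0 U0 t by rewrite addr_gt0.
pose x (Z U t : R) : R := X Z U t * (1 + X Z0 U0 t)^-1.
pose x' (Z U t : R) : R := X Z U t * (- (1 + X Z0 U0 t) ^- 2 * (0 + D * V Z0 U0 t)) +
   (1 + X Z0 U0 t)^-1 * (D * V Z U t).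
have dx (Z U t : R) : is_derive t 1 (x Z U) (x' Z U t).
  have := dX Z U t; have := dX Z0 U0 t => d1 d2.
  by rewrite /x /x'; derive_tac; rewrite gt_eqF.
have C1x (Z U : R) : is_C1 (x Z U).
  split; first by move=> t; have [] := dx Z U t.
  have -> : (derive1 (x Z U) : R -> R) = x' Z U.
    by apply/funext => t; rewrite derive1E; have [_ ->] := dx Z U t.
  suff cx' (t : R) : {for t, continuous (x' Z U)} by move=> t; exact: cx'.
  have := cX Z U t; have := cX Z0 U0 t; have := cV Z U t; have := cV Z0 U0 t.
  have qt := lt0r_neq0 (q0 t).
  by move=> c1 c2 c3 c4; rewrite /x'; continuous_tac; exact: expf_neq0.
have mE (t : R) : 1 - (x Z1 U1 t ^+ 2 + x Z2 U2 t ^+ 2) = 2 / (1 + X Z0 U0 t).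
  rewrite /x; have := X_hyperboloid t; have := q0 t.
  move: (X Z0 U0 t) (X Z1 U1 t) (X Z2 U2 t) => X0 {}X1 X2 q h.
  have -> : 1 - ((X1 / (1 + X0)) ^+ 2 + (X2 / (1 + X0)) ^+ 2) =
     ((1 + X0) ^+ 2 - (X1 ^+ 2 + X2 ^+ 2)) / (1 + X0) ^+ 2.
    by field; rewrite gt_eqF.
  have -> : X1 ^+ 2 + X2 ^+ 2 = X0 ^+ 2 - 1 by lra.
  by field; rewrite gt_eqF.
exists (x Z1 U1), (x Z2 U2); split.
  split; [exact: C1x|exact: C1x| | | ].
  - by move=> t _; rewrite /H2/= -subr_gt0 mE divr_gt0.
  - by rewrite /x /X mul0r cosh0 sinh0 !mul0r !mul1r !addr0.
  - by rewrite /x /X mul1r.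
rewrite /hyp_length (_ : (fun t => _) = cst D).
  by rewrite Rintegral_cst//= lebesgue_measure_itv/= lte01 oppr0 adde0 mulr1.
apply/funext => t /=.
have dE (Z U : R) : derive1 (x Z U) t = x' Z U t.
  by rewrite derive1E; have [_ ->] := dx Z U t.
rewrite mE !dE -[RHS](ger0_norm D0) -[RHS]sqrtr_sqr; congr Num.sqrt.
have := X_hyperboloid t; have := V_unit t; have := X_V t; have := q0 t.
rewrite /x'; move: (X Z0 U0 t) (X Z1 U1 t) (X Z2 U2 t) => X0 {}X1 X2.
move: (V Z0 U0 t) (V Z1 U1 t) (V Z2 U2 t) => V0 V1 V2 q hXV hV hX.
transitivity (D ^+ 2 * ((V1 ^+ 2 + V2 ^+ 2) * (1 + X0) ^+ 2 - 2 * (X1 * V1 + X2 * V2) * V0 * (1 + X0)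
   + (X1 ^+ 2 + X2 ^+ 2) * V0 ^+ 2) / (1 + X0) ^+ 2).
  by field; rewrite gt_eqF.
rewrite hV -hXV; have -> : X1 ^+ 2 + X2 ^+ 2 = X0 ^+ 2 - 1 by lra.
by field; rewrite gt_eqF.
Qed.

End geodesic_path.

Section hyp_dist_formula.
Context {R : realType}.
Implicit Types (z w : R * R).

Lemma cosh_distE z w : H2 z -> H2 w -> cosh_dist z w =
  ((1 + (z.1 ^+ 2 + z.2 ^+ 2)) * (1 + (w.1 ^+ 2 + w.2 ^+ 2)) - 4 * (z.1 * w.1 + z.2 * w.2))
  / ((1 - (z.1 ^+ 2 + z.2 ^+ 2)) * (1 - (w.1 ^+ 2 + w.2 ^+ 2))).
Proof.
rewrite /H2/= => z1 w1; rewrite /cosh_dist; field.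
by rewrite !gt_eqF// subr_gt0.
Qed.

Lemma hyp_path_exists z w : H2 z -> H2 w -> 1 < cosh_dist z w ->
  exists x y, is_path z w x y /\ hyp_length x y = acosh (cosh_dist z w).
Proof.
move=> Hz Hw c1.
set D := acosh _.
have cD : cosh D = cosh_dist z w by rewrite acoshK// ltW.
have D0 : 0 < D by rewrite -lt_cosh// ?cosh0 ?cD// acosh_ge0// ltW.
have sD : 0 < sinh D by rewrite sinh_gt0.
have c2 := cosh2Bsinh2 D.
case: z w Hz Hw c1 @D cD D0 sD c2 => [a b] [p q]; rewrite /H2/= => Hz Hw c1.
set D := acosh _ => cD D0 sD c2.
move: cD; rewrite cosh_distE//= => cD.
have dz : 0 < 1 - (a ^+ 2 + b ^+ 2) by rewrite subr_gt0.
have dw : 0 < 1 - (p ^+ 2 + q ^+ 2) by rewrite subr_gt0.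
(* Inverse stereographic projection of both points to the hyperboloid, where [cosh D] is the Lorentz
   product [Z0 * W0 - Z1 * W1 - Z2 * W2]. *)
pose n (a b : R) : R := 1 - (a ^+ 2 + b ^+ 2).
pose Z0 := (2 - n a b) / n a b; pose Z1 := 2 * a / n a b; pose Z2 := 2 * b / n a b.
pose W0 := (2 - n p q) / n p q; pose W1 := 2 * p / n p q; pose W2 := 2 * q / n p q.
have hZ : Z0 ^+ 2 = 1 + Z1 ^+ 2 + Z2 ^+ 2.
  by rewrite /Z0 /Z1 /Z2 /n; field; rewrite gt_eqF.
have hW : W0 ^+ 2 = 1 + W1 ^+ 2 + W2 ^+ 2.
  by rewrite /W0 /W1 /W2 /n; field; rewrite gt_eqF.
have hZW : Z0 * W0 = cosh D + Z1 * W1 + Z2 * W2.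
  by rewrite cD /W0 /W1 /W2 /Z0 /Z1 /Z2 /n; field; rewrite !gt_eqF.
have Z0gt0 : 0 < Z0.
  by rewrite divr_gt0// /n; have := sqr_ge0 a; have := sqr_ge0 b; lra.
set c := cosh D in hZW c2; set s := sinh D in sD c2.
have s0 : s != 0 by rewrite gt_eqF.
(* The unit tangent vector at [Z] pointing to [W], obtained by solving
   [W = cosh D * Z + sinh D * U]. *)
pose U0 := (W0 - c * Z0) / s; pose U1 := (W1 - c * Z1) / s; pose U2 := (W2 - c * Z2) / s.
have hU : U1 ^+ 2 + U2 ^+ 2 = 1 + U0 ^+ 2.
  have -> : U1 ^+ 2 + U2 ^+ 2 = ((W1 ^+ 2 + W2 ^+ 2) - 2 * c * (Z1 * W1 + Z2 * W2) +
       c ^+ 2 * (Z1 ^+ 2 + Z2 ^+ 2)) / s ^+ 2.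
    by rewrite /U1 /U2; field.
  have -> : 1 + U0 ^+ 2 = (s ^+ 2 + W0 ^+ 2 - 2 * c * (Z0 * W0) + c ^+ 2 * Z0 ^+ 2) / s ^+ 2.
    by rewrite /U0; field.
  rewrite hZW hZ hW; congr (_ / _).
  have -> : s ^+ 2 = c ^+ 2 - 1 by lra.
  by ring.
have hZU : Z0 * U0 = Z1 * U1 + Z2 * U2.
  have -> : Z0 * U0 = (Z0 * W0 - c * Z0 ^+ 2) / s by rewrite /U0; field.
  have -> : Z1 * U1 + Z2 * U2 = ((Z1 * W1 + Z2 * W2) - c * (Z1 ^+ 2 + Z2 ^+ 2)) / s.
    by rewrite /U1 /U2; field.
  by rewrite hZW hZ; congr (_ / _); ring.
have [x [y [pxy lxy]]] := geodesic_path hZ Z0gt0 hU hZU (ltW D0).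
exists x, y; split=> //.
move: pxy; rewrite /= -/c -/s.
have XE Zi Wi : c * Zi + s * ((Wi - c * Zi) / s) = Wi by field.
rewrite /U0 /U1 /U2 !XE.
have -> : Z1 / (1 + Z0) = a by rewrite /Z1 /Z0 /n; field; rewrite gt_eqF//; lra.
have -> : Z2 / (1 + Z0) = b by rewrite /Z2 /Z0 /n; field; rewrite gt_eqF//; lra.
have -> : W1 / (1 + W0) = p by rewrite /W1 /W0 /n; field; rewrite gt_eqF//; lra.
have -> // : W2 / (1 + W0) = q by rewrite /W2 /W0 /n; field; rewrite gt_eqF//; lra.
Qed.

Lemma hyp_path_const z : H2 z -> is_path z z (cst z.1) (cst z.2) /\
  hyp_length (cst z.1) (cst z.2) = 0.
Proof.
move=> Hz.
have C1 (c : R) : is_C1 (cst c).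
  split=> [t|]; first exact: derivable_cst.
  have -> : (derive1 (cst c) : R -> R) = cst 0 by apply/funext => t; rewrite derive1_cst.
  exact: cst_continuous.
split; first by split=> //=; case: z Hz.
rewrite /hyp_length (_ : (fun t => _) = cst 0).
  by rewrite Rintegral_cst//= mul0r.
by apply/funext => t /=; rewrite !derive1_cst expr0n/= addr0 mulr0 mul0r sqrtr0.
Qed.

Lemma cosh_dist_eq1 z w : H2 z -> H2 w -> cosh_dist z w = 1 -> z = w.
Proof.
rewrite /H2/= => Hz Hw /eqP; rewrite /cosh_dist -[X in _ == X]addr0.
rewrite (inj_eq (addrI 1)) mulf_eq0 invr_eq0 mulf_eq0 pnatr_eq0/= mulf_eq0.
rewrite (gt_eqF (_ : 0 < 1 - (z.1 ^+ 2 + z.2 ^+ 2))) ?subr_gt0//.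
rewrite (gt_eqF (_ : 0 < 1 - (w.1 ^+ 2 + w.2 ^+ 2))) ?subr_gt0// !orbF.
rewrite paddr_eq0 ?sqr_ge0// !expf_eq0/= !subr_eq0 => /andP[/eqP e1 /eqP e2].
by case: z w e1 e2 {Hz Hw} => ? ? [? ?] /= -> ->.
Qed.

(** The lower bound lets [u] tend to 0 in [hyp_length_ge]; the infimum is attained by a geodesic.
    Equal points need the constant path, since the tangent vector of the geodesic is defined through
    a division by [sinh D]. *)
Lemma hyp_distE z w : H2 z -> H2 w -> hyp_dist z w = acosh (cosh_dist z w).
Proof.
move=> Hz Hw; have c1 := cosh_dist_ge1 Hz Hw; have a0 := acosh_ge0 c1.
rewrite /hyp_dist; set E := [set l | _].
have lbE : lbound E (acosh (cosh_dist z w)).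
  move=> _ [x [y [pxy ->]]]; apply/ler_addgt0Pr => u u0.
  have l0 : 0 <= hyp_length x y by apply: Rintegral_ge0 => t _; exact: sqrtr_ge0.
  rewrite -le_cosh ?addr_ge0 ?(ltW u0)// acoshK//.
  apply: le_trans (hyp_length_ge u0 Hz pxy).
  by rewrite -addrA lerDl subr_ge0 cosh_ge1.
have [x [y [pxy lxy]]] : exists x y, is_path z w x y /\ hyp_length x y = acosh (cosh_dist z w).
  have [|c1'] := leP (cosh_dist z w) 1; last exact: hyp_path_exists.
  move=> c1'; have {c1'}c1E : cosh_dist z w = 1 by apply/le_anti; rewrite c1 c1'.
  have zw := cosh_dist_eq1 Hz Hw c1E; rewrite c1E zw.
  exists (cst w.1), (cst w.2); have [? ->] := hyp_path_const Hw; split=> //.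
  by rewrite -(@cosh0 R) coshK.
have El : E (acosh (cosh_dist z w)) by exists x, y; split.
apply/le_anti; rewrite ge_inf//=; last by exists (acosh (cosh_dist z w)).
by apply: lb_le_inf => //; exists (acosh (cosh_dist z w)).
Qed.

Lemma hyp_dist_le z w (r : R) : H2 z -> H2 w -> 0 <= r ->
  (hyp_dist z w <= r) = (cosh_dist z w <= cosh r).
Proof.
move=> Hz Hw r0; have c1 := cosh_dist_ge1 Hz Hw.
by rewrite hyp_distE// -le_cosh ?acosh_ge0// acoshK.
Qed.

End hyp_dist_formula.

(** * Rays and thresholds *)

Section rays.
Context {R : realType}.
Implicit Types (theta s t r : R) (z : R * R).

Definition ray_point theta s : R * R := (s * cos theta, s * sin theta).

Lemma ray_point_norm theta s :
  (ray_point theta s).1 ^+ 2 + (ray_point theta s).2 ^+ 2 = s ^+ 2.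
Proof. by rewrite /= !exprMn -mulrDr cos2Dsin2 mulr1. Qed.

Lemma ray_point_H2 theta s : 0 <= s < 1 -> H2 (ray_point theta s).
Proof.
move=> /andP[s0 s1]; have := ray_point_norm theta s; rewrite /H2/= => ->.
by rewrite expr_lt1.
Qed.

(* [tanh (t / 2)] *)
Definition ray_param t : R := (1 - expR (- t)) / (1 + expR (- t)).

Lemma ray_param_itv t : 0 <= t -> 0 <= ray_param t < 1.
Proof.
move=> t0; rewrite /ray_param; have q0 := expR_gt0 (- t).
have q1 : expR (- t) <= 1 by rewrite expR_le1 oppr_le0.
rewrite divr_ge0 ?subr_ge0//=.
rewrite ltr_pdivrMr ?addr_gt0//; lra.
Qed.

Lemma ray_param_surj s : 0 <= s < 1 -> exists2 t, 0 <= t & s = ray_param t.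
Proof.
move=> /andP[s0 s1]; have ps : 0 < (1 + s) / (1 - s) by rewrite divr_gt0//; lra.
exists (ln ((1 + s) / (1 - s))).
  by apply: ln_ge0; rewrite ler_pdivlMr; lra.
rewrite /ray_param expRN lnK ?posrE//; field.
by apply/and3P; split; apply: lt0r_neq0; lra.
Qed.

Lemma cvg_ray_param : ray_param t @[t --> +oo] --> (1 : R).
Proof.
have h : ray_param t @[t --> +oo] --> ((1 - 0) * (1 + 0)^-1 : R).
  apply: cvgM; first by apply: cvgB; [exact: cvg_cst|exact: cvgr_expR].
  apply: cvgV; first by rewrite addr0 oner_eq0.
  by apply: cvgD; [exact: cvg_cst|exact: cvgr_expR].
by move: h; rewrite subr0 addr0 invr1 mulr1.
Qed.

Lemma cvg_ray_point (a b : R) :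
  (ray_param t * a, ray_param t * b) @[t --> +oo] --> (a, b).
Proof.
have h (c : R) : ray_param t * c @[t --> +oo] --> c.
  have : ray_param t * c @[t --> +oo] --> 1 * c.
    by apply: cvgM; [exact: cvg_ray_param|exact: cvg_cst].
  by rewrite mul1r.
exact: (cvg_pair (h a) (h b)).
Qed.

Lemma cosh_norm r : cosh `|r| = cosh r.
Proof. by have [_|_] := ger0P r; rewrite ?coshN. Qed.

Lemma hyp_dist_eq (z w : R * R) r : H2 z -> H2 w ->
  (hyp_dist z w = `|r|) <-> (cosh_dist z w = cosh r).
Proof.
move=> Hz Hw; rewrite hyp_distE//; split=> [h|->].
  by rewrite -cosh_norm -h acoshK// cosh_dist_ge1.
by rewrite -cosh_norm coshK.
Qed.

Lemma geodesic_ray_point theta :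
  is_geodesic_ray theta (fun t => ray_point theta (ray_param t)).
Proof.
split.
- by rewrite /ray_param /ray_point oppr0 expR0 subrr mul0r !mul0r.
- by move=> t t0; exact/ray_point_H2/ray_param_itv.
- move=> s t s0 t0; apply/hyp_dist_eq; try exact/ray_point_H2/ray_param_itv.
  rewrite cosh_distE; try exact/ray_point_H2/ray_param_itv.
  rewrite !ray_point_norm /= /cosh opprB expRD (expRD t) !expRN /ray_param.
  rewrite !expRN.
  have ps := expR_gt0 s; have pt := expR_gt0 t.
  have -> : forall a b : R, a * cos theta * (b * cos theta) + a * sin theta * (b * sin theta) = a * b.
    by move=> a b; rewrite -[RHS]mulr1 -(cos2Dsin2 theta); ring.
  move: (expR s) (expR t) ps pt => p q p0 q0.
  have p1 : p + 1 != 0 by rewrite gt_eqF// addr_gt0.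
  have q1 : q + 1 != 0 by rewrite gt_eqF// addr_gt0.
  have rE (u : R) : u != 0 -> u + 1 != 0 -> (1 - u^-1) / (1 + u^-1) = (u - 1) / (u + 1).
    by move=> u0 u1; field; rewrite u0 u1.
  rewrite !rE ?p1 ?q1 ?(gt_eqF p0) ?(gt_eqF q0)//.
  have mE (u : R) : u + 1 != 0 -> 1 - ((u - 1) / (u + 1)) ^+ 2 = 4 * u / (u + 1) ^+ 2.
    by move=> u1; field.
  by rewrite !mE//; field; rewrite p1 q1 !gt_eqF.
- exact: cvg_ray_point.
Qed.

(** The distance to the origin fixes the norm of [g s], and the distance to [g 1] fixes its inner
    product with [g 1]. The latter is the extreme value in Cauchy-Schwarz, so [g s] is a nonnegative
    multiple of [g 1]; the limit at infinity then fixes the direction. *)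
Lemma geodesic_ray_unique theta g t : is_geodesic_ray theta g -> 0 <= t ->
  g t = ray_point theta (ray_param t).
Proof.
move=> [g0 Hg dg lg].
pose m (v : R) : R := 1 - ((g v).1 ^+ 2 + (g v).2 ^+ 2).
have m0 (s : R) : 0 <= s -> 0 < m s by move=> /Hg; rewrite /m subr_gt0.
have cg (s v : R) : 0 <= s -> 0 <= v -> cosh_dist (g s) (g v) = cosh (s - v).
  by move=> s0 v0; apply/hyp_dist_eq; [exact: Hg|exact: Hg|exact: dg].
have mE (s : R) : 0 <= s -> m s * (1 + cosh s) = 2.
  move=> s0; have := cg _ _ s0 (lexx 0); rewrite subr0 => <-.
  rewrite cosh_distE//; try exact: Hg.
  rewrite g0/= expr0n/= !addr0 !mulr0 !mulr1 addr0 subr0 mulr0 subr0 mulr1 -/(m s).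
  have -> : (g s).1 ^+ 2 + (g s).2 ^+ 2 = 1 - m s by rewrite /m; lra.
  by field; rewrite gt_eqF// m0.
have mV (s : R) : 0 <= s -> m s = 2 / (1 + cosh s).
  move=> s0; have := mE s s0; have := cosh_gt0 s => c0 <-; field.
  by rewrite gt_eqF// addr_gt0.
pose e : R * R := (2 * (g 1).1 / m 1 / sinh 1, 2 * (g 1).2 / m 1 / sinh 1).
have gE (s : R) : 0 <= s -> g s = (ray_param s * e.1, ray_param s * e.2).
  move=> s0; have := cg _ _ s0 ler01; rewrite coshB.
  have s1 : 0 < sinh 1 :> R by rewrite sinh_gt0.
  have c2 := cosh2Bsinh2 s; have c21 := @cosh2Bsinh2 R 1.
  have cs := cosh_gt0 s; have c1 := @cosh_gt0 R 1.
  rewrite cosh_distE; try exact: Hg; try exact: Hg ler01.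
  rewrite -/(m s) -/(m 1).
  have -> : (g s).1 ^+ 2 + (g s).2 ^+ 2 = 1 - m s by rewrite /m; lra.
  have -> : (g 1).1 ^+ 2 + (g 1).2 ^+ 2 = 1 - m 1 by rewrite /m; lra.
  have nE (u : R) : (g u).1 ^+ 2 + (g u).2 ^+ 2 = 1 - m u by rewrite /m; lra.
  have := nE s; have := nE 1; rewrite /e.
  have ms := mV s s0; have m1 := mV 1 ler01.
  have rE : ray_param s = sinh s / (1 + cosh s).
    rewrite /ray_param /sinh /cosh expRN; have := expR_gt0 s.
    move: (expR s) => p p0; field; rewrite !gt_eqF//; try lra.
    by nra.
  rewrite rE; case: (g s) => a b; case: (g 1) => a1 b1 /=; rewrite {}ms {}m1.
  move: (cosh s) (sinh s) (cosh 1) (sinh 1) s1 c2 c21 cs c1 => c' s' c k.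
  move=> sp c2 c21 cp cp1 n1 n2 E.
  have cp0 : 1 + c' != 0 by rewrite gt_eqF// addr_gt0.
  have cp10 : 1 + c != 0 by rewrite gt_eqF// addr_gt0.
  (* [(A, B)] and [(A1, B1)] are the spatial parts of points of the hyperboloid. *)
  pose A := a * (1 + c'); pose B := b * (1 + c').
  pose A1 := a1 * (1 + c); pose B1 := b1 * (1 + c).
  have nA : A ^+ 2 + B ^+ 2 = s' ^+ 2.
    have -> : A ^+ 2 + B ^+ 2 = (a ^+ 2 + b ^+ 2) * (1 + c') ^+ 2 by rewrite /A /B; ring.
    by rewrite n2; transitivity (c' ^+ 2 - 1); [field|lra].
  have nA1 : A1 ^+ 2 + B1 ^+ 2 = k ^+ 2.
    have -> : A1 ^+ 2 + B1 ^+ 2 = (a1 ^+ 2 + b1 ^+ 2) * (1 + c) ^+ 2 by rewrite /A1 /B1; ring.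
    by rewrite n1; transitivity (c ^+ 2 - 1); [field|lra].
  have AA1 : A * A1 + B * B1 = s' * k.
    suff : c' * c - (A * A1 + B * B1) = c' * c - s' * k by lra.
    rewrite -E /A /B /A1 /B1; field; by rewrite cp0 cp10.
  have : (k * A - s' * A1) ^+ 2 + (k * B - s' * B1) ^+ 2 = 0.
    transitivity (k ^+ 2 * (A ^+ 2 + B ^+ 2) - 2 * k * s' * (A * A1 + B * B1) +
       s' ^+ 2 * (A1 ^+ 2 + B1 ^+ 2)).
      by ring.
    by rewrite nA nA1 AA1; ring.
  move=> /eqP; rewrite paddr_eq0 ?sqr_ge0// !sqrf_eq0 !subr_eq0 => /andP[/eqP h1 /eqP h2].
  have aE : a = s' * A1 / k / (1 + c') by rewrite -h1 /A; field; rewrite cp0 gt_eqF.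
  have bE : b = s' * B1 / k / (1 + c') by rewrite -h2 /B; field; rewrite cp0 gt_eqF.
  by rewrite aE bE /A1 /B1; congr pair; field; rewrite cp0 cp10 gt_eqF.
have le : g s @[s --> +oo] --> e.
  have := @cvg_ray_point e.1 e.2; rewrite -surjective_pairing => le'.
  apply: cvg_trans le'; apply: near_eq_cvg.
  near=> s; rewrite gE//; near: s; exact: nbhs_pinfty_ge.
have eE : e = (cos theta, sin theta).
  apply: (cvg_unique _ le lg); exact: norm_hausdorff.
by move=> /gE ->; rewrite eE.
Unshelve. all: by end_near. Qed.

Lemma L_inftyE theta :
  L_infty theta = [set ray_point theta s | s in [set s | 0 <= s < 1]].
Proof.
apply/seteqP; split=> z.
  move=> [g [rg [t t0 ->]]]; exists (ray_param t); first exact: ray_param_itv.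
  by rewrite (geodesic_ray_unique rg).
move=> [s /ray_param_surj[t t0 ->] <-].
exists (fun t => ray_point theta (ray_param t)).
by split; [exact: geodesic_ray_point|exists t].
Qed.

End rays.

(** * Distance from a point to a ray, as a function of the direction *)

Section threshold.
Context {R : realType}.
Implicit Types (theta s r K : R) (z : R * R).

Definition sqnorm z : R := z.1 ^+ 2 + z.2 ^+ 2.
Definition dot theta z : R := z.1 * cos theta + z.2 * sin theta.
Definition cross theta z : R := z.1 * sin theta - z.2 * cos theta.

(* The hyperbolic sine of the distance from [z] to the ray of direction
   [theta]: an open ball centred at [z] meets the ray if and only if the
   hyperbolic sine of its radius exceeds this threshold. *)
Definition threshold theta z : R :=
  2 * Num.sqrt (sqnorm z - Num.max 0 (dot theta z) ^+ 2) / (1 - sqnorm z).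

Lemma sqnorm_ge0 z : 0 <= sqnorm z.
Proof. by rewrite addr_ge0// sqr_ge0. Qed.

Lemma dotD theta (a : R) z :
  dot (theta + a) z = dot theta z * cos a - cross theta z * sin a.
Proof. by rewrite /dot /cross cosD sinD; ring. Qed.

Lemma dot_cross theta z : dot theta z ^+ 2 + cross theta z ^+ 2 = sqnorm z.
Proof.
transitivity (sqnorm z * (cos theta ^+ 2 + sin theta ^+ 2)).
  by rewrite /dot /cross /sqnorm; ring.
by rewrite cos2Dsin2 mulr1.
Qed.

Lemma dot_sqr_le theta z : Num.max 0 (dot theta z) ^+ 2 <= sqnorm z.
Proof.
have := dot_cross theta z; have := sqr_ge0 (cross theta z).
by rewrite /Num.max; case: ifP => _; rewrite ?expr0n/=; have := sqnorm_ge0 z; lra.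
Qed.

Lemma threshold_ge0 theta z : H2 z -> 0 <= threshold theta z.
Proof. by move=> Hz; rewrite divr_ge0 ?mulr_ge0 ?sqrtr_ge0// subr_ge0 ltW. Qed.

Lemma threshold_sqr theta z : H2 z -> 1 + threshold theta z ^+ 2 =
  ((1 + sqnorm z) ^+ 2 - 4 * Num.max 0 (dot theta z) ^+ 2) / (1 - sqnorm z) ^+ 2.
Proof.
move=> Hz; have D0 : 0 < 1 - sqnorm z by rewrite subr_gt0.
rewrite /threshold exprMn exprVn exprMn sqr_sqrtr ?subr_ge0 ?dot_sqr_le//.
by field; rewrite gt_eqF.
Qed.

Lemma threshold_dot_gt0 theta z : H2 z -> 0 < dot theta z ->
  threshold theta z = 2 * `|cross theta z| / (1 - sqnorm z).
Proof.
move=> Hz d0; rewrite /threshold max_r ?ltW//.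
by rewrite -(dot_cross theta z) [X in Num.sqrt X]addrC addKr sqrtr_sqr.
Qed.

Lemma cosh_dist_ray theta s z : H2 z -> 0 <= s < 1 ->
  cosh_dist z (ray_point theta s) =
  ((1 + sqnorm z) * (1 + s ^+ 2) - 4 * s * dot theta z) /
  ((1 - sqnorm z) * (1 - s ^+ 2)).
Proof.
move=> Hz s01; rewrite cosh_distE//; last exact: ray_point_H2.
by rewrite ray_point_norm /dot /sqnorm /=; congr (_ / _); ring.
Qed.

Lemma cosh_dist_ray_ge theta s z : H2 z -> 0 <= s < 1 ->
  1 + threshold theta z ^+ 2 <= cosh_dist z (ray_point theta s) ^+ 2.
Proof.
move=> Hz s01; rewrite threshold_sqr// cosh_dist_ray//.
have D0 : 0 < 1 - sqnorm z by rewrite subr_gt0.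
have N0 := sqnorm_ge0 z; case/andP: s01 => s0 s1.
have E0 : 0 < 1 - s ^+ 2 by rewrite subr_gt0 expr_lt1.
have -> : forall Y, (Y / ((1 - sqnorm z) * (1 - s ^+ 2))) ^+ 2 =
    Y ^+ 2 / (1 - s ^+ 2) ^+ 2 / (1 - sqnorm z) ^+ 2.
  by move=> Y; field; rewrite !gt_eqF.
rewrite ler_pM2r ?invr_gt0 ?exprn_gt0// ler_pdivlMr ?exprn_gt0//.
set A := 1 + sqnorm z; set d := dot theta z.
have [d0|d0] := leP d 0.
  rewrite expr0n/= mulr0 subr0 -exprMn ler_sqr ?nnegrE.
    have A0 : 0 <= A by rewrite addr_ge0.
    have h1 : 0 <= s * - d by rewrite mulr_ge0 ?oppr_ge0.
    have h2 := mulr_ge0 A0 (sqr_ge0 s); nra.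
    by rewrite mulr_ge0// ?(ltW E0)// addr_ge0.
  by have := mulr_ge0 s0 s0; rewrite /A; nra.
(* The two sides differ by four times this square, which vanishes at the foot of the
   perpendicular. *)
have := sqr_ge0 (A * s - d * (1 + s ^+ 2)); nra.
Qed.

(** If the ray points away from [z], its nearest point is the origin and no other. A ball that
    touches such a ray touches it at the origin only, and this does not obstruct it. *)
Lemma cosh_dist_ray_gt theta s z : H2 z -> 0 < s < 1 -> dot theta z <= 0 ->
  1 + threshold theta z ^+ 2 < cosh_dist z (ray_point theta s) ^+ 2.
Proof.
move=> Hz /andP[s0 s1] d0.
have s01 : 0 <= s < 1 by rewrite ltW.
rewrite threshold_sqr// cosh_dist_ray//.
have D0 : 0 < 1 - sqnorm z by rewrite subr_gt0.
have N0 := sqnorm_ge0 z.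
have E0 : 0 < 1 - s ^+ 2 by rewrite subr_gt0 expr_lt1// ltW.
rewrite (max_l d0) expr0n/= mulr0 subr0 -expr_div_n ltr_sqr ?nnegrE.
- have -> : forall Y, Y / ((1 - sqnorm z) * (1 - s ^+ 2)) =
      Y / (1 - s ^+ 2) / (1 - sqnorm z).
    by move=> Y; field; rewrite !gt_eqF.
  rewrite ltr_pM2r ?invr_gt0// ltr_pdivlMr//.
  have : 0 < s ^+ 2 by rewrite exprn_gt0.
  have : 0 <= s * - dot theta z by rewrite mulr_ge0 ?oppr_ge0// ltW.
  nra.
- by rewrite divr_ge0 ?(ltW D0)// addr_ge0.
- rewrite divr_ge0 ?mulr_ge0 ?(ltW D0) ?(ltW E0)//.
  have := sqr_ge0 s; have : 0 <= s * - dot theta z by rewrite mulr_ge0 ?oppr_ge0// ltW.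
  nra.
Qed.

Lemma cosh_dist_ray_attained theta z : H2 z -> exists2 s, 0 <= s < 1 &
  cosh_dist z (ray_point theta s) ^+ 2 = 1 + threshold theta z ^+ 2.
Proof.
move=> Hz; have D0 : 0 < 1 - sqnorm z by rewrite subr_gt0.
have N0 := sqnorm_ge0 z.
set A := 1 + sqnorm z; set m := Num.max 0 (dot theta z).
have m0 : 0 <= m by rewrite le_max lexx.
have mn : m ^+ 2 <= sqnorm z by exact: dot_sqr_le.
have Am : 0 < A ^+ 2 - 4 * m ^+ 2.
  have : 0 < (1 - sqnorm z) ^+ 2 by rewrite exprn_gt0.
  by rewrite /A; nra.
pose S := Num.sqrt (A ^+ 2 - 4 * m ^+ 2).
have S0 : 0 < S by rewrite sqrtr_gt0.
have S2 : S ^+ 2 = A ^+ 2 - 4 * m ^+ 2 by rewrite sqr_sqrtr// ltW.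
have A0 : 0 < A by rewrite /A; lra.
have AS : 0 < A + S by rewrite addr_gt0.
have s01 : 0 <= 2 * m / (A + S) < 1.
  rewrite divr_ge0 ?mulr_ge0 ?(ltW AS)//= ltr_pdivrMr// mul1r.
  have : 2 * m < A.
    rewrite -ltr_sqr ?nnegrE ?(ltW A0) ?mulr_ge0//; nra.
  lra.
(* The smaller root of [m * (1 + s ^ 2) = A * s], where the square in [cosh_dist_ray_ge] vanishes.
   This form of the root also covers [m = 0], where it is the origin. *)
exists (2 * m / (A + S)) => //.
rewrite cosh_dist_ray// threshold_sqr// -/A -/m.
have -> : 4 * (2 * m / (A + S)) * dot theta z = 4 * (2 * m / (A + S)) * m.
  rewrite /m; have [d0|d0] := leP (dot theta z) 0; last by rewrite ?(max_r (ltW d0)).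
  by rewrite ?(max_l d0) !mulr0 !mul0r mulr0 mul0r.
have sE : (2 * m / (A + S)) ^+ 2 = (A - S) / (A + S).
  have -> : (2 * m / (A + S)) ^+ 2 = (4 * m ^+ 2) / (A + S) ^+ 2.
    by field; rewrite gt_eqF.
  have -> : 4 * m ^+ 2 = A ^+ 2 - S ^+ 2 by lra.
  by field; rewrite gt_eqF.
have mE : 4 * (2 * m / (A + S)) * m = 2 * (A - S).
  have -> : 4 * (2 * m / (A + S)) * m = 2 * (4 * m ^+ 2) / (A + S).
    by field; rewrite gt_eqF.
  have -> : 4 * m ^+ 2 = A ^+ 2 - S ^+ 2 by lra.
  by field; rewrite gt_eqF.
rewrite sE mE -S2; field.
rewrite !gt_eqF//= ?andbT.
by move: S0; lra.
Qed.

(** The unit vector of direction [b] is a combination of those of directions [a] and [c] with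
    coefficients [sin (c - b) / sin (c - a)] and [sin (b - a) / sin (c - a)]. These are nonnegative,
    and their sum is at least 1 by subadditivity of the sine. *)
Lemma dot_quasiconcave (a b c : R) z : a <= b <= c -> c - a < pi ->
  Num.min (Num.max 0 (dot a z)) (Num.max 0 (dot c z)) <= Num.max 0 (dot b z).
Proof.
move=> /andP[ab bc] ca.
have [ac|ac] := eqVneq a c.
  have -> : b = c by apply/le_anti; rewrite bc -ac ab.
  rewrite ac.
  by rewrite minxx.
have sac : 0 < sin (c - a) by apply: sin_gt0_pi; lra.
have sab : 0 <= sin (b - a) by apply: sin_ge0_pi; lra.
have sbc : 0 <= sin (c - b) by apply: sin_ge0_pi; lra.
have key : sin (c - a) * dot b z = sin (c - b) * dot a z + sin (b - a) * dot c z.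
  have -> : dot a z = dot (b + (a - b)) z by congr dot; ring.
  have -> : dot c z = dot (b + (c - b)) z by congr dot; ring.
  rewrite !dotD -(opprB b a) cosN sinN.
  have -> : sin (c - a) = sin ((c - b) + (b - a)) by congr sin; ring.
  by rewrite sinD; ring.
have sle : sin (c - a) <= sin (c - b) + sin (b - a).
  have -> : sin (c - a) = sin ((c - b) + (b - a)) by congr sin; ring.
  rewrite sinD; have := cos_le1 (b - a); have := cos_le1 (c - b); nra.
have [a0|a0] := leP (dot a z) 0.
  by rewrite ge_min le_max lexx.
have [c0|c0] := leP (dot c z) 0.
  by rewrite ge_min [X in _ || X]le_max lexx orbT.
rewrite le_max; apply/orP; right.
rewrite -(ler_pM2l sac) key.
set m := Num.min _ _.
have ma : m <= dot a z by rewrite ge_min lexx.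
have mc : m <= dot c z by rewrite ge_min lexx orbT.
have m0 : 0 <= m by rewrite le_min !ltW.
apply: (@le_trans _ _ ((sin (c - b) + sin (b - a)) * m)).
  by rewrite ler_wpM2r.
by rewrite mulrDl lerD// ler_wpM2l.
Qed.

Lemma threshold_le (a b : R) z : H2 z ->
  Num.max 0 (dot a z) <= Num.max 0 (dot b z) -> threshold b z <= threshold a z.
Proof.
move=> Hz ab; rewrite /threshold ler_pM2r ?invr_gt0 ?subr_gt0//.
rewrite ler_pM2l// ler_wsqrtr// lerB// ler_sqr// nnegrE le_max lexx//.
Qed.

Lemma threshold_lt (a b : R) z : H2 z -> 0 < dot a z ->
  dot a z < dot b z -> threshold b z < threshold a z.
Proof.
move=> Hz a0 ab; rewrite /threshold ltr_pM2r ?invr_gt0 ?subr_gt0//.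
have b0 := lt_trans a0 ab.
rewrite ltr_pM2l// (max_r (ltW a0)) (max_r (ltW b0)).
have sab : dot a z ^+ 2 < dot b z ^+ 2 by rewrite ltr_sqr ?nnegrE ?ltW.
have := dot_sqr_le b z; rewrite (max_r (ltW b0)) => db.
by rewrite ltr_sqrt; lra.
Qed.

Lemma threshold_quasiconvex (a b c : R) z : H2 z -> a <= b <= c -> c - a < pi ->
  threshold b z <= Num.max (threshold a z) (threshold c z).
Proof.
move=> Hz abc ca; have := dot_quasiconcave z abc ca.
by rewrite ge_min => /orP[] /(threshold_le Hz) h; rewrite le_max h ?orbT.
Qed.

Lemma continuous_threshold z : continuous (threshold ^~ z).
Proof.
move=> theta.
have cd : {for theta, continuous (fun s => dot s z)}.
  have cc : {for theta, continuous (@cos R)} by exact: continuous_cos.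
  have cs : {for theta, continuous (@sin R)} by exact: continuous_sin.
  by rewrite /dot; continuous_tac.
have cm : {for theta, continuous (fun s => Num.max 0 (dot s z))}.
  exact: (@continuous_max _ _ (fun=> 0) (fun s => dot s z) theta (cvg_cst _) cd).
suff : {for theta, continuous (fun s => threshold s z)} by [].
by rewrite /threshold; continuous_tac.
Qed.

Lemma measurable_inv : measurable_fun setT (@GRing.inv R).
Proof.
rewrite -(setUv [set (0 : R)]); apply/measurable_funU => //.
  exact: measurableC.
split; first exact: measurable_fun_set1.
apply: open_continuous_measurable_fun; first exact/closed_openC/closed_eq.
by move=> x; rewrite inE/= => /eqP x0; exact: inv_continuous.
Qed.

Lemma measurable_threshold theta : measurable_fun setT (threshold theta).
Proof.
have m1 : measurable_fun setT (fun z : R * R => z.1) by exact: measurable_fst.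
have m2 : measurable_fun setT (fun z : R * R => z.2) by exact: measurable_snd.
have mn : measurable_fun setT sqnorm.
  by apply: measurable_funD; exact: measurable_funX.
apply: measurable_funM.
  apply: measurable_funM; first exact: measurable_cst.
  apply: (@measurableT_comp _ _ _ _ _ _ (@Num.sqrt R)).
    by apply: continuous_measurable_fun; exact: sqrt_continuous.

  apply: measurable_funB => //; apply: measurable_funX; apply: measurable_maxr => //.
  by apply: measurable_funD; apply: measurable_funM.
apply: (@measurableT_comp _ _ _ _ _ _ (@GRing.inv R)); first exact: measurable_inv.
exact: measurable_funB.
Qed.

(* The threshold strictly decreases on one side of a direction tangent to a
   ball: such a direction is an endpoint of the shadow of the ball. *)
Lemma threshold_lt_side theta z : H2 z -> 0 < dot theta z ->
    0 < threshold theta z -> exists2 eta, 0 < eta &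
  (forall a, theta - eta < a < theta -> threshold a z < threshold theta z) \/
  (forall a, theta < a < theta + eta -> threshold a z < threshold theta z).
Proof.
move=> Hz d0; rewrite threshold_dot_gt0// => c0.
have {}c0 : 0 < `|cross theta z|.
  by move: c0; rewrite pmulr_lgt0 ?invr_gt0 ?subr_gt0// pmulr_rgt0.
have key (k : R) : 0 < k -> exists2 eta, 0 < eta & forall a, 0 < a < eta ->
    dot theta z < dot theta z * cos a + k * sin a.
  move=> k0.
  (* By the half-angle formulas the increment to be shown positive is [2 * sin (a / 2) * f (a / 2)],
     so the sign of [f] near 0 suffices. *)
  pose f (a : R) : R := k * cos a - dot theta z * sin a.
  have cf : {for 0, continuous f}.
    have cc : {for 0, continuous (@cos R)} by exact: continuous_cos.
    have cs : {for 0, continuous (@sin R)} by exact: continuous_sin.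
    by rewrite /f; continuous_tac.
  have f0 : 0 < f 0 by rewrite /f cos0 sin0 mulr1 mulr0 subr0.
  have : \forall a \near (0:R), 0 < f a by move: cf => /cvgr_gt; apply.
  move=> /nbhs_ballP[e /= e0 He].
  exists (Num.min e pi); first by rewrite lt_min e0 pi_gt0.
  move=> a /andP[a0]; rewrite lt_min => /andP[ae api].
  have : 0 < f (a / 2).
    apply: He; rewrite /ball/= sub0r normrN gtr0_norm ?divr_gt0//; lra.
  have s0 : 0 < sin (a / 2) by apply: sin_gt0_pi; lra.
  rewrite /f => fa; have -> : a = a / 2 + a / 2 by field.
  rewrite cosD sinD; have := cos2Dsin2 (a / 2).
  move: (cos _) (sin _) s0 fa => c s s0 fa cs.
  rewrite -subr_gt0.
  have -> : dot theta z * (c * c - s * s) + k * (s * c + c * s) - dot theta z =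
    2 * s * (k * c - dot theta z * s).
    have -> : dot theta z * (c * c - s * s) + k * (s * c + c * s) - dot theta z =
      dot theta z * (c * c - s * s) + k * (s * c + c * s) - dot theta z * (c ^+ 2 + s ^+ 2).
      by rewrite cs mulr1.
    by ring.
  by rewrite mulr_gt0// mulr_gt0.
have [eta eta0 Heta] := key _ c0.
exists eta => //.
have sub (a b : R) : dot theta z < dot b z -> a = b -> threshold a z < 2 * `|cross theta z| / (1 - sqnorm z).
  by move=> + ->; rewrite -threshold_dot_gt0//; exact: threshold_lt.
have [x0|x0] := ltP 0 (cross theta z).
- left=> a aeta; apply: (@sub _ (theta + (- (theta - a)))); last by ring.
  rewrite dotD cosN sinN mulrN opprK.
  have := Heta (theta - a); rewrite (gtr0_norm x0); apply; lra.
- right=> a aeta; apply: (@sub _ (theta + (a - theta))); last by ring.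
  rewrite dotD -mulNr.
  have := Heta (a - theta); rewrite (ler0_norm x0); apply; lra.
Qed.

End threshold.

Section visibility.
Context {d} {T : measurableType d} {R : realType}.
Implicit Types (theta : R) (xi : nat -> T -> R * R) (rho : nat -> T -> R) (w : T).

Lemma open_ball_nbhs (z p : R * R) (r : R) : H2 z -> H2 p -> 0 < r ->
  cosh_dist z p < cosh r ->
  nbhs p [set q | H2 q /\ cosh_dist z q < cosh r].
Proof.
move=> Hz Hp r0 zp.
have D0 : 0 < 1 - sqnorm z by rewrite subr_gt0.
have c1 : 1 < cosh r by rewrite -(@cosh0 R) lt_cosh// ltW.
pose N (q : R * R) : R := (q.1 - z.1) ^+ 2 + (q.2 - z.2) ^+ 2.
pose E (q : R * R) : R := 1 - (q.1 ^+ 2 + q.2 ^+ 2).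
(* The inequality on [cosh_dist] with denominators cleared: [f] is a polynomial, hence continuous
   everywhere, and [0 < f q] by itself forces [q] into the disc. *)
pose f (q : R * R) : R := (cosh r - 1) * (1 - sqnorm z) * E q - 2 * N q.
have k0 : 0 < (cosh r - 1) * (1 - sqnorm z) by rewrite mulr_gt0// subr_gt0.
have fE q : 0 < E q -> (0 < f q) = (cosh_dist z q < cosh r).
  move=> E0; rewrite /f subr_gt0 /cosh_dist -ltrBrDl.
  by rewrite ltr_pdivrMr ?mulr_gt0// mulrA.
have cf : {for p, continuous f}.
  have cx : {for p, continuous (fun q : R * R => q.1)} by exact: cvg_fst.
  have cy : {for p, continuous (fun q : R * R => q.2)} by exact: cvg_snd.
  by rewrite /f /E /N; continuous_tac.
have fp : 0 < f p by rewrite fE// subr_gt0.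
have : \forall q \near p, 0 < f q by move: cf => /cvgr_gt; apply.
apply: filterS => q fq.
have Eq : 0 < E q.
  rewrite ltNge; apply/negP => Eq0; move: fq; apply/negP; rewrite -leNgt.
  rewrite /f subr_le0 (@le_trans _ _ 0)// ?mulr_ge0 ?addr_ge0 ?sqr_ge0//.
  by rewrite pmulr_rle0.
by split; [rewrite /H2/= -subr_gt0|rewrite -fE].
Qed.

(** If the threshold were smaller, the open ball would contain a point of the ray together with a
    neighbourhood. This point would not be in the closure of the unoccupied set. *)
Lemma threshold_of_visible xi rho w theta : (forall n, 0 < rho n w) ->
  L_infty theta `<=` vacant_set xi rho w ->
  forall n, H2 (xi n w) -> sinh (rho n w) <= threshold theta (xi n w).
Proof.
move=> rho0 vis n Hn; rewrite leNgt; apply/negP => lt.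
have [s s01 sE] := cosh_dist_ray_attained theta Hn.
have Hp := ray_point_H2 theta s01.
have dlt : cosh_dist (xi n w) (ray_point theta s) < cosh (rho n w).
  rewrite -ltr_sqr ?nnegrE ?(ltW (cosh_gt0 _))//; last first.
    exact: le_trans (cosh_dist_ge1 Hn Hp).
  have := cosh2Bsinh2 (rho n w); rewrite sE => /(canRL (subrK _)) ->.
  by rewrite ltrD2l ltr_sqr ?nnegrE ?threshold_ge0// sinh_ge0 ltW.
have [_ /(_ _ (open_ball_nbhs Hn Hp (rho0 n) dlt))] : vacant_set xi rho w (ray_point theta s).
  by apply: vis; rewrite L_inftyE; exists s.
move=> [q [[Hq nq] [_ qlt]]]; apply: nq; exists n => //.
by split=> //; rewrite hyp_dist_le// ?ltW.
Qed.

(** All points of the ray other than the origin avoid every closed ball. The origin may be touched,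
    but it is a limit of those points; this is where the closure in the vacant set matters. *)
Lemma visible_of_threshold xi rho w theta : (forall n, 0 < rho n w) ->
  (forall n, H2 (xi n w) -> sinh (rho n w) < threshold theta (xi n w) \/
     sinh (rho n w) = threshold theta (xi n w) /\ dot theta (xi n w) <= 0) ->
  L_infty theta `<=` vacant_set xi rho w.
Proof.
move=> rho0 hyp.
have away (s : R) : 0 < s < 1 -> (H2 `\` occupied_set xi rho w) (ray_point theta s).
  move=> /andP[s0 s1]; have s01 : 0 <= s < 1 by rewrite ltW.
  have Hp := ray_point_H2 theta s01; split=> // -[n Hn [_]].
  rewrite (hyp_dist_le Hn Hp (ltW (rho0 n))) leNgt => /negP; apply.
  rewrite -ltr_sqr ?nnegrE ?(ltW (cosh_gt0 _))//; last first.
    exact: le_trans (cosh_dist_ge1 Hn Hp).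
  have := cosh2Bsinh2 (rho n w) => /(canRL (subrK _)) ->.
  have [lt|[-> dn]] := hyp n Hn; last by apply: cosh_dist_ray_gt => //; rewrite s0.
  apply: lt_le_trans (cosh_dist_ray_ge theta Hn s01).
  by rewrite ltrD2l ltr_sqr ?nnegrE ?threshold_ge0// sinh_ge0 ltW.
rewrite L_inftyE => _ [s /= s01 <-]; split; first exact: ray_point_H2.
have [s0|s0] := leP s 0; last first.
  by apply: subset_closure; apply: away; move: s01 => /andP[_ ->]; rewrite s0.
have -> : s = 0 by apply/le_anti; rewrite s0; case/andP: s01.
move=> B B0.
have c0 : {for (0 : R), continuous (ray_point theta)}.
  have ct : {for (0 : R), continuous (fun t : R => t * cos theta)} by continuous_tac.
  have st : {for (0 : R), continuous (fun t : R => t * sin theta)} by continuous_tac.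
  exact: (cvg_pair ct st).
have /nbhs_ballP[e /= e0 He] := c0 _ B0.
pose t := Num.min (e / 2) (1 / 2).
have t0 : 0 < t by rewrite lt_min !divr_gt0.
exists (ray_point theta t); split.
  apply: away; rewrite t0/= gt_min; apply/orP; right; lra.
apply: He; rewrite /ball/= sub0r normrN gtr0_norm//.
by rewrite gt_min; apply/orP; left; lra.
Qed.

Lemma endpoint_of_not_visible xi rho w theta : (forall n, 0 < rho n w) ->
  (forall n, H2 (xi n w) -> sinh (rho n w) <= threshold theta (xi n w)) ->
  ~ (L_infty theta `<=` vacant_set xi rho w) ->
  exists n, [/\ H2 (xi n w), sinh (rho n w) = threshold theta (xi n w)
    & 0 < dot theta (xi n w)].
Proof.
move=> rho0 le nvis; apply/not_existsP => H; apply: nvis.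
apply: visible_of_threshold => // n Hn; have := le n Hn.
rewrite le_eqVlt => /predU1P[e|->]; last by left.
right; split=> //; rewrite leNgt; apply/negP => d0; exact: (H n).
Qed.

End visibility.

(** * Dyadic grid of directions *)

Section grid.
Context {R : realType} (eps : R).
Hypothesis heps : 0 < eps < pi.
Variables (x : nat -> R * R) (K : nat -> R).
Implicit Types (theta : R) (k j : nat).

Definition grid k j : R := eps * j%:R / 2 ^+ k.

Let eps0 : 0 < eps. Proof. by case/andP: heps. Qed.

Lemma le_grid k i j : (i <= j)%N -> grid k i <= grid k j.
Proof.
move=> ij; rewrite /grid ler_pM2r ?invr_gt0 ?exprn_gt0//.
by rewrite ler_pM2l// ler_nat.
Qed.

Lemma grid_max k : grid k (2 ^ k) = eps.
Proof. by rewrite /grid natrX mulfK// expf_neq0. Qed.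

Lemma grid0 k : grid k 0 = 0.
Proof. by rewrite /grid mulr0 mul0r. Qed.

Lemma grid_itv k j : (j <= 2 ^ k)%N -> 0 <= grid k j <= eps.
Proof.
move=> jk; have := le_grid k jk; rewrite grid_max => ->.
by rewrite -(grid0 k) le_grid.
Qed.

Lemma gridS k j : grid k.+1 (j.*2) = grid k j.
Proof. by rewrite /grid exprS -muln2 natrM; field; rewrite expf_neq0. Qed.

Lemma grid_locate_right k theta : 0 <= theta < eps ->
  exists2 j, (j < 2 ^ k)%N & grid k j <= theta < grid k j.+1.
Proof.
move=> /andP[t0 t1]; pose y := theta * 2 ^+ k / eps.
have y0 : 0 <= y by rewrite divr_ge0 ?mulr_ge0 ?exprn_ge0// ltW.
have yE (j : R) : eps * j / 2 ^+ k <= theta = (j <= y).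
  by rewrite /y ler_pdivrMr ?exprn_gt0// ler_pdivlMr// mulrC.
have /andP[j1 j2] := truncn_itv y0.
have gj : grid k (Num.truncn y) <= theta < grid k (Num.truncn y).+1.
  by rewrite /grid yE j1/= ltNge yE -ltNge.
exists (Num.truncn y) => //.
rewrite ltnNge; apply/negP => /(le_grid k); rewrite grid_max => h.
by move: gj => /andP[/(le_trans h)]; rewrite leNgt t1.
Qed.

(** The grid is symmetric under [theta |-> eps - theta], which exchanges cells closed on the left
    and cells closed on the right. *)
Lemma grid_locate_left k theta : 0 < theta <= eps ->
  exists2 j, (j < 2 ^ k)%N & grid k j < theta <= grid k j.+1.
Proof.
move=> /andP[t0 t1].
have [|j jk /andP[j1 j2]] := @grid_locate_right k (eps - theta).
  by rewrite subr_ge0 t1/= ltrBlDr ltrDl.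
have rE i : (i <= 2 ^ k)%N -> grid k (2 ^ k - i) = eps - grid k i.
  by move=> ik; rewrite /grid natrB// natrX; field; rewrite expf_neq0.
exists (2 ^ k - j.+1)%N; first by rewrite ltn_subrL/= expn_gt0.
rewrite subnSK// !rE//; last exact: ltnW.
apply/andP; split; lra.
Qed.

Definition grid_visible k j : Prop := forall n, H2 (x n) ->
  K n <= Num.max (threshold (grid k j) (x n)) (threshold (grid k j.+1) (x n)).

Lemma grid_visible_of_visible k j theta : (j < 2 ^ k)%N ->
  grid k j <= theta <= grid k j.+1 ->
  (forall n, H2 (x n) -> K n <= threshold theta (x n)) -> grid_visible k j.
Proof.
move=> jk tj vis n Hn; apply: le_trans (vis n Hn) _.
apply: threshold_quasiconvex => //.
have /andP[g0 _] := grid_itv (ltnW jk); have /andP[_ g1] := grid_itv jk.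
by case/andP: heps; lra.
Qed.

Lemma grid_visible_half k j : (j < 2 ^ k.+1)%N ->
  grid_visible k.+1 j -> grid_visible k j./2.
Proof.
move=> jk vis n Hn; apply: le_trans (vis n Hn) _.
have hk : (j./2 < 2 ^ k)%N by rewrite ltn_half_double -mul2n -expnS.
have e1 : grid k j./2 <= grid k.+1 j.
  by rewrite -gridS le_grid// -{2}(odd_double_half j) leq_addl.
have e2 : grid k.+1 j.+1 <= grid k (j./2).+1.
  rewrite -(gridS k (j./2).+1) le_grid// doubleS -{1}(odd_double_half j).
  by rewrite -addn2 addnC ltn_add2l; case: (odd j).
have e3 := le_grid k.+1 (leqnSn j).
have /andP[g0 _] := grid_itv (ltnW hk); have /andP[_ g1] := grid_itv hk.
have ce : grid k (j./2).+1 - grid k j./2 < pi by case/andP: heps; lra.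
rewrite ge_max; apply/andP; split; apply: threshold_quasiconvex => //.
  by rewrite e1 (le_trans e3).
by rewrite e2 (le_trans e1).
Qed.

(** From right to left by compactness: the left ends of the visible cells accumulate at some
    [theta]. A ball obstructing [theta] would, by continuity of the threshold, obstruct both ends of
    every fine cell near [theta], against [grid_visible]. Cells of different scales need not be
    nested. *)
Lemma visibleP :
  (exists2 theta, 0 <= theta <= eps &
     forall n, H2 (x n) -> K n <= threshold theta (x n)) <->
  (forall k, exists2 j, (j < 2 ^ k)%N & grid_visible k j).
Proof.
split=> [[theta /andP[t0 t1] vis] k|].
  have [te|te] := ltP theta eps.
    have [|j jk /andP[j1 j2]] := @grid_locate_right k theta; first by rewrite t0.
    by exists j => //; apply: (@grid_visible_of_visible _ _ theta) => //; rewrite j1 ltW.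
  have [|j jk /andP[j1 j2]] := @grid_locate_left k theta.
    by rewrite t1 andbT (lt_le_trans eps0).
  by exists j => //; apply: (@grid_visible_of_visible _ _ theta) => //; rewrite j2 ltW.
move=> vis.
pose J k := s2val (cid2 (vis k)).
have JP k : (J k < 2 ^ k)%N /\ grid_visible k (J k).
  by rewrite /J; case: cid2.
pose u k := grid k (J k).
have u01 k : `[0, eps]%classic (u k).
  by rewrite /= in_itv/=; apply: grid_itv; have [/ltnW] := JP k.
have [theta [t01 tc]] : `[0, eps]%classic `&` cluster (u @ \oo) !=set0.
  apply: (@segment_compact R 0 eps (u @ \oo)).
  by exists 0%N => // k _; exact: u01.
exists theta; first by move: t01; rewrite /= in_itv.
move=> n Hn; rewrite leNgt; apply/negP => lt.
have : \forall a \near theta, threshold a (x n) < K n.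
  by have := @continuous_threshold R (x n) theta => /cvgr_lt; apply.
move=> /nbhs_ballP[e /= e0 He].
have [N NP] : exists N, forall k, (N <= k)%N -> eps / 2 ^+ k < e / 2.
  have : (eps * (2^-1) ^+ k) @[k --> \oo] --> eps * 0.
    by apply: cvgM; [exact: cvg_cst|apply: cvg_expr; rewrite gtr0_norm// invf_lt1// ltr1n].
  rewrite mulr0 => /cvgr_lt /(_ (e / 2)) [|N _ HN]; first by rewrite divr_gt0.
  by exists N => k /HN /=; rewrite exprVn.
have [] := tc [set u k | k in [set k | (N <= k)%N]] (ball theta (e / 2)).
- by exists N => // k /= Nk; exists k.
- by apply: nbhsx_ballx; rewrite divr_gt0.
move=> _ [[k /= Nk <-] uk].
have [Jk visk] := JP k; have := visk n Hn; apply/negP; rewrite -ltNge gt_max.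
have uk' : `|theta - u k| < e / 2 := uk.
have uS : grid k (J k).+1 = u k + eps / 2 ^+ k.
  by rewrite /u /grid -natr1; field; rewrite expf_neq0.
have ek0 : 0 < eps / 2 ^+ k by rewrite divr_gt0// exprn_gt0.
have ek := NP k Nk.
apply/andP; split; apply: He; rewrite /ball/=.
  by apply: lt_trans uk' _; lra.
rewrite uS opprD addrA (le_lt_trans (ler_normB _ _))// (gtr0_norm ek0); lra.
Qed.

(** The tangent ball blocks all directions close to [theta] on one side. At every scale finer than
    [eta], the cell reaching [theta] from that side has its far end blocked; its other end is free,
    because quasi-convexity bounds the threshold at [theta] by the larger of the two. *)
Lemma endpoint_detect theta n : 0 < theta < eps ->
  (forall n, H2 (x n) -> K n <= threshold theta (x n)) ->
  H2 (x n) -> 0 < K n -> K n = threshold theta (x n) -> 0 < dot theta (x n) ->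
  (exists k0, forall k, (k0 <= k)%N -> exists2 j, (j < 2 ^ k)%N &
     grid_visible k j /\
     threshold (grid k j) (x n) < K n <= threshold (grid k j.+1) (x n)) \/
  (exists k0, forall k, (k0 <= k)%N -> exists2 j, (j < 2 ^ k)%N &
     grid_visible k j /\
     threshold (grid k j.+1) (x n) < K n <= threshold (grid k j) (x n)).
Proof.
move=> /andP[t0 te] vis Hn K0 KE d0.
have th0 : 0 < threshold theta (x n) by rewrite -KE.
have [eta eta0 side] := threshold_lt_side Hn d0 th0.
have [k0 k0P] : exists N, forall k, (N <= k)%N -> eps / 2 ^+ k < eta.
  have : (eps * (2^-1) ^+ k) @[k --> \oo] --> eps * 0.
    by apply: cvgM; [exact: cvg_cst|apply: cvg_expr; rewrite gtr0_norm// invf_lt1// ltr1n].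
  rewrite mulr0 => /cvgr_lt /(_ eta) [|N _ HN]; first by [].
  by exists N => k /HN /=; rewrite exprVn.
have step k j : grid k j.+1 = grid k j + eps / 2 ^+ k.
  by rewrite /grid -natr1; field; rewrite expf_neq0.
have small k j : (j < 2 ^ k)%N -> grid k j.+1 - grid k j < pi.
  move=> jk; have /andP[g0 _] := grid_itv (ltnW jk); have /andP[_ g1] := grid_itv jk.
  by case/andP: heps; lra.
case: side => side; [left|right]; exists k0 => k k0k.
- have [|j jk /andP[j1 j2]] := @grid_locate_left k theta; first by rewrite t0 ltW.
  exists j => //; split.
    by apply: (@grid_visible_of_visible _ _ theta) => //; rewrite j2 ltW.
  have lt : threshold (grid k j) (x n) < K n.
    by rewrite KE; apply: side; have := k0P k k0k; move: j2; rewrite step; lra.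
  rewrite lt/=; have := @threshold_quasiconvex R (grid k j) theta (grid k j.+1) (x n) Hn.
  rewrite (ltW j1) j2 => /(_ isT (small _ _ jk)); rewrite -KE le_max => /orP[|//].
  by rewrite leNgt lt.
- have [|j jk /andP[j1 j2]] := @grid_locate_right k theta; first by rewrite te ltW.
  exists j => //; split.
    by apply: (@grid_visible_of_visible _ _ theta) => //; rewrite j1 ltW.
  have lt : threshold (grid k j.+1) (x n) < K n.
    by rewrite KE; apply: side; have := k0P k k0k; move: j2; rewrite step; lra.
  rewrite lt/=; have := @threshold_quasiconvex R (grid k j) theta (grid k j.+1) (x n) Hn.
  rewrite (ltW j2) j1 => /(_ isT (small _ _ jk)); rewrite -KE le_max => /orP[//|].
  by rewrite leNgt lt.
Qed.

End grid.

(** * Void probabilities *)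

Section hyp_area_measure.
Context {R : realType}.
Local Notation mu2 := (@lebesgue_measure R \x @lebesgue_measure R)%E.

Definition hyp_density (z : R * R) : R := 4 / (1 - (z.1 ^+ 2 + z.2 ^+ 2)) ^+ 2.

Lemma hyp_density_ge0 z : 0 <= hyp_density z.
Proof. by rewrite divr_ge0// sqr_ge0. Qed.

Lemma measurable_sqr_sum : measurable_fun setT (fun z : R * R => z.1 ^+ 2 + z.2 ^+ 2).
Proof.
have m1 : measurable_fun setT (fun z : R * R => z.1) by exact: measurable_fst.
have m2 : measurable_fun setT (fun z : R * R => z.2) by exact: measurable_snd.
by apply: measurable_funD; exact: measurable_funX.
Qed.

Lemma measurable_H2 : measurable (@H2 R).
Proof.
have := measurable_sqr_sum measurableT (measurable_itv `]-oo, (1 : R)[).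
by rewrite setTI.
Qed.

Lemma measurable_hyp_density : measurable_fun setT hyp_density.
Proof.
apply: measurable_funM => //.
apply: (@measurableT_comp _ _ _ _ _ _ (@GRing.inv R)); first exact: measurable_inv.
apply: measurable_funX; apply: measurable_funB => //.
exact: measurable_sqr_sum.
Qed.

Local Notation RR := (measurableTypeR R * measurableTypeR R)%type.

Lemma measurable_hyp_densityE (A : set RR) : measurable_fun A (fun z : RR => (hyp_density z)%:E).
Proof.
apply: (@measurable_funTS _ _ RR).
by apply/measurable_EFinP; exact: measurable_hyp_density.
Qed.

Lemma hyp_area0 : hyp_area set0 = 0%E :> \bar R.
Proof. by rewrite /hyp_area set0I integral_set0. Qed.

Lemma hyp_area_ge0 (A : set (R * R)) : (0 <= hyp_area A)%E.
Proof. by apply: integral_ge0 => z _; rewrite lee_fin hyp_density_ge0. Qed.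

Lemma hyp_area_semi_sigma_additive : semi_sigma_additive (@hyp_area R).
Proof.
move=> F mF tF mU; rewrite [X in _ --> X](_ : _ = \sum_(i <oo) hyp_area (F i))%E.
  by apply: is_cvg_ereal_nneg_natsum => i _; exact: hyp_area_ge0.
rewrite /hyp_area setI_bigcupl ge0_integral_bigcup//.
- move=> k; have mFk : measurable (F k : set RR) := mF k.
  by apply: measurableI => //; exact: measurable_H2.
- exact: measurable_hyp_densityE.
- by move=> z _; rewrite lee_fin hyp_density_ge0.
- exact: trivIset_setIr.
Qed.

HB.instance Definition _ := isMeasure.Build _ _ _ (@hyp_area R)
  hyp_area0 hyp_area_ge0 hyp_area_semi_sigma_additive.

Definition hyp_measure : {measure set (R * R) -> \bar R} := @hyp_area R.

End hyp_area_measure.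

Section limits.
Context {R : realType}.

Lemma cvg_prodn (I : Type) (s : seq I) (f : I -> nat -> R) (l : I -> R) :
  (forall i, f i n @[n --> \oo] --> l i) ->
  \prod_(i <- s) f i n @[n --> \oo] --> \prod_(i <- s) l i.
Proof.
move=> fl; elim: s => [|i s IH].
  by rewrite big_nil; under eq_fun do rewrite big_nil; exact: cvg_cst.
rewrite big_cons; under eq_fun do rewrite big_cons.
by apply: cvgM => //; exact: fl.
Qed.

Lemma cvg_poisson_series (m p : R) :
  \sum_(i < n) (m ^+ i / i`!%:R * expR (- m) * p ^+ i) @[n --> \oo] -->
  expR (- (m * (1 - p))).
Proof.
have -> : expR (- (m * (1 - p))) = expR (m * p) * expR (- m).
  by rewrite -expRD; congr expR; ring.
have h : (fun n => \sum_(i < n) (m ^+ i / i`!%:R * expR (- m) * p ^+ i)) =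
    (fun n => series (exp_coeff (m * p)) n * expR (- m)).
  apply/funext => n; rewrite /series/= big_mkord mulr_suml.
  by apply: eq_bigr => i _; rewrite /exp_coeff/= exprMn; ring.
rewrite h; apply: cvgM; last exact: cvg_cst.
exact: is_cvg_series_exp_coeff.
Qed.

End limits.

Section finite_integrals.
Context {d} {T : measurableType d} {R : realType} (P : {measure set T -> \bar R}).

Lemma prod_indic (I : Type) (s : seq I) (E : I -> set T) (w : T) :
  \prod_(i <- s) \1_(E i) w = \1_(\big[setI/setT]_(i <- s) E i) w :> R.
Proof.
elim: s => [|i s IH]; first by rewrite !big_nil indicT.
by rewrite !big_cons indicI /= IH.
Qed.

Lemma integral_sum_indic (I : Type) (s : seq I) (a : I -> R) (E : I -> set T) :
  (forall i, 0 <= a i) -> (forall i, measurable (E i)) ->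
  (\int[P]_w (\sum_(i <- s) a i * \1_(E i) w)%:E =
   \sum_(i <- s) (a i)%:E * P (E i))%E.
Proof.
move=> a0 mE; under eq_integral do rewrite -sumEFin.
have mI i : measurable_fun setT (fun w => (\1_(E i) w)%:E : \bar R).
  by apply/measurable_EFinP; exact: measurable_indic.
rewrite ge0_integral_sum//; last 2 first.
- move=> i; apply/measurable_EFinP; apply: measurable_funM => //.
- by move=> i w _; rewrite lee_fin mulr_ge0.
apply: eq_bigr => i _; under eq_integral do rewrite EFinM.
rewrite ge0_integralZl ?lee_fin//.
by rewrite integral_indic// setIT.
Qed.

End finite_integrals.

Section independent_marks.
Context {d} {T : measurableType d} {R : realType} (P : probability T R).
Context (law : probability R R).
Variables (xi : nat -> T -> R * R) (rho : nat -> T -> R).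
Hypotheses (mxi : forall n, measurable_fun setT (xi n))
  (mrho : forall n, measurable_fun setT (rho n))
  (lawE : forall n B, measurable B -> P (rho n @^-1` B) = law B)
  (indep_rho : mutually_independent P rho)
  (indep : independent_sequences P xi rho).

Lemma measurable_preimage d' (U : measurableType d') (X : T -> U) (B : set U) :
  measurable_fun setT X -> measurable B -> measurable (X @^-1` B).
Proof. by move=> mX mB; rewrite -[_ @^-1` _]setTI; exact: mX. Qed.

Lemma sigma_generated_bigI d' (U : measurableType d') (X : nat -> T -> U)
    (E : nat -> set U) (s : seq nat) : (forall n, measurable (E n)) ->
  sigma_generated X (\big[setI/setT]_(n <- s) (X n @^-1` E n)).
Proof.
move=> mE.
pose G : set (set T) := [set A | exists n B, measurable B /\ A = X n @^-1` B].
have := @bigsetI_measurable _ (g_sigma_algebraType G) _ s xpredT (fun n => X n @^-1` E n).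
apply=> n _; apply: sub_sigma_algebra; by exists n, (E n).
Qed.

Lemma probability_pattern (D : nat -> set (R * R)) (B : nat -> set R) (s : seq nat) :
  uniq s -> (forall n, measurable (D n)) -> (forall n, measurable (B n)) ->
  P ((\big[setI/setT]_(n <- s) (xi n @^-1` D n)) `&`
     (\big[setI/setT]_(n <- s) (rho n @^-1` B n))) =
  (P (\big[setI/setT]_(n <- s) (xi n @^-1` D n)) * \prod_(n <- s) law (B n))%E.
Proof.
move=> us mD mB; rewrite indep; try exact: sigma_generated_bigI.
by rewrite indep_rho//; congr (_ * _)%E; apply: eq_bigr => n _; rewrite lawE.
Qed.

Variables (O : finType) (o0 : O) (D : O -> set (R * R)) (B : O -> set R).
Hypotheses (mD : forall o, measurable (D o)) (mB : forall o, measurable (B o)).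
Hypothesis (partD : forall x, exists2 o, D o x & forall o', D o' x -> o' = o).

Definition marks_ok (N : nat) : set T :=
  [set w | forall n, (n < N)%N -> forall o, D o (xi n w) -> B o (rho n w)].

Definition mark_prob (o : O) : R := fine (law (B o)).

(** The conditional probability of [marks_ok N] given the points. In each inner sum a single
    indicator is nonzero, that of the class of the point. *)
Definition mark_weight (N : nat) (w : T) : R :=
  \prod_(n < N) \sum_o \1_(D o) (xi n w) * mark_prob o.

Lemma mark_probE o : law (B o) = (mark_prob o)%:E.
Proof. by rewrite /mark_prob fineK// fin_num_measure. Qed.

Lemma mark_prob_itv o : 0 <= mark_prob o <= 1.
Proof. by rewrite -!lee_fin -mark_probE measure_ge0 probability_le1. Qed.

Lemma sum_indicD x (a : O -> R) o : D o x -> \sum_o' \1_(D o') x * a o' = a o.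
Proof.
move=> Dx; rewrite (bigD1 o)//= big1 ?addr0.
  by rewrite indicE mem_set// mul1r.
have [q _ uniqo] := partD x.
move=> o' /eqP oo'; rewrite indicE memNset ?mul0r// => Do'; apply: oo'.
by rewrite (uniqo _ Dx) (uniqo _ Do').
Qed.

(** Decompose according to the classes [c] of the first [N] points. For fixed [c] the event is an
    event of the points intersected with an event of the marks, and its probability factorizes;
    summing over the finitely many [c] replaces a conditional expectation. *)
Lemma probability_marks_ok N :
  P (marks_ok N) = (\int[P]_w (mark_weight N w)%:E)%E.
Proof.
(* Independence is available for families indexed by [nat]. The default [o0] is only taken at
   indices from [N] on, which do not occur in [iota 0 N]. *)
pose ext (c : {ffun 'I_N -> O}) (n : nat) : O :=
  if insub n is Some k then c k else o0.
have extE c (n : 'I_N) : ext c n = c n by rewrite /ext valK.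
have big_ext (F : O -> nat -> R) (c : {ffun 'I_N -> O}) :
    \prod_(n < N) F (c n) n = \prod_(n <- iota 0 N) F (ext c n) n.
  have -> : iota 0 N = index_iota 0 N by rewrite /index_iota subn0.
  by rewrite big_mkord; apply: eq_bigr => n _; rewrite extE.
pose pat c := \big[setI/setT]_(n <- iota 0 N) (xi n @^-1` D (ext c n)).
pose ok c := \big[setI/setT]_(n <- iota 0 N) (rho n @^-1` B (ext c n)).
have mpat c : measurable (pat c).
  by apply: bigsetI_measurable => n _; exact: measurable_preimage.
have mok c : measurable (ok c).
  by apply: bigsetI_measurable => n _; exact: measurable_preimage.
have weightE w : mark_weight N w =
    \sum_(c : {ffun 'I_N -> O}) (\prod_(n < N) mark_prob (c n)) * \1_(pat c) w.
  rewrite /mark_weight bigA_distr_bigA/=; apply: eq_bigr => c _.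
  rewrite big_split/= mulrC; congr (_ * _).
  by rewrite (big_ext (fun o n => \1_(D o) (xi n w))) /pat -prod_indic.
have okE w : \1_(marks_ok N) w =
    \sum_(c : {ffun 'I_N -> O}) 1 * \1_(pat c `&` ok c) w :> R.
  transitivity (\prod_(n < N) \sum_o \1_(D o) (xi n w) * \1_(B o) (rho n w) : R).
    have [h|h] := pselect (marks_ok N w).
      rewrite indicE mem_set// big1// => n _.
      have [q Do _] := partD (xi n w).
      by rewrite (sum_indicD _ Do) indicE mem_set//; exact: (h n).
    rewrite indicE memNset//.
    have [n hn] : exists n : 'I_N, ~ forall o, D o (xi n w) -> B o (rho n w).
      apply/existsNP => h'; apply: h => n nN; exact: (h' (Ordinal nN)).
    have [q Do _] := partD (xi n w).
    rewrite (bigD1 n)//= (sum_indicD _ Do) indicE memNset ?mul0r// => Bo.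
    apply: hn => o' Do'; have [q1 _ u] := partD (xi n w).
    by rewrite (u _ Do') -(u _ Do).
  rewrite bigA_distr_bigA/=; apply: eq_bigr => c _; rewrite mul1r.
  rewrite indicI/= /pat /ok -!prod_indic big_split/=.
  by rewrite (big_ext (fun o n => \1_(D o) (xi n w)))
     (big_ext (fun o n => \1_(B o) (rho n w))).
have mmarks : measurable (marks_ok N).
  rewrite (_ : marks_ok N = \big[setU/set0]_(c : {ffun 'I_N -> O}) (pat c `&` ok c)).
    by apply: bigsetU_measurable => c _; exact: measurableI.
  apply/seteqP; split=> w.
    move=> h; have := okE w; rewrite [in LHS]indicE mem_set// => e.
    apply: contrapT => nU; move: e; rewrite big1 => [/eqP|c _].
      by rewrite oner_eq0.
    rewrite mul1r indicE memNset// => hc; apply: nU.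
    by rewrite -bigcup_seq; exists c => //; rewrite /= mem_index_enum.
  rewrite -bigcup_seq => -[c _ [hp ho]] n nN o Do.
  have := okE w; rewrite (bigD1 c)//= mul1r [X in _ = X + _]indicE mem_set//.
  have r0 : 0 <= \sum_(i | i != c) 1 * \1_(pat i `&` ok i) w :> R.
    by apply: sumr_ge0 => i _; rewrite mul1r.
  rewrite indicE; case: (boolP (w \in marks_ok N)) => [/set_mem h _|_ /= e].
    exact: (h n).
  by move: r0; rewrite -(lerD2l 1) -e addr0 ler10.
under eq_integral do rewrite weightE.
rewrite integral_sum_indic//; last first.
  by move=> c; apply: prodr_ge0 => n _; have /andP[] := mark_prob_itv (c n).
transitivity (\int[P]_w (\1_(marks_ok N) w)%:E)%E.
  by rewrite integral_indic// setIT.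
under eq_integral do rewrite okE.
rewrite integral_sum_indic//; last by move=> c; exact: measurableI.
have patE c : P (pat c `&` ok c) = (P (pat c) * \prod_(n <- iota 0 N) law (B (ext c n)))%E.
  exact: (probability_pattern (iota_uniq 0 N) (fun n => mD (ext c n))
    (fun n => mB (ext c n))).
apply: eq_bigr => c _; rewrite mul1e; apply: etrans (patE c) _; rewrite muleC.
congr (_ * _)%E; rewrite (big_ext (fun o _ => mark_prob o)) -prodEFin.
by apply: eq_bigr => n _; rewrite mark_probE.
Qed.

End independent_marks.

Section void_cells.
Context {d} {T : measurableType d} {R : realType} (P : probability T R).
Context (lambda : R) (law : probability R R).
Variables (xi : nat -> T -> R * R) (rho : nat -> T -> R).
Hypothesis model : is_boolean_model P lambda law xi rho.
Variables (m : nat) (A : 'I_m -> set (R * R)) (B : 'I_m -> set R).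
Hypotheses (mA : forall i, measurable (A i)) (mB : forall i, measurable (B i)).
Hypothesis tA : trivIset setT A.
Hypothesis finA : forall i, (hyp_area (A i) < +oo)%E.

Let mxi n : measurable_fun setT (xi n). Proof. by case: model => -[]. Qed.

Let AH i : set (R * R) := A i `&` H2.

Let mAH i : measurable (AH i).
Proof. by apply: measurableI => //; exact: measurable_H2. Qed.

(** [None] is the class of what lies outside all cells or outside the disc; its marks are
    unconstrained. This completes the cells to a partition. *)
Let D (o : option 'I_m) : set (R * R) :=
  if o is Some i then AH i else ~` (\bigcup_i AH i).

Let C (o : option 'I_m) : set R := if o is Some i then B i else setT.

Let mD o : measurable (D o).
Proof.
case: o => [i|] //=; apply: measurableC; exact: fin_bigcup_measurable.
Qed.

Let mC o : measurable (C o). Proof. by case: o => [i|] //=. Qed.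

Let AH_inj i j x : AH i x -> AH j x -> i = j.
Proof. by move=> [Aix _] [Ajx _]; apply: tA => //; exists x. Qed.

Let partD x : exists2 o, D o x & forall o', D o' x -> o' = o.
Proof.
have [[i _ Ax]|nA] := pselect ((\bigcup_i AH i) x).
  exists (Some i) => // -[j /= Aj|/= nA]; first by rewrite (AH_inj Ax Aj).
  by exfalso; apply: nA; exists i.
exists None => // -[j /= Aj|//].
by exfalso; apply: nA; exists j.
Qed.

Let count N i w : nat := \sum_(n < N) (xi n w \in AH i).

Let weight := mark_weight law xi D C.

Let p i : R := mark_prob law B i.

Let p01 i : 0 <= p i <= 1. Proof. exact: mark_prob_itv. Qed.

Let weightE N w : weight N w = \prod_(i < m) p i ^+ count N i w.
Proof.
rewrite /count; under eq_bigr do rewrite expr_sum.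
rewrite exchange_big/= /weight /mark_weight; apply: eq_bigr => n _.
have [q Dq _] := partD (xi n w).
rewrite (sum_indicD partD _ Dq).
case: q Dq => [i|] /= Dq.
  rewrite (bigD1 i)//= big1 ?mulr1; first by rewrite mem_set.
  move=> j ji; rewrite memNset// => Aj; move: ji.
  by rewrite (AH_inj Aj Dq) eqxx.
rewrite big1; first by rewrite /mark_prob /= probability_setT.
by move=> j _; rewrite memNset// => Aj; apply: Dq; exists j.
Qed.

Let weight01 N w : 0 <= weight N w <= 1.
Proof.
rewrite weightE; apply/andP; split.
  by apply: prodr_ge0 => i _; rewrite exprn_ge0//; case/andP: (p01 i).
apply: prodr_ile1 => i _; rewrite exprn_ge0//=; last by case/andP: (p01 i).
by apply: exprn_ile1; case/andP: (p01 i).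
Qed.

(** The partial counts are integers that converge to an integer, so they are eventually equal to
    it. *)
Let count_point_count i w k : point_count xi (A i) w = k%:R%:E ->
  exists N0, forall N, (N0 <= N)%N -> count N i w = k.
Proof.
move=> ck.
have cv : (fun N => ((count N i w)%:R : R)%:E) @ \oo --> (k%:R : R)%:E.
  rewrite -ck /point_count.
  rewrite [X in X @ _ --> _](_ : _ = (fun N => \sum_(0 <= n < N) (\1_(A i `&` H2) (xi n w))%:E)%E).
    by apply: is_cvg_nneseries => n _ _; rewrite lee_fin.
  apply/funext => N; rewrite sumEFin; congr EFin.
  by rewrite /count big_mkord natr_sum; apply: eq_bigr => n _; rewrite indicE.
have /fine_cvgP[_ /cvgrPdist_lt /(_ 1 ltr01)[N0 _ HN]] := cv.
exists N0 => N N0N; have := HN N N0N => /=.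
rewrite -[X in `|X|]/(k%:R - (count N i w)%:R).
case: (ltngtP (count N i w) k) => // h.
  by rewrite -natrB ?(ltnW h)// normr_nat -[X in _ < X]/(1%:R) ltr_nat ltnS leqn0 subn_eq0 leqNgt h.
rewrite distrC -natrB ?(ltnW h)// normr_nat -[X in _ < X]/(1%:R) ltr_nat ltnS.
by rewrite leqn0 subn_eq0 leqNgt h.
Qed.

Let Omega L (k : {ffun 'I_m -> 'I_L}) : set T :=
  \big[setI/setT]_(i <- enum 'I_m)
     (point_count xi (A i) @^-1` [set (k i)%:R%:E]).

Let OmegaP L (k : {ffun 'I_m -> 'I_L}) w :
  Omega k w <-> forall i, point_count xi (A i) w = (k i)%:R%:E.
Proof.
rewrite /Omega -bigcap_seq; split=> [h i|h i _]; last exact: h.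
by apply: h; rewrite /= mem_enum.
Qed.

Let measurable_indic_xi S n : measurable S ->
  measurable_fun setT (fun w => \1_S (xi n w) : R).
Proof.
move=> mS; rewrite (_ : (fun w => _) = \1_(xi n @^-1` S)).
  by apply: measurable_indic; exact: measurable_preimage.
by apply/funext => w; rewrite !indicE.
Qed.

Let measurable_point_count i : measurable_fun setT (point_count xi (A i)).
Proof.
apply: (@emeasurable_fun_cvg _ _ _ _ (fun N w => \sum_(0 <= n < N) (\1_(A i `&` H2) (xi n w))%:E)%E).
  move=> N; apply: emeasurable_sum => n.
  by apply/measurable_EFinP; apply: measurable_indic_xi; exact: mAH.
by move=> w _; apply: is_cvg_nneseries => n _ _; rewrite lee_fin.
Qed.

Let mOmega L (k : {ffun 'I_m -> 'I_L}) : measurable (Omega k).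
Proof.
by apply: bigsetI_measurable => i _; exact: measurable_preimage.
Qed.

Let mean i : R := lambda * fine (hyp_area (A i)).

Let pois i (j : nat) : R := mean i ^+ j / j`!%:R * expR (- mean i).

Let prob_Omega L (k : {ffun 'I_m -> 'I_L}) :
  P (Omega k) = (\prod_(i < m) pois i (k i))%:E.
Proof.
have [[_ law_count indep] _ _ _ _] := model.
rewrite /Omega indep//; last exact: enum_uniq.
rewrite -prodEFin [RHS](_ : _ = (\prod_(i <- enum 'I_m) (pois i (k i))%:E)%E).
  apply: eq_bigr => i _; have := law_count _ (mA i).
  have -> : (lambda%:E * hyp_area (A i) = (mean i)%:E)%E.
    by rewrite EFinM fineK// ge0_fin_numE ?finA// hyp_area_ge0.
  by apply.
by rewrite [RHS]big_enum.
Qed.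

(** The conditional probability of the void event given all points. Where every cell holds finitely
    many points, it is the product of the [p i] to the power of the counts. *)
Let f w : R := limn (fun N => weight N w).

Let cvg_weight w : weight N w @[N --> \oo] --> f w.
Proof.
apply: nonincreasing_is_cvgn; last first.
  by exists 0 => _ [N _ <-]; case/andP: (weight01 N w).
apply/nonincreasing_seqP => N; rewrite /weight /mark_weight big_ord_recr/=.
have w0 : 0 <= weight N w by case/andP: (weight01 N w).
rewrite -[leRHS]mulr1; apply: ler_wpM2l => //.
have [q Dq _] := partD (xi N w); rewrite (sum_indicD partD _ Dq).
by case/andP: (mark_prob_itv law mC q).
Qed.

Let f01 w : 0 <= f w <= 1.
Proof.
by apply/andP; split; [apply: limr_ge|apply: limr_le]; try (by apply/cvg_ex; eexists; exact: cvg_weight);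
  apply: nearW => N; case/andP: (weight01 N w).
Qed.

Let mweight N : measurable_fun setT (weight N).
Proof.
rewrite /weight /mark_weight.
under eq_fun do rewrite -(big_mkord xpredT (fun n => \sum_q \1_(D q) (xi n _) * mark_prob law C q)).
apply: measurable_prod => n _; apply: measurable_sum => q.
by apply: measurable_funM => //; exact: measurable_indic_xi.
Qed.

Let mf : measurable_fun setT f.
Proof. by apply: (measurable_fun_cvg mweight) => w _; exact: cvg_weight. Qed.

Let f_Omega L (k : {ffun 'I_m -> 'I_L}) w : Omega k w -> f w = \prod_(i < m) p i ^+ k i.
Proof.
move=> /OmegaP h; apply/cvg_lim => //.
apply: cvg_near_cst.
have : forall i, exists N0, forall N, (N0 <= N)%N -> count N i w = k i.
  by move=> i; exact: count_point_count.
move=> /boolp.choice[N0 HN0]; exists (\max_i N0 i) => // N /= hN.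
rewrite weightE; apply: eq_bigr => i _; rewrite HN0//.
by apply: leq_trans hN; exact: leq_bigmax.
Qed.

Let void : set T := [set w | forall n i, AH i (xi n w) -> B i (rho n w)].

Let voidE : void = \bigcap_N marks_ok xi rho D C N.
Proof.
apply/seteqP; split=> w h.
  by move=> N _ n nN [i|] /=; [exact: h|].
by move=> n i; apply: (h n.+1 I n (ltnSn n) (Some i)).
Qed.

Let mmarks N : measurable (marks_ok xi rho D C N).
Proof.
have [_ mrho _ _ _] := model.
rewrite (_ : marks_ok _ _ _ _ _ = \bigcap_(n in [set n | (n < N)%N])
    \bigcap_q (~` (xi n @^-1` D q) `|` rho n @^-1` C q)).
  apply: bigcap_measurableType => n _.
  apply: fin_bigcap_measurable => [|q _]; first exact: finite_finset.
  apply: measurableU; last exact: measurable_preimage.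
  by apply: measurableC; exact: measurable_preimage.
apply/seteqP; split=> w h n nN q.
  by move=> _; have [/(h n nN q)|] := pselect (D q (xi n w)); [right|left].
by move=> Dq; case: (h n nN q I).
Qed.

Let measurable_void : measurable void.
Proof. by rewrite voidE; apply: bigcapT_measurable => N. Qed.

Let prob_void_integral : P void = (\int[P]_w (f w)%:E)%E.
Proof.
have [[_ _ _] mrho lawE ir ind] := model.
have c1 : P (marks_ok xi rho D C N) @[N --> \oo] --> P void.
  rewrite voidE; apply: nonincreasing_cvg_mu => //.
  - by rewrite (le_lt_trans (probability_le1 _ _))// ltry.
  - by rewrite -voidE.
  - apply/nonincreasing_seqP => N; apply/subsetPset => w h n nN.
    by apply: h; exact: ltn_trans nN _.
have c2 : P (marks_ok xi rho D C N) @[N --> \oo] --> (\int[P]_w (f w)%:E)%E.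
  under eq_fun do rewrite (probability_marks_ok mxi mrho lawE ir ind None mD mC partD).
  apply: (@dominated_cvg _ _ _ _ _ measurableT _ _ (cst 1%E)) => //.
  - by move=> N; apply/measurable_EFinP; exact: mweight.
  - by move=> w _; apply/fine_cvgP; split; [exact: nearW|exact: cvg_weight].
  - exact: finite_measure_integrable_cst.
  - move=> N w _; rewrite lee_fin ger0_norm; by case/andP: (weight01 N w).
exact: (cvg_unique _ c1 c2).
Qed.

Let Omega_inj L (k k' : {ffun 'I_m -> 'I_L}) w : Omega k w -> Omega k' w -> k = k'.
Proof.
move=> /OmegaP h /OmegaP h'; apply/ffunP => i; apply/val_inj => /=.
by have := h i; rewrite h' => -[/eqP]; rewrite eqr_nat => /eqP ->.
Qed.

Let sum_Omega L w (a : {ffun 'I_m -> 'I_L} -> R) k : Omega k w ->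
  \sum_k a k * \1_(Omega k) w = a k.
Proof.
move=> Ok; rewrite (bigD1 k)//= big1 ?addr0 ?indicE ?mem_set ?mulr1// => k' kk'.
rewrite indicE memNset ?mulr0// => Ok'.
by move: kk'; rewrite (Omega_inj Ok' Ok) eqxx.
Qed.

Let sum_OmegaN L w (a : {ffun 'I_m -> 'I_L} -> R) : (forall k : {ffun 'I_m -> 'I_L}, ~ Omega k w) ->
  \sum_k a k * \1_(Omega k) w = 0.
Proof.
by move=> nO; rewrite big1// => k _; rewrite indicE memNset ?mulr0//; exact: nO.
Qed.

Let partial q L : R := \prod_(i < m) \sum_(j < L) (pois i j * q i ^+ j).

Let integral_partial (q : 'I_m -> R) L : (forall i, 0 <= q i) ->
  (\int[P]_w (\sum_(k : {ffun 'I_m -> 'I_L}) (\prod_(i < m) q i ^+ k i) * \1_(Omega k) w)%:E =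
  (partial q L)%:E)%E.
Proof.
move=> q0; rewrite integral_sum_indic//; last first.
  by move=> k; apply: prodr_ge0 => i _; exact: exprn_ge0.
rewrite /partial bigA_distr_bigA/= -sumEFin; apply: eq_bigr => k _.
by rewrite prob_Omega -EFinM -big_split/=; congr EFin; apply: eq_bigr => i _; rewrite mulrC.
Qed.

Let msum (q : 'I_m -> R) L : measurable_fun setT (fun w =>
  \sum_(k : {ffun 'I_m -> 'I_L}) (\prod_(i < m) q i ^+ k i) * \1_(Omega k) w).
Proof.
apply: measurable_sum => k; apply: measurable_funM => //.
Qed.

Let partial_le L : partial p L <= fine (P void).
Proof.
have p0 i : 0 <= p i by case/andP: (p01 i).
rewrite -lee_fin fineK ?fin_num_measure// -integral_partial// prob_void_integral.
apply: ge0_le_integral => //.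
- move=> w _; rewrite lee_fin; apply: sumr_ge0 => k _; rewrite mulr_ge0//.
  by apply: prodr_ge0 => i _; exact: exprn_ge0.
- by apply/measurable_EFinP; exact: msum.
- by apply/measurable_EFinP; exact: mf.
- move=> w _; rewrite lee_fin.
  have [[k Ok]|nO] := pselect (exists k : {ffun 'I_m -> 'I_L}, Omega k w).
    by rewrite (sum_Omega _ Ok) (f_Omega Ok).
  rewrite sum_OmegaN; first by case/andP: (f01 w).
  by move=> k Ok; apply: nO; exists k.
Qed.

(** Where some count is not below [L] only [f <= 1] is used, at the cost of the probability
    [1 - partial (fun=> 1) L]. The terms are arranged as sums, so that all integrands are
    nonnegative. *)
Let partial_ge L : fine (P void) + partial (fun=> 1) L <= partial p L + 1.
Proof.
have p0 i : 0 <= p i by case/andP: (p01 i).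
rewrite -lee_fin EFinD fineK ?fin_num_measure// EFinD -!integral_partial// prob_void_integral.
have -> : (1%:E = \int[P]_w (cst 1%E w) :> \bar R)%E.
  by rewrite integral_cst//= probability_setT mule1.
have s0 (q : 'I_m -> R) : (forall i, 0 <= q i) -> forall w, 0 <=
    \sum_(k : {ffun 'I_m -> 'I_L}) (\prod_(i < m) q i ^+ k i) * \1_(Omega k) w.
  move=> q0 w; apply: sumr_ge0 => k _; rewrite mulr_ge0//.
  by apply: prodr_ge0 => i _; exact: exprn_ge0.
rewrite -!ge0_integralD//; first last.
- by apply/measurable_EFinP; exact: msum.
- by move=> w _; rewrite lee_fin; apply: s0 => i; exact: ler01.
- by apply/measurable_EFinP; exact: mf.
- by move=> w _; rewrite lee_fin; case/andP: (f01 w).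
- by apply/measurable_EFinP; exact: msum.
- by move=> w _; rewrite lee_fin; apply: s0.
apply: ge0_le_integral => //.
- move=> w _; rewrite -EFinD lee_fin addr_ge0//; first by case/andP: (f01 w).
  by apply: s0.
- apply: emeasurable_funD; apply/measurable_EFinP; [exact: mf|exact: msum].
- by apply: emeasurable_funD => //; apply/measurable_EFinP; exact: msum.
- move=> w _; rewrite -!EFinD lee_fin.
  have [[k Ok]|nO] := pselect (exists k : {ffun 'I_m -> 'I_L}, Omega k w).
    rewrite !(sum_Omega _ Ok) (f_Omega Ok) lerD2l.
    by rewrite big1// => i _; rewrite expr1n.
  have nO' (k : {ffun 'I_m -> 'I_L}) : ~ Omega k w by move=> Ok; apply: nO; exists k.
  by rewrite !sum_OmegaN// addr0 add0r; case/andP: (f01 w).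
Qed.

(** Given the counts [k_i], the marks are all allowed with probability [prod_i p_i ^ k_i], and the
    generating function of a Poisson law of mean [m_i] at [p_i] is [exp (- m_i (1 - p_i))].
    Truncating the counts at [L] leaves finite sums, and [L] tends to infinity in two matching
    bounds. *)
Lemma void_cells : measurable [set w | forall n i, AH i (xi n w) -> B i (rho n w)] /\
  P [set w | forall n i, AH i (xi n w) -> B i (rho n w)] =
  (expR (- (lambda * \sum_(i < m) fine (hyp_area (A i)) * (1 - fine (law (B i))))))%:E.
Proof.
split=> //; rewrite -[LHS]fineK ?fin_num_measure//; congr EFin.
have c1 : partial p L @[L --> \oo] --> \prod_(i < m) expR (- (mean i * (1 - p i))).
  by apply: cvg_prodn => i; exact: cvg_poisson_series.
have c2 : partial (fun=> 1) L @[L --> \oo] --> \prod_(i < m) expR (- (mean i * (1 - 1))).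
  by apply: cvg_prodn => i; exact: cvg_poisson_series.
have e2 : \prod_(i < m) expR (- (mean i * (1 - 1))) = 1.
  by rewrite big1// => i _; rewrite subrr mulr0 oppr0 expR0.
rewrite e2 in c2.
have -> : expR (- (lambda * \sum_(i < m) fine (hyp_area (A i)) * (1 - fine (law (B i))))) =
    \prod_(i < m) expR (- (mean i * (1 - p i))).
  rewrite -expR_sum; congr expR; rewrite mulr_sumr -sumrN.
  by apply: eq_bigr => i _; rewrite /mean /p /mark_prob mulrA.
apply/le_anti/andP; split; last first.
  apply: ler_cvg_to c1 (cvg_cst _) _; apply: nearW => L; exact: partial_le.
have c3 : (partial p L + 1 - partial (fun=> 1) L) @[L --> \oo] -->
    (\prod_(i < m) expR (- (mean i * (1 - p i))) + 1 - 1).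
  by apply: cvgB => //; apply: cvgD => //; exact: cvg_cst.
move: c3; rewrite addrK => c3; apply: ler_cvg_to (cvg_cst _) c3 _.
by apply: nearW => L; rewrite lerBrDr; exact: partial_ge.
Qed.

End void_cells.

Lemma hyp_area_H2 {R : realType} (A : set (R * R)) : hyp_area (A `&` H2) = hyp_area A.
Proof. by rewrite /hyp_area -setIA setIid. Qed.

(** * Approximation of a threshold function by finitely many levels *)

Section threshold_level.
Context {R : realType}.
Variables (g : R * R -> R) (M : R).
Hypotheses (mg : measurable_fun setT g) (g0 : forall x, 0 <= g x).
Hypothesis finM : (hyp_area [set x | (g x < M)%R] < +oo)%E.

Definition level l x : nat := Num.truncn (g x * 2 ^+ l).

Let level_itv l x : (level l x)%:R <= g x * 2 ^+ l < (level l x).+1%:R.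
Proof. by apply: truncn_itv; rewrite mulr_ge0// exprn_ge0. Qed.

(** A rounding of [g] that decreases to [g] with the scale. The sets where it is below [c] therefore
    increase to [{g < c}], which gives convergence of areas by monotonicity alone. *)
Definition upper_level l x : R := (level l x).+1%:R / 2 ^+ l.

Lemma upper_level_gt l x : g x < upper_level l x.
Proof.
by rewrite /upper_level ltr_pdivlMr ?exprn_gt0//; case/andP: (level_itv l x).
Qed.

Lemma upper_level_le l x : upper_level l x <= g x + (2 ^+ l)^-1.
Proof.
rewrite /upper_level -natr1 mulrDl mul1r lerD2r ler_pdivrMr ?exprn_gt0//.
by case/andP: (level_itv l x).
Qed.

Lemma upper_level_nincr l x : upper_level l.+1 x <= upper_level l x.
Proof.
rewrite /upper_level exprS ler_pdivrMr ?mulr_gt0 ?exprn_gt0//.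
have -> : (level l x).+1%:R / 2 ^+ l * (2 * 2 ^+ l) = (level l x).+1.*2%:R :> R.
  by rewrite -muln2 natrM; field; rewrite expf_neq0.
rewrite ler_nat -(ltr_nat R).
have /andP[h1 _] := level_itv l.+1 x; have /andP[_ h2] := level_itv l x.
apply: le_lt_trans h1 _; rewrite exprS mulrCA -mul2n natrM.
by rewrite ltr_pM2l.
Qed.

Definition cell_count l : nat := ((Num.truncn M).+1 * 2 ^ l)%N.

Definition level_cell l (i : 'I_(cell_count l)) : set (R * R) :=
  [set x | g x < M /\ level l x = i].

Lemma level_cellP l x : g x < M -> exists i : 'I_(cell_count l), level_cell i x.
Proof.
move=> gM; suff lt : (level l x < cell_count l)%N by exists (Ordinal lt).
rewrite -(ltr_nat R); have /andP[h1 _] := level_itv l x.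
apply: le_lt_trans h1 _; rewrite /cell_count natrM natrX ltr_pM2r ?exprn_gt0//.
have M0 : 0 <= M by exact: le_trans (g0 x) (ltW gM).
apply: lt_trans gM _; by case/andP: (truncn_itv M0).
Qed.

Lemma upper_level_cell l (i : 'I_(cell_count l)) x :
  level_cell i x -> upper_level l x = i.+1%:R / 2 ^+ l.
Proof. by move=> [_ e]; rewrite /upper_level e. Qed.

Lemma measurable_sublevel (c : R) : measurable [set x | g x < c].
Proof.
have := mg measurableT (measurable_itv `]-oo, c[).
rewrite setTI; congr measurable; apply/seteqP.
Qed.

Lemma measurable_level_cell l (i : 'I_(cell_count l)) : measurable (level_cell i).
Proof.
rewrite (_ : level_cell i = [set x | g x < M] `&`
   ([set x | g x < i.+1%:R / 2 ^+ l] `\` [set x | g x < i%:R / 2 ^+ l])).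
  by apply: measurableI; [|apply: measurableD]; exact: measurable_sublevel.
have p0 : 0 < 2 ^+ l :> R by rewrite exprn_gt0.
apply/seteqP; split=> x [gM] /=.
  move=> e; split=> //; have := level_itv l x; rewrite e => /andP[h1 h2].
  by split; [rewrite ltr_pdivlMr|apply/negP; rewrite -leNgt ler_pdivrMr].
move=> [h1 /negP]; rewrite -leNgt => h2; split=> //.
apply/eqP; rewrite /level truncn_eq ?mulr_ge0// ?(ltW p0)//.
by rewrite -ler_pdivrMr// h2/= -ltr_pdivlMr.
Qed.

Lemma trivIset_level_cell l : trivIset setT (@level_cell l).
Proof. by move=> i j _ _ [x [[_ h1] [_ h2]]]; apply/val_inj; rewrite /= -h1 -h2. Qed.

Lemma level_cell_finite l (i : 'I_(cell_count l)) : (hyp_area (level_cell i) < +oo)%E.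
Proof.
apply: le_lt_trans finM.
apply: (le_measure (@hyp_measure R)); rewrite ?inE.
- exact: measurable_level_cell.
- exact: measurable_sublevel.
- by move=> x [].
Qed.

Lemma measurable_upper_level l c : measurable [set x | g x < M /\ upper_level l x < c].
Proof.
rewrite (_ : [set x | _] = \bigcup_(i in [set i : 'I_(cell_count l) | i.+1%:R / 2 ^+ l < c]) level_cell i).
  apply: fin_bigcup_measurable; first exact: finite_finset.
  by move=> i _; exact: measurable_level_cell.
apply/seteqP; split=> x /=.
  move=> [gM uc]; have [i ix] := level_cellP l gM.
  by exists i => //=; rewrite -(upper_level_cell ix).
by move=> [i /= ic ix]; rewrite (upper_level_cell ix); case: ix.
Qed.

Lemma area_upper_level l c : hyp_area [set x | g x < M /\ upper_level l x < c] =
  (\sum_(i < cell_count l) fine (hyp_area (level_cell i)) *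
     ((i.+1%:R / 2 ^+ l < c)%R : nat)%:R)%:E.
Proof.
rewrite (_ : [set x | _] = \big[setU/set0]_(i < cell_count l | i.+1%:R / 2 ^+ l < c)
    level_cell i); last first.
  apply/seteqP; split=> x /=; rewrite -bigcup_seq_cond.
    move=> [gM uc]; have [i ix] := level_cellP l gM.
    exists i => //=; rewrite mem_index_enum.
    by rewrite -(upper_level_cell ix) uc.
  move=> [i /= /andP[_ ic]] ix.
  by rewrite (upper_level_cell ix); case: ix.
rewrite (@measure_bigsetU_ord _ _ _ (@hyp_measure R)); last 2 first.
- by move=> i; exact: measurable_level_cell.
- exact: trivIset_level_cell.
rewrite big_mkcond -sumEFin; apply: eq_bigr => i _.
case: ifP => _; rewrite ?mulr1 ?mulr0//.
by rewrite fineK// ge0_fin_numE ?level_cell_finite// hyp_area_ge0.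
Qed.

Lemma cvg_area_upper_level c : c <= M ->
  hyp_area [set x | g x < M /\ upper_level l x < c] @[l --> \oo] -->
  hyp_area [set x | g x < c].
Proof.
move=> cM.
have -> : [set x | g x < c] = \bigcup_l [set x | g x < M /\ upper_level l x < c].
  apply/seteqP; split=> x /=; last first.
    by move=> [l _ [_]]; exact: lt_trans (upper_level_gt l x).
  move=> gc.
  have : ((2^-1 : R) ^+ l) @[l --> \oo] --> (0 : R).
    by apply: cvg_expr; rewrite gtr0_norm// invf_lt1// ltr1n.
  move=> /cvgr_lt /(_ (c - g x)) []; first by rewrite subr_gt0.
  move=> l _ /(_ l (leqnn l)) /=; rewrite exprVn => h.
  exists l => //; split; first exact: lt_le_trans gc cM.
  apply: le_lt_trans (upper_level_le l x) _; lra.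
apply: (@nondecreasing_cvg_mu _ _ _ (@hyp_measure R)).
- by move=> l; exact: measurable_upper_level.
- by apply: bigcupT_measurable => l; exact: measurable_upper_level.
- apply/nondecreasing_seqP => l; apply/subsetPset => x /= [gM uc]; split=> //.
  exact: le_lt_trans (upper_level_nincr l x) uc.
Qed.

End threshold_level.

Section marked_area.
Context {R : realType} (law : probability R R) (h : R -> R).
Implicit Types (g : R * R -> R).

(** The mass of the marked points [(x, r)] with [g x < h r], those that violate the event of [g],
    under the product of the area and the law of the marks. *)
Definition marked_area g : \bar R :=
  (\int[law]_r hyp_area [set x | (g x < h r)%R])%E.

(** Points with [M <= g x] can never violate [h r <= g x], so everything happens on a set of finite
    area, where Poisson counts are finite. *)
Definition admissible g := exists M, [/\ measurable_fun setT g,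
  forall x, 0 <= g x, forall r, h r <= M & (hyp_area [set x | (g x < M)%R] < +oo)%E].

Hypothesis mh : measurable_fun setT h.

Let measurable_mark_gt c : measurable [set r | c < h r].
Proof.
have := mh measurableT (measurable_itv `]c, +oo[).
by rewrite setTI; congr measurable; apply/seteqP; split=> r /=; rewrite in_itv/= andbT.
Qed.

Let step_fun g M l r : \bar R :=
  (\sum_(i < cell_count M l) fine (hyp_area (level_cell g (M := M) i)) *
     \1_[set r | i.+1%:R / 2 ^+ l < h r] r)%:E.

Let step_funE g M l r : measurable_fun setT g -> (forall x, 0 <= g x) ->
  (hyp_area [set x | (g x < M)%R] < +oo)%E ->
  step_fun g M l r = hyp_area [set x | g x < M /\ upper_level g l x < h r].
Proof.
move=> mg g0 finM; rewrite area_upper_level//; congr EFin; apply: eq_bigr => i _.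
by rewrite indicE; congr (_ * (nat_of_bool _)%:R); apply/idP/idP => [/set_mem|/mem_set].
Qed.

Let measurable_step_fun g M l : measurable_fun setT (step_fun g M l).
Proof.
by apply/measurable_EFinP; apply: measurable_sum => i; apply: measurable_funM.
Qed.

Lemma measurable_marked g : admissible g ->
  measurable_fun setT (fun r => hyp_area [set x | (g x < h r)%R]).
Proof.
move=> [M [mg g0 hM finM]].
apply: (emeasurable_fun_cvg (step_fun g M)); first by move=> l; exact: measurable_step_fun.
move=> r _; under eq_fun do rewrite step_funE//.
exact: cvg_area_upper_level.
Qed.

Lemma marked_area_lty g : admissible g -> (marked_area g < +oo)%E.
Proof.
move=> ag; have [M [mg g0 hM finM]] := ag.
apply: (@le_lt_trans _ _ (\int[law]_r (cst (hyp_area [set x | (g x < M)%R])) r)%E).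
  apply: ge0_le_integral => //.
  - exact: measurable_marked.
  - move=> r _; apply: (le_measure (@hyp_measure R)); rewrite ?inE.
    + exact: measurable_sublevel.
    + exact: measurable_sublevel.
    + by move=> x /= /lt_le_trans; apply.
by rewrite integral_cst//= probability_setT mule1.
Qed.

Lemma marked_area_ge0 g : (0 <= marked_area g)%E.
Proof. by apply: integral_ge0 => r _; exact: hyp_area_ge0. Qed.

Lemma marked_area_fin g : admissible g -> marked_area g \is a fin_num.
Proof. by move=> ag; rewrite ge0_fin_numE ?marked_area_ge0// marked_area_lty. Qed.

Lemma cvg_marked_area g M : measurable_fun setT g -> (forall x, 0 <= g x) ->
  (forall r, h r <= M) -> (hyp_area [set x | (g x < M)%R] < +oo)%E ->
  (\sum_(i < cell_count M l) fine (hyp_area (level_cell g (M := M) i)) *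
     (1 - fine (law [set r | h r <= i.+1%:R / 2 ^+ l]))) @[l --> \oo] -->
  fine (marked_area g).
Proof.
move=> mg g0 hM finM.
have ag : admissible g by exists M.
have sumE l : (\int[law]_r step_fun g M l r)%E =
    (\sum_(i < cell_count M l) fine (hyp_area (level_cell g (M := M) i)) *
     (1 - fine (law [set r | h r <= i.+1%:R / 2 ^+ l])))%:E.
  rewrite integral_sum_indic//; last by move=> i; exact/fine_ge0/hyp_area_ge0.
  rewrite -sumEFin; apply: eq_bigr => i _; rewrite EFinM; congr (_ * _)%E.
  rewrite (_ : [set r | h r <= _] = ~` [set r | i.+1%:R / 2 ^+ l < h r]); last first.
    by apply/seteqP; split=> r /=; rewrite leNgt => /negP.
  rewrite probability_setC// fineB ?fin_num_measure//=.
  by rewrite subKr fineK// fin_num_measure.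
have cv : (\int[law]_r step_fun g M l r)%E @[l --> \oo] --> marked_area g.
  rewrite /marked_area.
  have mono r : nondecreasing_seq (fun l => step_fun g M l r).
    apply/nondecreasing_seqP => l; rewrite !step_funE//.
    apply: (le_measure (@hyp_measure R)); rewrite ?inE; try exact: measurable_upper_level.
    move=> x /= [gM uc]; split=> //.
    exact: le_lt_trans (upper_level_nincr g0 l x) uc.
  have lim r : limn (fun l => step_fun g M l r) = hyp_area [set x | (g x < h r)%R].
    apply/cvg_lim => //; under eq_fun do rewrite step_funE//.
    exact: cvg_area_upper_level.
  under [X in _ --> X]eq_integral do rewrite -lim.
  apply: cvg_monotone_convergence => //.
  - by move=> l r _; rewrite step_funE// hyp_area_ge0.
apply: (@fine_cvg _ _ _ _ (fun l => (\sum_(i < cell_count M l) fine (hyp_area (level_cell g (M := M) i)) *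
     (1 - fine (law [set r | h r <= i.+1%:R / 2 ^+ l])))%:E)).
rewrite fineK ?marked_area_fin//.
by under eq_fun do rewrite -sumE.
Qed.

Lemma hyp_area_UI (A B : set (R * R)) : measurable A -> measurable B ->
  (hyp_area (A `|` B) + hyp_area (A `&` B) = hyp_area A + hyp_area B)%E.
Proof.
move=> mA mB; have mBA : measurable (B `\` A) by exact: measurableD.
have e1 : A `|` B = A `|` (B `\` A).
  by rewrite setDE setUIr setUCr setIT.
have e2 : B = (B `\` A) `|` (A `&` B).
  by rewrite setDE (setIC A) -setIUr setUC setUCr setIT.
have mAB : measurable (A `&` B) by exact: measurableI.
have addU (X Y : set (R * R)) : measurable X -> measurable Y -> X `&` Y = set0 ->
    hyp_area (X `|` Y) = (hyp_area X + hyp_area Y)%E := @measureU _ _ _ (@hyp_measure R) X Y.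
rewrite e1 [in RHS]e2 !addU ?addeA//.
  by apply/seteqP; split=> x // [[_ nA] [Ax _]].
by apply/seteqP; split=> x // [Ax [_ nA]].
Qed.

Lemma admissible_max g1 g2 : admissible g1 -> admissible g2 ->
  admissible (fun x => Num.max (g1 x) (g2 x)).
Proof.
move=> [M [mg1 g10 hM1 fin1]] [M' [mg2 g20 _ _]]; exists M; split=> //.
- exact: measurable_maxr.
- by move=> x; rewrite le_max g10.
- apply: le_lt_trans fin1; apply: (le_measure (@hyp_measure R)); rewrite ?inE.
  + by apply: measurable_sublevel; exact: measurable_maxr.
  + exact: measurable_sublevel.
  + by move=> x /=; rewrite gt_max => /andP[].
Qed.

Lemma admissible_min g1 g2 : admissible g1 -> admissible g2 ->
  admissible (fun x => Num.min (g1 x) (g2 x)).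
Proof.
move=> [M1 [mg1 g10 hM1 fin1]] [M2 [mg2 g20 hM2 fin2]]; exists (Num.min M1 M2); split=> //.
- exact: measurable_minr.
- by move=> x; rewrite le_min g10 g20.
- by move=> r; rewrite le_min hM1 hM2.
- have m1 := measurable_sublevel mg1 (Num.min M1 M2).
  have m2 := measurable_sublevel mg2 (Num.min M1 M2).
  apply: (@le_lt_trans _ _ (hyp_area ([set x | g1 x < Num.min M1 M2] `|` [set x | g2 x < Num.min M1 M2]))).
    apply: (le_measure (@hyp_measure R)); rewrite ?inE.
    + by apply: measurable_sublevel; exact: measurable_minr.
    + exact: measurableU.
    + by move=> x /=; rewrite gt_min => /orP[]; [left|right].
  apply: (@le_lt_trans _ _ (hyp_area [set x | (g1 x < Num.min M1 M2)%R] +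
    hyp_area [set x | (g2 x < Num.min M1 M2)%R])%E).
    by apply: (@measureU2 _ _ _ (@hyp_measure R)).
  apply: lte_add_pinfty; [apply: le_lt_trans fin1|apply: le_lt_trans fin2];
    apply: (le_measure (@hyp_measure R)); rewrite ?inE; try exact: measurable_sublevel.
    by move=> x /=; rewrite lt_min => /andP[].
  by move=> x /=; rewrite lt_min => /andP[].
Qed.

(** For each mark, the set where the minimum is below it is a union and the set where the maximum is
    below it is an intersection; then inclusion-exclusion for areas. *)
Lemma marked_area_minmax g1 g2 : admissible g1 -> admissible g2 ->
  (marked_area (fun x => Num.min (g1 x) (g2 x)) + marked_area (fun x => Num.max (g1 x) (g2 x)) =
   marked_area g1 + marked_area g2)%E.
Proof.
move=> a1 a2.
have D g g' : admissible g -> admissible g' -> (marked_area g + marked_area g' =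
    \int[law]_r (hyp_area [set x | (g x < h r)%R] + hyp_area [set x | (g' x < h r)%R]))%E.
  move=> ag ag'; rewrite ge0_integralD//.
  - exact: measurable_marked.
  - exact: measurable_marked.
apply: (etrans (D _ _ (admissible_min a1 a2) (admissible_max a1 a2))).
apply: (etrans _ (esym (D _ _ a1 a2))).
apply: eq_integral => r _; rewrite -[RHS]hyp_area_UI.
- congr (hyp_area _ + hyp_area _)%E; apply/seteqP; split=> x /=.
  + by rewrite gt_min => /orP[]; [left|right].
  + by rewrite gt_min => -[] ->; rewrite ?orbT.
  + by rewrite gt_max => /andP[].
  + by rewrite gt_max => -[-> ->].
- by case: a1 => M [? _ _ _]; exact: measurable_sublevel.
- by case: a2 => M [? _ _ _]; exact: measurable_sublevel.
Qed.

Lemma eq_marked_area g1 g2 : (forall x, H2 x -> g1 x = g2 x) ->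
  marked_area g1 = marked_area g2.
Proof.
move=> g12; apply: eq_integral => r _.
rewrite -(hyp_area_H2 [set x | g2 x < h r]) -(hyp_area_H2 [set x | g1 x < h r]).
by congr hyp_area; apply/seteqP; split=> x [/= gx Hx]; split=> //=; rewrite ?g12// -g12.
Qed.

End marked_area.

Section void_threshold.
Context {d} {T : measurableType d} {R : realType} (P : probability T R).
Context (lambda : R) (law : probability R R).
Variables (xi : nat -> T -> R * R) (rho : nat -> T -> R).
Hypothesis model : is_boolean_model P lambda law xi rho.
Variable h : R -> R.
Hypothesis mh : measurable_fun setT h.

Definition below (g : R * R -> R) : set T :=
  [set w | forall n, H2 (xi n w) -> h (rho n w) <= g (xi n w)].

(** Replacing [g] by its roundings gives events of the form treated in [void_cells]. They decrease
    to [below g], and their exponents converge to the marked area by monotone convergence. *)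
Lemma void_threshold g : admissible h g -> measurable (below g) /\
  P (below g) = (expR (- (lambda * fine (marked_area law h g))))%:E.
Proof.
move=> [M [mg g0 hM finM]].
pose A l i := level_cell g (M := M) (l := l) i.
pose B l (i : 'I_(cell_count M l)) : set R := [set r | h r <= i.+1%:R / 2 ^+ l].
have mB l i : measurable (B l i).
  have := mh measurableT (measurable_itv `]-oo, (i.+1%:R / 2 ^+ l)]).
  by rewrite setTI; congr measurable; apply/seteqP; split=> r /=; rewrite in_itv.
pose E l : set T := [set w | forall n i, (A l i `&` H2) (xi n w) -> B l i (rho n w)].
have [mE PE] : (forall l, measurable (E l)) /\ (forall l, P (E l) =
    (expR (- (lambda * \sum_(i < cell_count M l) fine (hyp_area (A l i)) * (1 - fine (law (B l i))))))%:E).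
  suff vc l : measurable (E l) /\ P (E l) =
      (expR (- (lambda * \sum_(i < cell_count M l) fine (hyp_area (A l i)) * (1 - fine (law (B l i))))))%:E.
    by split=> l; have [] := vc l.
  apply: (void_cells model).
  - by move=> i; exact: measurable_level_cell.
  - exact: mB.
  - exact: trivIset_level_cell.
  - by move=> i; exact: level_cell_finite.
have EE l w : E l w <-> forall n, H2 (xi n w) -> g (xi n w) < M ->
    h (rho n w) <= upper_level g l (xi n w).
  split=> [Elw n Hn gM|hyp n i [Ai Hn]].
    have [i ix] := level_cellP g0 l gM.
    by rewrite (upper_level_cell ix); apply: (Elw n i); split.
  rewrite /B/= -(upper_level_cell Ai); apply: hyp => //.
  by case: Ai.
have belowE : below g = \bigcap_l E l.
  apply/seteqP; split=> w hyp.
    move=> l _; apply/EE => n Hn gM; apply: le_trans (hyp n Hn) _.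
    exact/ltW/upper_level_gt.
  move=> n Hn; have [gM|gM] := ltP (g (xi n w)) M; last exact: le_trans (hM _) gM.
  have c1 : (g (xi n w) + (2^-1) ^+ l) @[l --> \oo] --> g (xi n w) + 0.
    apply: cvgD; first exact: cvg_cst.
    by apply: cvg_expr; rewrite gtr0_norm// invf_lt1// ltr1n.
  rewrite addr0 in c1; apply: ler_cvg_to (cvg_cst _) c1 _.
  apply: nearW => l; have /EE := hyp l I; move=> /(_ n Hn gM) /le_trans; apply.
  by rewrite exprVn; exact: upper_level_le.
have mbelow : measurable (below g) by rewrite belowE; exact: bigcapT_measurable.
split=> //.
have c1 : P (E l) @[l --> \oo] --> P (below g).
  rewrite belowE; apply: nonincreasing_cvg_mu => //.
  - by rewrite (le_lt_trans (probability_le1 _ _))// ltry.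
  - by rewrite -belowE.
  - apply/nonincreasing_seqP => l; apply/subsetPset => w /EE El; apply/EE => n Hn gM.
    by apply: le_trans (El n Hn gM) _; exact: upper_level_nincr.
have c2 : P (E l) @[l --> \oo] --> (expR (- (lambda * fine (marked_area law h g))))%:E.
  under eq_fun do rewrite PE.
  apply/fine_cvgP; split; first exact: nearW.
  have /= c3 := @cvg_marked_area _ law h mh g M mg g0 hM finM.
  apply: (cvg_comp _ expR); last exact: continuous_expR.
  by apply: cvgN; apply: cvgM => //; exact: cvg_cst.
exact: (cvg_unique _ c1 c2).
Qed.

End void_threshold.

(** * Area near two rays *)

Section rotation_invariance.
Context {R : realType}.
Local Notation mu := (@lebesgue_measure R).
Local Notation mu2 := (@lebesgue_measure R \x @lebesgue_measure R)%E.
Local Notation R1 := (measurableTypeR R).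
Local Notation RR := (measurableTypeR R * measurableTypeR R)%type.
Implicit Types (A : set RR) (c : R).

Lemma lebesgue_measure_translation c (B : set R1) : measurable B ->
  mu ((fun y => y + c) @^-1` B) = mu B.
Proof.
have mD : measurable_fun setT ((fun y => y + c) : R1 -> R1).
  exact: (@measurable_funD _ _ R setT id (cst c)).
pose nu : {measure set R1 -> \bar R} := pushforward mu ((fun y => y + c) : R1 -> R1).
move=> mB; apply/esym/(@lebesgue_measure_unique _ (nu mD)) => //= _ [[a b]] _ <-.
rewrite /nu/= /pushforward.
have -> : (fun y : R => y + c) @^-1` `]a, b] = `]a - c, b - c]%classic.
  by apply/seteqP; split=> y /=; rewrite !in_itv/= ltrBlDr lerBrDr.
by rewrite !lebesgue_measure_itv/= !lte_fin ltrD2r -!EFinB opprB addrA subrK.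
Qed.

Lemma measurable_shear2 c : measurable_fun setT (fun z : RR => (z.1, z.2 + c * z.1) : RR).
Proof.
apply/measurable_fun_pairP; split => /=; first exact: measurable_fst.
apply: (@measurable_funD _ _ R); first exact: measurable_snd.
by apply: (@measurable_funM _ _ R) => //; exact: measurable_fst.
Qed.

Lemma measurable_shear1 c : measurable_fun setT (fun z : RR => (z.1 + c * z.2, z.2) : RR).
Proof.
apply/measurable_fun_pairP; split => /=; last exact: measurable_snd.
apply: (@measurable_funD _ _ R); first exact: measurable_fst.
by apply: (@measurable_funM _ _ R) => //; exact: measurable_snd.
Qed.

Lemma lebesgue2_shear2 c A : measurable A ->
  mu2 ((fun z : RR => (z.1, z.2 + c * z.1) : RR) @^-1` A) = mu2 A.
Proof.
move=> mA; apply: eq_integral => x _ /=.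
rewrite -(@lebesgue_measure_translation (c * x) (xsection A x)); last exact: measurable_xsection.
by congr mu; apply/seteqP; split=> y; rewrite /xsection/= !inE.
Qed.

Lemma lebesgue2_ysection A : measurable A ->
  mu2 A = (\int[mu]_y mu (ysection A y))%E.
Proof.
move=> mA; apply: (@product_measure_unique _ _ R1 R1 R mu mu (mu \x^ mu)%E) => // B C mB mC.
exact: product_measure2E.
Qed.

Lemma lebesgue2_shear1 c A : measurable A ->
  mu2 ((fun z : RR => (z.1 + c * z.2, z.2) : RR) @^-1` A) = mu2 A.
Proof.
move=> mA; rewrite !lebesgue2_ysection//; last first.
  by rewrite -[_ @^-1` _]setTI; exact: measurable_shear1.
apply: eq_integral => x _ /=.
rewrite -(@lebesgue_measure_translation (c * x) (ysection A x)); last exact: measurable_ysection.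
by congr mu; apply/seteqP; split=> y; rewrite /ysection/= !inE.
Qed.

Definition rotate (m : R) (z : RR) : RR :=
  (z.1 * cos m - z.2 * sin m, z.1 * sin m + z.2 * cos m).

Lemma measurable_rotate m : measurable_fun setT (rotate m).
Proof.
have m1 : measurable_fun setT (fun z : RR => z.1) by exact: measurable_fst.
have m2 : measurable_fun setT (fun z : RR => z.2) by exact: measurable_snd.
apply/measurable_fun_pairP; split => /=.
  by apply: (@measurable_funB _ _ R); apply: (@measurable_funM _ _ R).
by apply: (@measurable_funD _ _ R); apply: (@measurable_funM _ _ R).
Qed.

(* A rotation of angle [m] is a product of three shears, by [- tan (m / 2)],
   [sin m] and [- tan (m / 2)]. *)
Lemma lebesgue2_rotate m A : 0 <= m < pi -> measurable A ->
  mu2 (rotate m @^-1` A) = mu2 A.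
Proof.
move=> /andP[m0 mpi] mA.
pose c := - tan (m / 2).
pose S1 (z : RR) : RR := (z.1 + c * z.2, z.2).
pose S2 (z : RR) : RR := (z.1, z.2 + sin m * z.1).
have rE z : rotate m z = S1 (S2 (S1 z)).
  have ch : cos (m / 2) != 0.
    by rewrite gt_eqF// cos_gt0_pihalf//; have := @pi_gt0 R; lra.
  have sE : sin m = 2 * sin (m / 2) * cos (m / 2).
    have -> : sin m = sin (m / 2 + m / 2) by congr sin; field.
    by rewrite sinD; ring.
  have cE : cos m = cos (m / 2) ^+ 2 - sin (m / 2) ^+ 2.
    have -> : cos m = cos (m / 2 + m / 2) by congr cos; field.
    by rewrite cosD; ring.
  have u := cos2Dsin2 (m / 2).
  have e1 : c * sin m = - 2 * sin (m / 2) ^+ 2.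
    by rewrite /c /tan sE; field.
  have e2 : 1 + c * sin m = cos m.
    by rewrite e1 cE; lra.
  have e3 : c + c * (1 + sin m * c) = - sin m.
    rewrite [sin m * c]mulrC e2 cE sE /c /tan.
    transitivity (- (sin (m / 2) / cos (m / 2)) * (1 + (cos (m / 2) ^+ 2 - sin (m / 2) ^+ 2))).
      by ring.
    rewrite -[X in X + (_ - _)]u; field; exact: ch.
  rewrite /rotate /S1 /S2 /=; congr pair.
    transitivity (z.1 * (1 + c * sin m) + z.2 * (c + c * (1 + sin m * c))); last by ring.
    by rewrite e2 e3; ring.
  transitivity (z.1 * sin m + z.2 * (1 + c * sin m)); last by ring.
  by rewrite e2.
have mS1 := measurable_shear1 c; have mS2 := measurable_shear2 (sin m).
have m1 : measurable (S1 @^-1` A) by rewrite -[_ @^-1` _]setTI; exact: mS1.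
have m2 : measurable (S2 @^-1` (S1 @^-1` A)) by rewrite -[_ @^-1` _]setTI; exact: mS2.
transitivity (mu2 (S1 @^-1` (S2 @^-1` (S1 @^-1` A)))).
  by congr mu2; apply/seteqP; split=> z; rewrite /= -?rE ?rE.
by rewrite lebesgue2_shear1// lebesgue2_shear2// lebesgue2_shear1.
Qed.

Lemma rotate_sqnorm m z : sqnorm (rotate m z) = sqnorm z.
Proof.
rewrite /sqnorm /=; transitivity ((z.1 ^+ 2 + z.2 ^+ 2) * (cos m ^+ 2 + sin m ^+ 2)).
  by ring.
by rewrite cos2Dsin2 mulr1.
Qed.

Lemma hyp_area_rotate m (A : set (R * R)) : 0 <= m < pi -> measurable A ->
  hyp_area (rotate m @^-1` A) = hyp_area A.
Proof.
move=> mpi mA.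
have mr := measurable_rotate m.
have mAH : measurable (A `&` H2 : set RR) by apply: measurableI => //; exact: measurable_H2.
pose f (z : RR) : \bar R := (hyp_density z)%:E.
transitivity (\int[mu2]_(z in rotate m @^-1` (A `&` H2)) (f \o rotate m) z)%E.
  rewrite /hyp_area.
  have -> : rotate m @^-1` A `&` H2 = rotate m @^-1` (A `&` H2).
    apply/seteqP; split=> z; rewrite /H2 /= -!/(sqnorm _).
      by move=> [Az Hz]; split=> //; rewrite -/(sqnorm (rotate m z)) rotate_sqnorm.
    by move=> [Az]; rewrite -/(sqnorm (rotate m z)) rotate_sqnorm.
  apply: eq_integral => z _; rewrite /f /hyp_density /= -/(sqnorm (rotate m z)).
  by rewrite rotate_sqnorm.
have f0 : {in A `&` H2, forall z : RR, (0 <= f z)%E}.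
  by move=> z _; rewrite lee_fin hyp_density_ge0.
have pf := @ge0_integral_pushforward _ _ RR RR R (rotate m) mr mu2 (A `&` H2) f mAH
  (@measurable_hyp_densityE R (A `&` H2)) f0.
apply: etrans (esym pf) _.
apply: (@eq_measure_integral _ RR R (A `&` H2) mu2 (pushforward mu2 (rotate m)) f) => B mB BA.
exact: lebesgue2_rotate.
Qed.

End rotation_invariance.

Section slices.
Context {R : realType}.
Local Notation mu := (@lebesgue_measure R).
Local Notation mu2 := (@lebesgue_measure R \x @lebesgue_measure R)%E.
Local Notation R1 := (measurableTypeR R).
Local Notation RR := (measurableTypeR R * measurableTypeR R)%type.
Implicit Types (A : set RR).

Definition slice A (x : R) : \bar R :=
  (\int[mu]_(y in xsection (A `&` H2) x) (hyp_density (x, y))%:E)%E.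

Let f A : RR -> \bar R := (fun z : RR => (hyp_density z)%:E) \_ (A `&` H2).

Let mAH A : measurable A -> measurable (A `&` H2 : set RR).
Proof. by move=> mA; apply: measurableI => //; exact: measurable_H2. Qed.

Let f_ge0 A z : (0 <= f A z)%E.
Proof. by rewrite /f patchE; case: ifP => _ //; rewrite lee_fin hyp_density_ge0. Qed.

Let measurable_f A : measurable A -> measurable_fun setT (f A).
Proof.
move=> mA; apply/(measurable_restrictT _ (mAH mA)).
exact: measurable_hyp_densityE.
Qed.

Let sliceE A x : slice A x = fubini_F mu (f A) x.
Proof.
apply: etrans (integral_mkcond _ _) _; apply: eq_integral => y _.
by rewrite /f !patchE mem_xsection.
Qed.

Lemma slice_ge0 A x : (0 <= slice A x)%E.
Proof. by apply: integral_ge0 => y _; rewrite lee_fin hyp_density_ge0. Qed.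

Lemma measurable_slice A : measurable A -> measurable_fun setT (slice A : R1 -> \bar R).
Proof.
move=> mA; rewrite (_ : slice A = fubini_F mu (f A)); last by apply/funext => x; exact: sliceE.
by apply: measurable_fun_fubini_tonelli_F => //; exact: measurable_f.
Qed.

Lemma hyp_area_slice A : measurable A -> hyp_area A = (\int[mu]_x slice A x)%E.
Proof.
move=> mA; rewrite /hyp_area integral_mkcond.
have := @fubini_tonelli1 _ _ R1 R1 R mu mu (f A) (measurable_f mA) (f_ge0 A).
move=> e; apply: etrans e _; apply: eq_integral => x _; exact/esym/sliceE.
Qed.

Lemma hyp_area_le_primitive A (a b : R) (phi Phi : R -> R) : measurable A -> a < b ->
  (forall z, A z -> H2 z -> a <= z.1 <= b) ->
  (forall x, a <= x <= b -> {for x, continuous phi}) ->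
  (forall x, a <= x <= b -> is_derive x 1 Phi (phi x)) ->
  (forall x, a <= x <= b -> (slice A x <= (phi x)%:E)%E) ->
  (hyp_area A <= (Phi b - Phi a)%:E)%E.
Proof.
move=> mA ab Aab cphi dPhi le_phi.
rewrite -(is_derive_FTC2 ab cphi dPhi) hyp_area_slice//.
have -> : (\int[mu]_x slice A x = \int[mu]_(x in `[a, b]) slice A x)%E.
  rewrite [RHS]integral_mkcond; apply: eq_integral => x _; rewrite patchE.
  case: ifPn => // /negP nx; rewrite /slice.
  suff -> : xsection (A `&` H2) x = set0 by rewrite integral_set0.
  apply/seteqP; split=> y //; rewrite /xsection/= inE => -[Az Hz].
  by apply: nx; rewrite inE/= in_itv/=; exact: (Aab (x, y)).
apply: ge0_le_integral => //.
- by move=> x _; exact: slice_ge0.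
- by apply: measurable_funTS; exact: measurable_slice.
- have : mu.-integrable `[a, b] (EFin \o phi).
    apply: continuous_compact_integrable; first exact: segment_compact.
    by apply: continuous_in_subspaceT => t; rewrite inE/= in_itv/=; exact: cphi.
  by case/integrableP.
Qed.

Lemma hyp_area_ge_primitive A (a b : R) (phi Phi : R -> R) : measurable A -> a < b ->
  (forall x, a <= x <= b -> {for x, continuous phi}) ->
  (forall x, a <= x <= b -> is_derive x 1 Phi (phi x)) ->
  (forall x, a <= x <= b -> ((phi x)%:E <= slice A x)%E) ->
  ((Phi b - Phi a)%:E <= hyp_area A)%E.
Proof.
move=> mA ab cphi dPhi le_phi.
(* [phi] may be negative while slices are nonnegative; the positive part allows the comparison of
   nonnegative integrals. *)
pose v x := Num.max 0 (phi x).
have cv x : a <= x <= b -> {for x, continuous v}.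
  move=> xab; apply: (@continuous_max _ _ (cst 0) phi); [exact: cvg_cst|exact: cphi].
have le1 : Phi b - Phi a <= \int[mu]_(x in `[a, b]) v x.
  apply: (is_derive_le_integral ab cphi cv dPhi) => x _.
  by rewrite /v le_max lexx orbT.
have iv : mu.-integrable `[a, b] (EFin \o v).
  apply: continuous_compact_integrable; first exact: segment_compact.
  by apply: continuous_in_subspaceT => t; rewrite inE/= in_itv/=; exact: cv.
apply: (@le_trans _ _ (\int[mu]_(x in `[a, b]) (v x)%:E)%E).
  by rewrite -[leRHS]fineK ?lee_fin//; exact: integrable_fin_num.
apply: (@le_trans _ _ (\int[mu]_(x in `[a, b]) slice A x)%E).
  apply: ge0_le_integral => //.
  - by move=> x _; rewrite lee_fin /v le_max lexx.
  - by case/integrableP: iv.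
  - by apply: measurable_funTS; exact: measurable_slice.
  - move=> x /=; rewrite in_itv/= => xab; rewrite /v; case: (leP 0 (phi x)) => _.
      exact: le_phi.
    exact: slice_ge0.
rewrite hyp_area_slice//; apply: ge0_subset_integral => //.
  exact: measurable_slice.
by move=> x _; exact: slice_ge0.
Qed.

Let measurable_section_density x : measurable_fun setT (fun y : R1 => (hyp_density (x, y))%:E).
Proof.
apply: (@measurableT_comp _ _ _ _ _ _ (fun z : RR => (hyp_density z)%:E) _ (fun y : R1 => (x, y) : RR)).
  exact: measurable_hyp_densityE.
exact: measurable_pair1.
Qed.

Lemma slice_le A (x Y : R) : measurable A -> 0 < Y -> Y ^+ 2 < 1 - x ^+ 2 ->
  (forall y, A (x, y) -> H2 (x, y) -> `|y| <= Y) ->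
  (slice A x <= (8 * Y / ((1 - x ^+ 2) * (1 - x ^+ 2 - Y ^+ 2)))%:E)%E.
Proof.
move=> mA Y0; set w := 1 - x ^+ 2 => Yw AY.
have w0 : 0 < w by apply: le_lt_trans (sqr_ge0 Y) Yw.
(* The density multiplied by [(w + y ^ 2) / w >= 1]. With this factor it has the rational primitive
   [Phi], whereas the density itself would bring in a logarithm. *)
pose phi y : R := 4 / w * ((w + y ^+ 2) / (w - y ^+ 2) ^+ 2).
pose Phi y : R := 4 / w * (y / (w - y ^+ 2)).
have D0 y : - Y <= y <= Y -> 0 < w - y ^+ 2.
  move=> yY; rewrite subr_gt0; apply: le_lt_trans Yw.
  by move: yY => /andP[y1 y2]; rewrite -subr_ge0 subr_sqr mulr_ge0//; lra.
have cphi y : - Y <= y <= Y -> {for y, continuous phi}.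
  by move=> yY; rewrite /phi; continuous_tac; rewrite expf_neq0 ?gt_eqF ?D0.
have dPhi y : - Y <= y <= Y -> is_derive y 1 Phi (phi y).
  move=> yY; have D := D0 _ yY.
  have -> : phi y = 4 / w * (y * (- (w - y ^+ 2) ^- 2 * (0 - 2 * y * 1)) +
      (w - y ^+ 2)^-1 * 1) + y * (w - y ^+ 2)^-1 * 0.
    by rewrite /phi; field; rewrite !gt_eqF.
  by rewrite /Phi; derive_tac; rewrite gt_eqF.
have mf : measurable_fun setT (fun y : R1 => (hyp_density (x, y))%:E).
  exact: measurable_section_density.
apply: (@le_trans _ _ (\int[mu]_(y in `[(- Y)%R, Y]) (hyp_density (x, y))%:E)%E).
  apply: ge0_subset_integral => //.
  - by apply: measurable_xsection; exact: mAH.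
  - exact: measurable_funTS.
  - by move=> y _; rewrite lee_fin hyp_density_ge0.
  - move=> y; rewrite /xsection/= inE => -[Ay Hy].
    by rewrite in_itv/= -ler_norml; exact: AY.
apply: (@le_trans _ _ (\int[mu]_(y in `[(- Y)%R, Y]) (phi y)%:E)%E).
  apply: ge0_le_integral => //.
  - by move=> y _; rewrite lee_fin hyp_density_ge0.
  - exact: measurable_funTS.
  - have : mu.-integrable `[- Y, Y] (EFin \o phi).
      apply: continuous_compact_integrable; first exact: segment_compact.
      by apply: continuous_in_subspaceT => t; rewrite inE/= in_itv/=; exact: cphi.
    by case/integrableP.
  - move=> y /=; rewrite in_itv/= => yY; have D := D0 _ yY.
    rewrite lee_fin /hyp_density/= /phi.
    have -> : 1 - (x ^+ 2 + y ^+ 2) = w - y ^+ 2 by rewrite /w opprD addrA.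
    have -> : 4 / w * ((w + y ^+ 2) / (w - y ^+ 2) ^+ 2) = 4 * ((w + y ^+ 2) / w) / (w - y ^+ 2) ^+ 2.
      by field; rewrite !gt_eqF.
    rewrite ler_pM2r ?invr_gt0 ?exprn_gt0// ler_peMr// ler_pdivlMr// mul1r.
    by have := sqr_ge0 y; lra.
rewrite (is_derive_FTC2 _ cphi dPhi); last by lra.
rewrite lee_fin /Phi sqrrN le_eqVlt; apply/orP; left; apply/eqP.
by field; rewrite !gt_eqF// subr_gt0.
Qed.

Lemma slice_ge A (x Z : R) : measurable A ->
  (forall y, `|y| < Z -> A (x, y) /\ H2 (x, y)) ->
  ((8 * Z / (1 - x ^+ 2) ^+ 2)%:E <= slice A x)%E.
Proof.
move=> mA AZ; have [Z0|Z0] := leP Z 0.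
  apply: (@le_trans _ _ 0%E); last exact: slice_ge0.
  by rewrite lee_fin mulr_le0_ge0 ?invr_ge0 ?sqr_ge0// pmulr_rle0.
have w0 : 0 < 1 - x ^+ 2.
  have [_] := AZ 0 (eq_ind_r (fun t => t < Z) Z0 (normr0 _)).
  by rewrite /H2/= expr0n/= addr0 subr_gt0.
set w := 1 - x ^+ 2 in w0 *.
have sub : `]- Z, Z[%classic `<=` xsection (A `&` H2) x.
  by move=> y /=; rewrite in_itv/= -ltr_norml => /AZ[Ay Hy]; rewrite /xsection/= inE.
have mf : measurable_fun setT (fun y : R1 => (hyp_density (x, y))%:E).
  exact: measurable_section_density.
apply: (@le_trans _ _ (\int[mu]_(y in `](- Z)%R, Z[) (hyp_density (x, y))%:E)%E); last first.
  apply: ge0_subset_integral => //.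
  - by apply: measurable_xsection; exact: mAH.
  - exact: measurable_funTS.
  - by move=> y _; rewrite lee_fin hyp_density_ge0.
apply: (@le_trans _ _ (\int[mu]_(y in `](- Z)%R, Z[) (cst (4 / w ^+ 2)%:E) y)%E).
  rewrite integral_cst//= lebesgue_measure_itv/= lte_fin ifT; last by lra.
  by rewrite -EFinB -EFinM lee_fin le_eqVlt; apply/orP; left; apply/eqP; field; rewrite gt_eqF.
apply: ge0_le_integral => //.
- by move=> y _; rewrite lee_fin divr_ge0// sqr_ge0.
- exact: measurable_funTS.
- move=> y /=; rewrite in_itv/= -ltr_norml => /AZ[_]; rewrite /H2/= => Hy.
  rewrite lee_fin /hyp_density/= ler_pM2l// lef_pV2 ?posrE ?exprn_gt0 ?subr_gt0//;
    last by rewrite -subr_gt0.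
  have y0 := sqr_ge0 y; have xw : x ^+ 2 = 1 - w by rewrite /w subKr.
  by apply: lerXn2r; rewrite ?nnegrE/=; lra.
Qed.

End slices.

Section near_both_rays.
Context {R : realType}.
Local Notation mu2 := (@lebesgue_measure R \x @lebesgue_measure R)%E.
Local Notation RR := (measurableTypeR R * measurableTypeR R)%type.
Implicit Types (a b h K L x : R) (z : R * R).

Definition near_both a b K : set (R * R) :=
  [set z | Num.max (threshold a z) (threshold b z) < K].

Lemma measurable_near_both a b K : measurable (near_both a b K).
Proof.
by apply: measurable_sublevel; apply: measurable_maxr; exact: measurable_threshold.
Qed.

Lemma threshold_rotate m a z : threshold (a + m) (rotate m z) = threshold a z.
Proof.
rewrite /threshold rotate_sqnorm; congr (2 * Num.sqrt (_ - Num.max 0 _ ^+ 2) / _).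
rewrite /dot /rotate /= cosD sinD.
transitivity ((z.1 * cos a + z.2 * sin a) * (cos m ^+ 2 + sin m ^+ 2)); first by ring.
by rewrite cos2Dsin2 mulr1.
Qed.

Lemma hyp_area_near_both_rotate m a b K : 0 <= m < pi ->
  hyp_area (near_both (a + m) (b + m) K) = hyp_area (near_both a b K).
Proof.
move=> mpi; rewrite -(hyp_area_rotate mpi); last exact: measurable_near_both.
by congr hyp_area; apply/seteqP; split=> z; rewrite /near_both /= !threshold_rotate.
Qed.

(** A crude bound: the density is at most [4 / (1 - q) ^ 2] on the disc, which lies in a square of
    Euclidean area 4. *)
Lemma hyp_area_disc_le (q : R) : q < 1 ->
  (hyp_area [set z : R * R | (sqnorm z <= q)%R] <= (16 / (1 - q) ^+ 2)%:E)%E.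
Proof.
move=> q1; set D := [set z : R * R | _].
have mD : measurable (D : set RR).
  have := @measurable_sqr_sum R measurableT _ (measurable_itv `]-oo, q]).
  by rewrite setTI.
have mDH : measurable (D `&` H2 : set RR) by apply: measurableI => //; exact: measurable_H2.
pose box : set RR := `[(- 1 : R), 1]%classic `*` `[(- 1 : R), 1]%classic.
have mbox : measurable box by exact: measurableX.
have q0 : 0 < 4 / (1 - q) ^+ 2 by rewrite divr_gt0 ?exprn_gt0 ?subr_gt0.
have sub : D `&` H2 `<=` box.
  move=> z [_]; rewrite /H2/= => Hz; split; rewrite /= in_itv/= -ler_norml -(@ler_pXn2r _ 2) ?nnegrE//.
    by rewrite real_normK ?num_real// expr1n; have := sqr_ge0 z.2; lra.
  by rewrite real_normK ?num_real// expr1n; have := sqr_ge0 z.1; lra.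
apply: (@le_trans _ _ (\int[mu2]_(z in D `&` H2) (cst (4 / (1 - q) ^+ 2)%:E) z)%E).
  apply: ge0_le_integral => //.
  - by move=> z _; rewrite lee_fin hyp_density_ge0.
  - exact: measurable_hyp_densityE.
  - move=> z [Dz Hz]; rewrite lee_fin ler_pM2l// lef_pV2 ?posrE ?exprn_gt0 ?subr_gt0//.
    by apply: lerXn2r; rewrite ?nnegrE/= -?/(sqnorm z); move: Dz Hz; rewrite /D/H2/= -?/(sqnorm z); lra.
rewrite integral_cst//.
apply: (@le_trans _ _ ((4 / (1 - q) ^+ 2)%:E * mu2 box)%E).
  rewrite lee_pmul2l//; apply: (le_measure mu2) => //; rewrite inE//.
have -> : mu2 box = (4 : R)%:E.
  rewrite /box product_measure1E//= !lebesgue_measure_itv/= lte_fin ifT; last by lra.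
  by rewrite -EFinB -EFinM; congr EFin; ring.
by rewrite -EFinM lee_fin le_eqVlt; apply/orP; left; apply/eqP; field; rewrite subr_eq0 gt_eqF.
Qed.

(** The left side is the hyperbolic sine of the distance to the whole geodesic line, which contains
    the ray. *)
Lemma threshold_ge_cross a z : H2 z ->
  2 * `|cross a z| / (1 - sqnorm z) <= threshold a z.
Proof.
move=> Hz; have D0 : 0 < 1 - sqnorm z by rewrite subr_gt0.
rewrite /threshold ler_pM2r ?invr_gt0// ler_pM2l// -sqrtr_sqr ler_wsqrtr//.
have := dot_cross a z; have := sqr_ge0 (dot a z).
by rewrite /Num.max; case: ifP => _; rewrite ?expr0n/=; lra.
Qed.

Lemma threshold_dot_le0 a z : dot a z <= 0 ->
  threshold a z = 2 * Num.sqrt (sqnorm z) / (1 - sqnorm z).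
Proof. by move=> d0; rewrite /threshold max_l// expr0n/= subr0. Qed.

Section half_angle.
Variable h : R.
Hypothesis hpi : 0 < h < pi / 4.

Let h1 : h < 1.
Proof. by have := @pihalf_lt2 R; case/andP: hpi; lra. Qed.

Lemma half_angle_cos : [/\ 1 / 2 < cos h, sin h < cos h & 1 - h <= cos h].
Proof.
have [h0 h4] := andP hpi; have p0 := @pi_gt0 R.
have c0 : 0 < cos h by apply: cos_gt0_pihalf; lra.
have s0 : 0 < sin h by apply: sin_gt0_pihalf; lra.
have c2 : 0 < cos (h + h) by apply: cos_gt0_pihalf; lra.
have u := cos2Dsin2 h; rewrite cosD -!expr2 in c2.
split.
- rewrite ltNge; apply/negP => c12.
  have : cos h ^+ 2 <= (1 / 2) ^+ 2 by apply: lerXn2r; rewrite ?nnegrE//; lra.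
  lra.
- rewrite ltNge; apply/negP => sc.
  have : cos h ^+ 2 <= sin h ^+ 2 by apply: lerXn2r; rewrite ?nnegrE//; lra.
  lra.
- have [c _] := @MVT _ cos (fun x => - sin x) 0 h h0 (fun x _ => is_derive_cos x)
    (continuous_subspaceT (@continuous_cos R)).
  rewrite cos0 subr0 => e; have : sin c * h <= 1 * h by rewrite ler_pM2r// sin_le1.
  lra.
Qed.

Lemma half_angle_sin : h / 2 <= sin h <= h.
Proof.
have [h0 h4] := andP hpi; have p0 := @pi_gt0 R.
have [c] := @MVT _ sin cos 0 h h0 (fun x _ => is_derive_sin x)
    (continuous_subspaceT (@continuous_sin R)).
rewrite in_itv/= => /andP[c0 ch]; rewrite sin0 !subr0 => ->.
have [c12 _ _] := half_angle_cos.
have : cos h < cos c by rewrite ltr_cos ?in_itv/=//; lra.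
have : cos c * h <= 1 * h by rewrite ler_pM2r// cos_le1.
have : 0 < cos h * h by rewrite mulr_gt0//; lra.
move=> _ c1 cc; rewrite -[h / 2]mulrC mul1r in c1 *.
have : 2^-1 * h <= cos c * h by rewrite ler_pM2r//; lra.
lra.
Qed.

Variables (K L : R).
Hypotheses (K0 : 0 < K) (KL : K <= L).

(** The points of the right half-plane that are close to both lines of directions [- h] and [h]; the
    condition is the one for the farther line, on the other side of the axis. *)
Definition thin_region : set (R * R) :=
  [set z | 0 <= z.1 /\ 2 * (z.1 * sin h + `|z.2| * cos h) < K * (1 - sqnorm z)].

(** For [z.1 < 0] one of the two dot products is at most 0, because their sum is [2 * z.1 * cos h].
    The distance to that ray is then the distance to the origin, and the point lies in a compact
    disc that depends on [L] only. *)
Let near_both_sub : near_both (- h) h K `&` H2 `<=`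
  [set z | sqnorm z <= 1 - (L + 2)^-1] `|` thin_region.
Proof.
move: (K0) (KL) => K0' KL' z [] /=; rewrite /near_both/= gt_max => /andP[t1 t2] Hz.
have D0 : 0 < 1 - sqnorm z by rewrite subr_gt0.
have L0 : 0 < L by lra.
have [x0|x0] := ltP z.1 0; last first.
  right; split=> //.
  have := le_lt_trans (threshold_ge_cross (- h) Hz) t1.
  have := le_lt_trans (threshold_ge_cross h Hz) t2.
  rewrite !ltr_pdivrMr// /cross sinN cosN.
  have [n1|n1] := leP 0 z.2.
    rewrite (ger0_norm n1) => _; have := ler_norm (- (z.1 * - sin h - z.2 * cos h)); rewrite normrN; lra.
  by rewrite (ltr0_norm n1); have := ler_norm (z.1 * sin h - z.2 * cos h); lra.
left.
have big : 2 * Num.sqrt (sqnorm z) < L * (1 - sqnorm z).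
  have [c0 _ _] := half_angle_cos.
  have xc : z.1 * cos h < 0 by rewrite nmulr_rlt0//; lra.
  have KLD : K * (1 - sqnorm z) <= L * (1 - sqnorm z) by rewrite ler_pM2r.
  have [d|d] := leP (dot h z) 0.
    by move: t2; rewrite threshold_dot_le0// ltr_pdivrMr//; lra.
  move: t1; rewrite threshold_dot_le0 ?ltr_pdivrMr//; first by lra.
  by move: d; rewrite /dot cosN sinN; lra.
have n0 := sqrtr_ge0 (sqnorm z).
have nn : Num.sqrt (sqnorm z) ^+ 2 = sqnorm z by rewrite sqr_sqrtr// sqnorm_ge0.
rewrite lerBrDr -lerBrDl -[leLHS]mul1r ler_pdivrMr; last by lra.
set n := Num.sqrt (sqnorm z) in big n0 nn *; rewrite -nn in big D0 *.
have [n2|n2] := leP (1 / 2) n; first by nra.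
have : n ^+ 2 <= (1 / 2) ^+ 2 by apply: lerXn2r; rewrite ?nnegrE//; lra.
nra.
Qed.

Lemma measurable_thin_region : measurable thin_region.
Proof.
have m1 : measurable_fun setT (fun z : R * R => z.1) by exact: measurable_fst.
have m2 : measurable_fun setT (fun z : R * R => z.2) by exact: measurable_snd.
have -> : thin_region = [set z | - z.1 <= 0] `&`
    [set z | 2 * (z.1 * sin h + `|z.2| * cos h) - K * (1 - sqnorm z) < 0].
  by apply/seteqP; split=> z /=; rewrite oppr_le0 subr_lt0.
apply: measurableI.
  have := measurable_funN m1 => m; have := m measurableT _ (measurable_itv `]-oo, 0]).
  by rewrite setTI.
apply: measurable_sublevel; apply: measurable_funB.
  apply: measurable_funM => //; apply: measurable_funD; apply: measurable_funM => //.
  exact: measurableT_comp.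
apply: measurable_funM => //; apply: measurable_funB => //.
exact: measurable_sqr_sum.
Qed.

(** Beyond this abscissa the two rays are too far apart. For [x >= 1 / 2] the region requires [h / 2
    < 2 * x * sin h + ... < 2 * L * (1 - x)] up to the choice of constants, so it stops at a
    distance of order [h] from the circle; this is the source of [ln h^-1]. *)
Let X : R := 1 - h / (4 * L + 4).

Let X01 : 0 < X < 1.
Proof.
move: (K0) (KL) (h1) => K0' KL' h1'.
have [h0 _] := andP hpi; rewrite /X.
have : 0 < h / (4 * L + 4) by rewrite divr_gt0//; lra.
have : h / (4 * L + 4) < 1 by rewrite ltr_pdivrMr; lra.
lra.
Qed.

Let w_gt0 x : 0 <= x <= X -> 0 < 1 - x ^+ 2.
Proof. by move=> /andP[x0 x1]; have [_ X1] := andP X01; nra. Qed.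

Let thin_region_lt z : thin_region z -> H2 z -> 0 <= z.1 <= X.
Proof.
move: (K0) (KL) (h1) => K0' KL' h1'.
move=> [x0 xh] Hz; rewrite x0 /=.
have [h0 _] := andP hpi; have [s1 _] := andP half_angle_sin; have [c0 _ _] := half_angle_cos.
have L0 : 0 < L by lra.
have D0 : 0 < 1 - sqnorm z by rewrite subr_gt0.
rewrite /X lerBrDr -lerBrDl ler_pdivrMr; last by lra.
have x1 : z.1 ^+ 2 < 1 by move: D0; rewrite /sqnorm; have := sqr_ge0 z.2; lra.
have [x2|x2] := ltP z.1 (1 / 2).
  have : 0 < (1 / 2 - z.1) * (4 * L + 4) by rewrite mulr_gt0//; lra.
  lra.
have y0 : 0 <= `|z.2| * cos h by rewrite mulr_ge0//; lra.
have e1 : 2 * (z.1 * sin h) < L * (1 - z.1 ^+ 2).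
  have : K * (1 - sqnorm z) <= L * (1 - z.1 ^+ 2).
    by move: D0; rewrite /sqnorm => D0; have y20 := sqr_ge0 z.2; apply: ler_pM; lra.
  lra.
have : 1 / 2 * (h / 2) <= z.1 * sin h by apply: ler_pM; lra.
have x1' : z.1 < 1.
  by rewrite ltNge; apply/negP => x1'; have := mulr_ege1 x1' x1'; rewrite -expr2; lra.
have : 0 <= L * (1 - z.1) ^+ 2 by rewrite mulr_ge0// ?sqr_ge0//; lra.
lra.
Qed.

(** Dropping the term [x * sin h] leaves [|y| < k * (w - y ^ 2)], that is [|y| < Y] for the positive
    root [Y] of [Y = k * (w - Y ^ 2)]. This equation turns the bound of [slice_le] into
    [8 * k / w]. *)
Let slice_thin_region x : 0 <= x <= X ->
  (slice thin_region x <= (4 * K / cos h / (1 - x ^+ 2))%:E)%E.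
Proof.
move: (K0) (KL) (h1) => K0' KL' h1'.
move=> xX; have w0 := w_gt0 xX; have [x0 _] := andP xX.
have [h0 _] := andP hpi; have [s1 _] := andP half_angle_sin; have [c0 _ _] := half_angle_cos.
have ch : 0 < cos h by lra.
set w := 1 - x ^+ 2 in w0 *.
pose k := K / (2 * cos h).
have k0 : 0 < k by rewrite divr_gt0// mulr_gt0.
pose r := Num.sqrt (1 + 4 * k ^+ 2 * w).
have arg : 1 < 1 + 4 * k ^+ 2 * w.
  by have := exprn_gt0 2 k0 => k2; rewrite ltrDl; do 2![apply: mulr_gt0 => //].
have r1 : 1 < r by rewrite -sqrtr1 ltr_sqrt//; lra.
have rr : r ^+ 2 = 1 + 4 * k ^+ 2 * w by rewrite sqr_sqrtr//; lra.
pose Y := (r - 1) / (2 * k).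
have Y0 : 0 < Y by rewrite divr_gt0 ?subr_gt0// mulr_gt0.
have YE : Y = k * (w - Y ^+ 2).
  have -> : w = (r ^+ 2 - 1) / (4 * k ^+ 2) by rewrite rr; field; rewrite gt_eqF.
  by rewrite /Y; field; rewrite gt_eqF.
have wY : w - Y ^+ 2 = Y / k by apply: (mulfI (lt0r_neq0 k0)); rewrite -YE; field; rewrite gt_eqF.
have -> : 4 * K / cos h / w = 8 * Y / (w * (w - Y ^+ 2)).
  by rewrite wY /k; field; rewrite !gt_eqF.
apply: slice_le => //; first exact: measurable_thin_region.
  by rewrite -subr_gt0 -/w wY divr_gt0.
move=> y [_ /= hy] _.
have hy' : `|y| < k * (w - y ^+ 2).
  have xs : 0 <= x * sin h by rewrite mulr_ge0//; lra.
  rewrite -(ltr_pM2r ch); have -> : k * (w - y ^+ 2) * cos h = K * (w - y ^+ 2) / 2.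
    by rewrite /k; field; rewrite gt_eqF.
  move: hy; have -> : 1 - sqnorm (x, y) = w - y ^+ 2 by rewrite /sqnorm/w/=; ring.
  lra.
rewrite leNgt; apply/negP => Yy.
have : Y ^+ 2 <= y ^+ 2.
  by rewrite -[y ^+ 2]real_normK ?num_real//; apply: lerXn2r; rewrite ?nnegrE//; lra.
move=> YYyy; have : k * (w - y ^+ 2) <= k * (w - Y ^+ 2) by rewrite ler_pM2l//; lra.
lra.
Qed.

Let area_thin_region : (hyp_area thin_region <=
  (2 * K * ln h^-1 + (4 * L + 6 * L * ln (8 * L + 8)))%:E)%E.
Proof.
move: (K0) (KL) (h1) => K0' KL' h1'.
have [h0 _] := andP hpi; have [c0 _ ch1] := half_angle_cos.
have ch : 0 < cos h by lra.
have [X0 X1] := andP X01.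
pose phi x : R := 4 * K / cos h * (1 - x ^+ 2)^-1.
pose Phi x : R := 2 * K / cos h * (ln (1 + x) - ln (1 - x)).
have := @hyp_area_le_primitive R thin_region 0 X phi Phi measurable_thin_region X0
  thin_region_lt _ _ slice_thin_region.
have cphi x : 0 <= x <= X -> {for x, continuous phi}.
  by move=> /w_gt0 w0; rewrite /phi; continuous_tac; rewrite gt_eqF.
have dPhi x : 0 <= x <= X -> is_derive x 1 Phi (phi x).
  move=> xX; have w0 := w_gt0 xX; have [x0 x1] := andP xX.
  have p1 : 0 < 1 + x by lra.
  have p2 : 0 < 1 - x by lra.
  have d1 := @is_derive_comp R (@ln R) (fun x => 1 + x) x _ _ (is_derive1_ln p1)
    (is_derive_funD (is_derive_const 1 x) (is_derive_ident x)).
  have d2 := @is_derive_comp R (@ln R) (fun x => 1 - x) x _ _ (is_derive1_ln p2)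
    (is_derive_funB (is_derive_const 1 x) (is_derive_ident x)).
  have -> : phi x = 2 * K / cos h * ((1 + x)^-1 * (0 + 1) - (1 - x)^-1 * (0 - 1)) +
     (ln (1 + x) - ln (1 - x)) * 0.
    rewrite /phi; field; rewrite !gt_eqF//.
  by rewrite /Phi; derive_tac.
move=> /(_ cphi dPhi) /le_trans; apply; rewrite lee_fin.
rewrite /Phi addr0 subr0 ln1 subrr mulr0 subr0.
have -> : 1 - X = h / (4 * L + 4) by rewrite /X; ring.
have L4 : 0 < 4 * L + 4 by lra.
rewrite ln_div ?posrE// lnV ?posrE//.
have lnX : ln (1 + X) <= ln 2 by rewrite ler_ln ?posrE; lra.
have ln8 : ln (8 * L + 8) = ln 2 + ln (4 * L + 4).
  by rewrite -lnM ?posrE//; congr ln; ring.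
have lnh : - ln h <= h^-1 - 1.
  rewrite -lnV ?posrE//; have := @le_ln1Dx R (h^-1 - 1).
  by rewrite addrCA subrr addr0; apply; rewrite ltrBrDl subrr invr_gt0.
have lnh0 : 0 <= - ln h by rewrite oppr_ge0 ln_le0//; lra.
have ln80 : 0 <= ln (8 * L + 8) by rewrite ln_ge0//; lra.
(* Since [1 / cos h] is at most [1 + 2 * h], this bound allows the leading coefficient
   [2 * K / cos h] to be replaced by [2 * K] at the price of a constant. *)
have hlnh : h * (- ln h) <= 1.
  have : h * (- ln h) <= h * (h^-1 - 1) by rewrite ler_pM2l.
  by rewrite mulrBr mulfV ?gt_eqF//; lra.
have ci : (cos h)^-1 <= 1 + 2 * h.
  rewrite -[leLHS]mul1r ler_pdivrMr//; nra.
have ci0 : 0 < (cos h)^-1 by rewrite invr_gt0.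
set T := ln (8 * L + 8) in ln8 ln80 *.
have s1 : 2 * K / cos h * (ln (1 + X) - (ln h - ln (4 * L + 4))) <=
    2 * K / cos h * (T - ln h).
  by rewrite ler_pM2l ?divr_gt0//; lra.
apply: le_trans s1 _.
have s2 : 2 * K / cos h * (T - ln h) <= 2 * K * (1 + 2 * h) * (T - ln h).
  by apply: ler_wpM2r; [lra|rewrite ler_pM2l//; lra].
apply: le_trans s2 _.
have -> : 2 * K * (1 + 2 * h) * (T - ln h) =
  2 * K * - ln h + 2 * K * (1 + 2 * h) * T + 4 * K * (h * - ln h) by ring.
have s3 : 4 * K * (h * - ln h) <= 4 * L * 1 by apply: ler_pM => //; [lra|rewrite mulr_ge0//; lra|lra].
have s4 : 2 * K * (1 + 2 * h) * T <= 6 * L * T.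
  apply: ler_wpM2r => //; have : K * (1 + 2 * h) <= L * 3 by apply: ler_pM; lra.
  lra.
lra.
Qed.

Lemma hyp_area_near_both_le : (hyp_area (near_both (- h) h K) <=
  (2 * K * ln h^-1 + (16 * (L + 2) ^+ 2 + 4 * L + 6 * L * ln (8 * L + 8)))%:E)%E.
Proof.
move: (K0) (KL) => K0' KL'; have L2 : 0 < L + 2 by lra.
set D := [set z : R * R | sqnorm z <= 1 - (L + 2)^-1].
have mD : measurable D.
  have := @measurable_sqr_sum R measurableT _ (measurable_itv `]-oo, 1 - (L + 2)^-1]).
  by rewrite setTI.
have mT := measurable_thin_region.
rewrite -hyp_area_H2; apply: (@le_trans _ _ (hyp_area (D `|` thin_region))).
  apply: (le_measure (@hyp_measure R)); rewrite ?inE.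
  - by apply: measurableI; [exact: measurable_near_both|exact: measurable_H2].
  - exact: measurableU.
  - exact: near_both_sub.
apply: (@le_trans _ _ (hyp_area D + hyp_area thin_region)%E).
  exact: (@measureU2 _ _ _ (@hyp_measure R)).
have q1 : 1 - (L + 2)^-1 < 1 by rewrite ltrBlDr ltrDl invr_gt0.
apply: le_trans (leeD (hyp_area_disc_le q1) area_thin_region) _.
rewrite -EFinD lee_fin le_eqVlt; apply/orP; left; apply/eqP.
by rewrite subKr; field; rewrite gt_eqF.
Qed.

(** From this abscissa on, [K ^ 2 * w <= 1] and [K * w <= 1] hold with [w = 1 - x ^ 2], for all
    [K <= L]; the strip around the axis is then narrow enough to stay in the disc and in front of
    both rays. *)
Let x0 : R := 1 - (2 * (L + 1) ^+ 2)^-1.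

Let slice_near_both x : x0 <= x < 1 ->
  ((4 * K * (1 - x ^+ 2)^-1 - K ^+ 3 - 8 * h * (1 - x) ^- 2)%:E <=
   slice (near_both (- h) h K) x)%E.
Proof.
move: (K0) (KL) (h1) => K0' KL' h1' /andP[xx0 x1].
have [h0 _] := andP hpi; have [c0 sc ch1] := half_angle_cos.
have [_ sh] := andP half_angle_sin.
have L1 : 1 <= (L + 1) ^+ 2 by rewrite exprn_ege1//; lra.
have iL : (2 * (L + 1) ^+ 2)^-1 <= 2^-1 by rewrite lef_pV2 ?posrE; lra.
have x12 : 1 / 2 <= x by move: xx0; rewrite /x0; lra.
have w0 : 0 < 1 - x ^+ 2 by rewrite (_ : 1 - x ^+ 2 = (1 - x) * (1 + x)) ?mulr_gt0//; [lra|lra|ring].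
have wL : (1 - x ^+ 2) * (L + 1) ^+ 2 <= 1.
  have : 1 - x <= (2 * (L + 1) ^+ 2)^-1 by move: xx0; rewrite /x0; lra.
  rewrite -[leRHS]mul1r ler_pdivlMr; last by lra.
  have : 0 <= (1 - x) * ((1 - x) * (L + 1) ^+ 2) by rewrite !mulr_ge0//; lra.
  by rewrite (_ : 1 - x ^+ 2 = (1 - x) * (1 + x)); [lra|ring].
set w := 1 - x ^+ 2 in w0 wL *.
have w1x : 1 - x <= w by have : 0 <= x * (1 - x) by [rewrite mulr_ge0; lra]; rewrite /w; lra.
(* It suffices that [2 * (x * sin h + |y| * cos h) < K * (w - y ^ 2)]. Bounding [x * sin h] by [h],
   [cos h] by 1 and [y ^ 2] by [(K * w / 2) ^ 2] leaves exactly [|y| < Z]. *)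
pose Z := K * w / 2 - K ^+ 3 * w ^+ 2 / 8 - h.
have KLL : K ^+ 2 * w <= 1.
  have : K ^+ 2 * w <= (L + 1) ^+ 2 * w.
    by rewrite ler_pM2r//; apply: lerXn2r; rewrite ?nnegrE; lra.
  lra.
have Kw1 : K * w <= 1.
  have : K * w <= (L + 1) ^+ 2 * w.
    rewrite ler_pM2r//; have : 0 <= L ^+ 2 by exact: sqr_ge0.
    lra.
  lra.
have hw : 8 * Z / w ^+ 2 = 4 * K * w^-1 - K ^+ 3 - 8 * h * w ^- 2.
  by rewrite /Z; field; rewrite gt_eqF.
apply: (@le_trans _ _ (8 * Z / w ^+ 2)%:E).
  rewrite lee_fin hw lerB// ler_pM2l ?mulr_gt0// lef_pV2 ?posrE ?exprn_gt0//; last by lra.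
  by apply: lerXn2r; rewrite ?nnegrE; lra.
apply: slice_ge; first exact: measurable_near_both.
move=> y yZ.
have K30 : 0 <= K ^+ 3 * w ^+ 2 by rewrite mulr_ge0 ?exprn_ge0// ltW.
have Kw0 : 0 < K * w by rewrite mulr_gt0.
have yK : `|y| < K * w / 2 by move: yZ; rewrite /Z; lra.
have y20 : y ^+ 2 <= (K * w / 2) ^+ 2.
  by rewrite -[y ^+ 2]real_normK ?num_real//; apply: lerXn2r; rewrite ?nnegrE//; lra.
have Hxy : H2 (x, y).
  rewrite /H2/=; suff : y ^+ 2 < w by rewrite /w; lra.
  apply: le_lt_trans y20 _.
  have -> : (K * w / 2) ^+ 2 = K ^+ 2 * w * (w / 4) by field.
  have : K ^+ 2 * w * (w / 4) <= 1 * (w / 4) by rewrite ler_pM2r//; lra.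
  lra.
split=> //.
have D0 : 0 < 1 - sqnorm (x, y) by rewrite subr_gt0.
have xc : 1 / 2 * cos h <= x * cos h by rewrite ler_pM2r//; lra.
have s0 : 0 < sin h by have := half_angle_sin; lra.
have yc : `|y| * sin h <= 1 / 2 * sin h by rewrite ler_pM2r//; lra.
have [y1 y2] : - (`|y| * sin h) <= y * sin h /\ y * sin h <= `|y| * sin h.
  by split; rewrite -?mulNr ler_pM2r// ?ler_norm// lerNl ler_normr lexx orbT.
have bound : 2 * (x * sin h + `|y| * cos h) < K * (1 - sqnorm (x, y)).
  have b1 : x * sin h <= 1 * h by apply: ler_pM; lra.
  have b2 : `|y| * cos h <= `|y| * 1 by rewrite ler_wpM2l// cos_le1.
  have -> : 1 - sqnorm (x, y) = w - y ^+ 2 by rewrite /sqnorm/w/=; ring.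
  have b3 : K * y ^+ 2 <= K * (K * w / 2) ^+ 2 by rewrite ler_pM2l.
  move: yZ; rewrite /Z; lra.
rewrite /near_both/= gt_max !threshold_dot_gt0 ?/dot ?cosN ?sinN//=; [|lra|lra].
rewrite !ltr_pdivrMr// /cross /= cosN sinN.
have xs : 0 <= x * sin h by rewrite mulr_ge0//; lra.
have yc0 : `|y * cos h| = `|y| * cos h by rewrite normrM (gtr0_norm (_ : 0 < cos h))//; lra.
have t1 := ler_normB (x * - sin h) (y * cos h).
have t2 := ler_normB (x * sin h) (y * cos h).
rewrite mulrN normrN yc0 (ger0_norm xs) in t1; rewrite yc0 (ger0_norm xs) in t2.
by apply/andP; rewrite mulrN; split; lra.
Qed.

Lemma hyp_area_near_both_ge : ((2 * K * ln h^-1 -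
  (L ^+ 3 + 8 + 2 * L * (ln 2 + ln (2 * (L + 1) ^+ 2))))%:E <= hyp_area (near_both (- h) h K))%E.
Proof.
move: (K0) (KL) (h1) => K0' KL' h1'.
have [h0 _] := andP hpi.
have L1 : 1 <= (L + 1) ^+ 2 by rewrite exprn_ege1//; lra.
have L20 : 0 < 2 * (L + 1) ^+ 2 by lra.
have iL : (2 * (L + 1) ^+ 2)^-1 <= 2^-1 by rewrite lef_pV2 ?posrE; lra.
have iL0 : 0 < (2 * (L + 1) ^+ 2)^-1 by rewrite invr_gt0.
have L30 : 0 <= L ^+ 3 by rewrite exprn_ge0//; lra.
have ln20 : 0 <= ln 2 :> R by rewrite ln_ge0; lra.
have lnL0 : 0 <= ln (2 * (L + 1) ^+ 2) by rewrite ln_ge0; lra.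
set M := ln (2 * (L + 1) ^+ 2) in lnL0 *.
(* In the first case [h] is bounded below in terms of [L], and the claimed lower bound is
   nonpositive. *)
have [hx|hx] := leP (1 - h) x0.
  apply: (@le_trans _ _ 0%E); last exact: hyp_area_ge0.
  rewrite lee_fin.
  have : ln h^-1 <= M.
    rewrite ler_ln ?posrE ?invr_gt0//; move: hx; rewrite /x0 lerD2l lerN2 => hx.
    by rewrite -[leRHS]invrK lef_pV2 ?posrE.
  move=> lnhM; have m1 : K * ln h^-1 <= L * M.
    apply: ler_pM => //; first by lra.
    by rewrite ln_ge0// invf_ge1//; lra.
  have : 0 <= L * ln 2 by rewrite mulr_ge0; lra.
  lra.
pose phi x : R := 4 * K * (1 - x ^+ 2)^-1 - K ^+ 3 - 8 * h * (1 - x) ^- 2.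
(* The integration stops at [1 - h], where the last error term [8 * h / (1 - x)] equals 8 while
   [- ln (1 - x)] already reaches [ln h^-1]. *)
pose Phi x : R := 2 * K * (ln (1 + x) - ln (1 - x)) - x * K ^+ 3 - 8 * h * (1 - x)^-1.
have x00 : 1 / 2 <= x0 by rewrite /x0; lra.
have cphi x : x0 <= x <= 1 - h -> {for x, continuous phi}.
  move=> /andP[x1 x2]; rewrite /phi; continuous_tac; rewrite gt_eqF ?exprn_gt0//; last by lra.
  by rewrite (_ : 1 - x ^+ 2 = (1 - x) * (1 + x)); [rewrite mulr_gt0//; lra|ring].
have dPhi x : x0 <= x <= 1 - h -> is_derive x 1 Phi (phi x).
  move=> /andP[x1 x2].
  have p1 : 0 < 1 + x by lra.
  have p2 : 0 < 1 - x by lra.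
  have p3 : 0 < 1 - x ^+ 2.
    by rewrite (_ : 1 - x ^+ 2 = (1 - x) * (1 + x)); [rewrite mulr_gt0//; lra|ring].
  have d1 := @is_derive_comp R (@ln R) (fun x => 1 + x) x _ _ (is_derive1_ln p1)
    (is_derive_funD (is_derive_const 1 x) (is_derive_ident x)).
  have d2 := @is_derive_comp R (@ln R) (fun x => 1 - x) x _ _ (is_derive1_ln p2)
    (is_derive_funB (is_derive_const 1 x) (is_derive_ident x)).
  have -> : phi x = 2 * K * ((1 + x)^-1 * (0 + 1) - (1 - x)^-1 * (0 - 1)) +
     (ln (1 + x) - ln (1 - x)) * 0 - (x * 0 + K ^+ 3 * 1) -
     (8 * h * (- (1 - x) ^- 2 * (0 - 1)) + (1 - x)^-1 * 0).
    by rewrite /phi; field; rewrite !gt_eqF.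
  rewrite /Phi; derive_tac.
  by rewrite gt_eqF.
have le_phi x : x0 <= x <= 1 - h -> ((phi x)%:E <= slice (near_both (- h) h K) x)%E.
  by move=> /andP[x1 x2]; apply: slice_near_both; rewrite x1; lra.
have := hyp_area_ge_primitive (measurable_near_both (- h) h K) hx cphi dPhi le_phi.
apply: le_trans; rewrite lee_fin /Phi.
have -> : 1 - (1 - h) = h by ring.
have -> : 1 - x0 = (2 * (L + 1) ^+ 2)^-1 by rewrite /x0; ring.
rewrite !lnV ?posrE// -/M invrK.
have l1 : 0 <= ln (1 + (1 - h)) by rewrite ln_ge0//; lra.
have l2 : ln (1 + x0) <= ln 2 by rewrite ler_ln ?posrE; rewrite /x0; lra.
have l3 : 8 * h * h^-1 = 8 by field; rewrite gt_eqF.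
have l4 : 0 <= 8 * h * (2 * (L + 1) ^+ 2) by rewrite !mulr_ge0; lra.
have K3 : 0 <= K ^+ 3 <= L ^+ 3.
  by rewrite exprn_ge0 ?(ltW K0)//=; apply: lerXn2r; rewrite ?nnegrE; lra.
have [K30 K31] := andP K3.
have l5 : K ^+ 3 * (1 - h) <= L ^+ 3 * 1 by apply: ler_pM; lra.
have l6 : 0 <= K ^+ 3 * x0 by rewrite mulr_ge0; lra.
have l7 : K * (ln (1 + x0) + M) <= L * (ln 2 + M).
  apply: ler_pM; [lra| |lra|lra].
  by rewrite addr_ge0// ln_ge0; lra.
have l8 : 0 <= K * ln (1 + (1 - h)) by rewrite mulr_ge0; lra.
lra.
Qed.

End half_angle.

(** The bisector is rotated to the horizontal axis; the bounds on [a] and [b] put its direction in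
    [[0, pi)] and the half-angle below [pi / 4]. The error is uniform in the angle and in [K], and
    the main term is linear in [K], so that averaging over the radius produces [E[sinh R]]. *)
Lemma hyp_area_near_both L : 0 <= L -> exists2 C0, 0 <= C0 & forall a b K,
  0 <= a -> a < b -> b - a < pi / 2 -> a + b < 2 * pi -> 0 < K <= L ->
  ((2 * K * ln (b - a)^-1 - C0)%:E <= hyp_area (near_both a b K))%E /\
  (hyp_area (near_both a b K) <= (2 * K * ln (b - a)^-1 + C0)%:E)%E.
Proof.
move=> L0.
have ln20 : 0 <= ln 2 :> R by rewrite ln_ge0; lra.
have L1 : 1 <= (L + 1) ^+ 2 by rewrite exprn_ege1//; lra.
pose Cu := 16 * (L + 2) ^+ 2 + 4 * L + 6 * L * ln (8 * L + 8).
pose Cl := L ^+ 3 + 8 + 2 * L * (ln 2 + ln (2 * (L + 1) ^+ 2)).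
have Cu0 : 0 <= Cu.
  rewrite /Cu !addr_ge0 ?mulr_ge0 ?sqr_ge0 ?ln_ge0//; lra.
have Cl0 : 0 <= Cl.
  rewrite /Cl !addr_ge0 ?mulr_ge0 ?addr_ge0 ?exprn_ge0 ?ln_ge0//; lra.
have LL0 : 0 <= 2 * L * ln 2 by rewrite !mulr_ge0; lra.
exists (Cu + Cl + 2 * L * ln 2); first by rewrite addr_ge0// addr_ge0.
move=> a b K a0 ab ba2 ab2 /andP[K0 KL].
pose h := (b - a) / 2; pose m := (a + b) / 2.
have hpi : 0 < h < pi / 4 by rewrite /h; lra.
have mpi : 0 <= m < pi by rewrite /m; lra.
have -> : near_both a b K = near_both (- h + m) (h + m) K.
  by congr near_both; rewrite /h /m; field.
rewrite hyp_area_near_both_rotate//.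
have lnhE : ln h^-1 = ln (b - a)^-1 + ln 2.
  by rewrite -lnM ?posrE ?invr_gt0 ?subr_gt0//; congr ln; rewrite /h invf_div mulrC.
have K2 : 0 <= K * ln 2 <= L * ln 2.
  by rewrite mulr_ge0 ?(ltW K0)//= ler_wpM2r.
split.
  apply: le_trans (hyp_area_near_both_ge hpi K0 KL).
  by rewrite lee_fin lnhE -/Cl; lra.
apply: le_trans (hyp_area_near_both_le hpi K0 KL) _.
by rewrite lee_fin lnhE -/Cu; lra.
Qed.

End near_both_rays.

(** * Regeneration *)

Section regeneration.
Context {d} {T : measurableType d} {R : realType} (P : probability T R).
Let p (A : set T) : R := fine (P A).
Variables (V : nat -> set T) (past : nat -> set T -> Prop) (N : nat).
Hypotheses (mV : forall i, measurable (V i))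
  (past_measurable : forall i A, past i A -> measurable A)
  (pastT : forall i, past i setT)
  (pastI : forall i k A, (k < i < N)%N -> past i A -> past i (A `&` V k))
  (markov : forall i j A, (i < j < N)%N -> past i A ->
    p (A `&` V i `&` V j) * p (V i) = p (A `&` V i) * p (V i `&` V j))
  (V_gt0 : forall i, (i < N)%N -> 0 < p (V i)).

Let p_ge0 A : 0 <= p A. Proof. exact: fine_ge0. Qed.

Let pD A B : measurable A -> measurable B -> p (A `\` B) = p A - p (A `&` B).
Proof.
move=> mA mB; rewrite /p measureD//; last by rewrite (le_lt_trans (probability_le1 _ _))// ltry.
by rewrite fineB// fin_num_measure//; exact: measurableI.
Qed.

Let U m := \big[setU/set0]_(k < m) V k.

Let mU m : measurable (U m). Proof. exact: bigsetU_measurable. Qed.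

Let markov_setD m i j A : (m <= i)%N -> (i < j < N)%N -> past i A ->
  p (A `&` V i `&` V j `\` U m) * p (V i) = p ((A `&` V i) `\` U m) * p (V i `&` V j).
Proof.
move=> mi ij; elim: m mi A => [|m IH] mi A pA.
  by rewrite /U big_ord0 !setD0; exact: markov.
have mA := past_measurable pA.
have mAV : measurable (A `&` V i) by exact: measurableI.
have mAVV : measurable (A `&` V i `&` V j) by exact: measurableI.
have split X : measurable X -> p (X `\` U m.+1) = p (X `\` U m) - p ((X `&` V m) `\` U m).
  move=> mX; rewrite /U big_ord_recr /= -/(U m) setDUr.
  have -> : (X `\` U m) `&` (X `\` V m) = (X `\` U m) `\` V m.
    by apply/seteqP; split=> w /=; tauto.
  rewrite pD//; last exact: measurableD.
  by congr (_ - p _); apply/seteqP; split=> w /=; tauto.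
rewrite !split// !mulrBl IH//; last exact: ltnW.
congr (_ - _).
have miN : (m < i < N)%N by case/andP: ij => ij jN; rewrite mi (ltn_trans ij jN).
have pAm := pastI miN pA.
have := IH (ltnW mi) _ pAm.
have -> : A `&` V m `&` V i `&` V j = A `&` V i `&` V j `&` V m.
  by apply/seteqP; split=> w /=; tauto.
by have -> : A `&` V m `&` V i = A `&` V i `&` V m by apply/seteqP; split=> w /=; tauto.
Qed.

Let J := seqDU V.

Let mJ i : measurable (J i). Proof. exact: seqDU_measurable. Qed.

Let first_markov i j : (i <= j < N)%N ->
  p (J i `&` V j) * p (V i) = p (J i) * p (V i `&` V j).
Proof.
rewrite leq_eqVlt => /andP[/orP[/eqP <-|ij] jN].
  by rewrite setIid (_ : J i `&` V i = J i)//; apply/setIidl; exact: subset_seqDU.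
have ijN : (i < j < N)%N by rewrite ij.
have := markov_setD (leqnn i) ijN (pastT i); rewrite !setTI => <-.
by congr (p _ * _); rewrite /J /seqDU /U; apply/seteqP; split=> w /=; tauto.
Qed.

Let first_disjoint i j : (j < i)%N -> J i `&` V j = set0.
Proof.
move=> ji; rewrite /J /seqDU; apply/seteqP; split=> w //= [[_ nU] Vj]; apply: nU.
by rewrite -bigcup_mkord; exists j.
Qed.

Let p_sum (A : set T) M : measurable A -> A `<=` U M ->
  p A = \sum_(i < M) p (J i `&` A).
Proof.
move=> mA AU; rewrite -{1}(setIidr AU) /U bigsetU_seqDU big_distrl/= /p.
rewrite measure_bigsetU_ord//.
- by rewrite -sum_fine// => i _; rewrite fin_num_measure//; exact: measurableI.
- by move=> i; exact: measurableI.
- move=> i j _ _ [w [[Ji _] [Jj _]]]; apply/val_inj => /=.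
  by apply: (trivIset_seqDU V) => //; exists w.
Qed.

Let sum_V M : \sum_(j < M) p (V j) = \sum_(i < M) \sum_(j < M) p (J i `&` V j).
Proof.
rewrite exchange_big/=; apply: eq_bigr => j _; apply: p_sum => //.
by move=> w Vw; rewrite /U -bigcup_mkord; exists j => /=.
Qed.

Let p_union M : p (U M) = \sum_(i < M) p (J i).
Proof.
rewrite (@p_sum (U M) M)//; apply: eq_bigr => i _; congr p; apply/setIidl.
by move=> w Jw; have Vw := subset_seqDU Jw; rewrite /U -bigcup_mkord; exists i => /=.
Qed.

(** The left side is the expected number of occurrences. Split at the first one, at [i]: given it,
    the later ones behave as given [V i] alone, so their expected number is at most the sum of the
    [b n]. *)
Lemma regeneration_lower (b : nat -> R) : (forall n, 0 <= b n) ->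
  (forall i j, (i <= j < N)%N -> p (V i `&` V j) <= p (V i) * b (j - i)%N) ->
  \sum_(j < N) p (V j) <= p (U N) * \sum_(n < N) b n.
Proof.
move=> b0 Vb; rewrite sum_V p_union mulr_suml; apply: ler_sum => i _.
apply: (@le_trans _ _ (\sum_(j < N | (i <= j)%N) p (J i) * b (j - i)%N)).
  rewrite [leRHS]big_mkcond/=; apply: ler_sum => j _; case: leqP => ij; last first.
    by rewrite first_disjoint// /p measure0.
  rewrite -(ler_pM2r (V_gt0 (ltn_ord i))) first_markov ?ij ?ltn_ord// -mulrA.
  by rewrite ler_wpM2l// mulrC Vb// ij ltn_ord.
rewrite -mulr_sumr ler_wpM2l//.
rewrite -(big_mkord (fun j => i <= j)%N (fun j => b (j - i)%N)) -(big_mkord xpredT b).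
rewrite (big_cat_nat (n := i)) ?(ltnW (ltn_ord i))//= big_nat_cond big1 ?add0r; last first.
  by move=> j /andP[/andP[_ ji] ij]; move: ji; rewrite ltnNge ij.
rewrite big_nat_cond (eq_bigl (fun j => (i <= j < N)%N)); last first.
  by move=> j /=; case: (i <= j)%N; rewrite ?andbT.
rewrite -big_nat -{1}(add0n i) big_addn.
under eq_bigr do rewrite addnK.
rewrite [leRHS](big_cat_nat (n := (N - i)%N)) ?leq_subr//= lerDl.
by apply: sumr_ge0.
Qed.

(** Given a first occurrence at [i < M], the [M] indices from [i] on contribute at least the sum of
    the [a n]. They must all exist whatever [i] is, whence the [M + M] indices on the right. *)
Lemma regeneration_upper (a : nat -> R) (M : nat) : (M + M <= N)%N ->
  (forall i j, (i < M)%N -> (i <= j < i + M)%N -> p (V i) * a (j - i)%N <= p (V i `&` V j)) ->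
  p (U M) * \sum_(n < M) a n <= \sum_(j < M + M) p (V j).
Proof.
move=> MN Va; rewrite sum_V p_union mulr_suml.
have H0 i j : 0 <= p (J i `&` V j) by [].
apply: (@le_trans _ _ (\sum_(i < M) \sum_(j < M + M) p (J i `&` V j))); last first.
  rewrite [leRHS]big_split_ord/= lerDl.
  by apply: sumr_ge0 => i _; apply: sumr_ge0.
apply: ler_sum => i _.
have iM := ltn_ord i.
rewrite -(big_mkord xpredT (fun j => p (J i `&` V j))) -(big_mkord xpredT a).
rewrite [leRHS](big_cat_nat (n := i)) ?(ltnW (ltn_addr _ iM))//=.
rewrite [X in _ + X](big_cat_nat (n := (M + i)%N)) ?leq_addl ?leq_add2l ?(ltnW iM)//=.
rewrite addrCA ler_wpDr//; first by rewrite addr_ge0//; apply: sumr_ge0.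
rewrite -{2}(add0n i) big_addn addnK mulr_sumr [leLHS]big_nat [leRHS]big_nat.
apply: ler_sum => n /andP[_ nM].
have jN : (i <= n + i < N)%N by rewrite leq_addl (leq_trans _ MN)// -addSn leq_add// ltnW.
have iN : (i < N)%N by apply: leq_ltn_trans (leq_addl n i) _; case/andP: jN.
rewrite -(ler_pM2r (V_gt0 iN)) first_markov// -mulrA ler_wpM2l//.
have := Va i (n + i)%N iM; rewrite addnK mulrC; apply.
by rewrite leq_addl addnC ltn_add2l.
Qed.

End regeneration.

(** * Sums of powers *)

Section power_sums.
Context {R : realType}.
Implicit Types (a b x : R).

Lemma powR_bernoulli b x : 0 < b <= 1 -> -1 <= x -> (1 + x) `^ b <= 1 + b * x.
Proof.
move=> /andP[b0 b1]; rewrite le_eqVlt => /orP[/eqP <-|x1].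
  by rewrite subrr powR0 ?gt_eqF//; lra.
have y0 : 0 < 1 + x by lra.
rewrite /powR gt_eqF//.
have eL : expR (ln (1 + x)) = 1 + x by rewrite lnK ?posrE.
set L := ln (1 + x) in eL *.
have e0 := expR_gt0 (b * L).
(* [t1] and [t2] are the tangent inequality of the exponential at [b * L], taken at [L] and at 0.
   Weighted by [b] and [1 - b], their terms linear in [L] cancel. *)
have t1 : expR (b * L) * (1 + (1 - b) * L) <= 1 + x.
  have e : b * L + (1 - b) * L = L by ring.
  by rewrite -eL -[in leRHS]e expRD ler_pM2l// expR_ge1Dx.
have t2 : expR (b * L) * (1 - b * L) <= 1.
  have e1 : expR (b * L) * expR (- (b * L)) = 1 by rewrite -expRD subrr expR0.
  by rewrite -[leRHS]e1 ler_pM2l// expR_ge1Dx.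
have : b * (expR (b * L) * (1 + (1 - b) * L)) <= b * (1 + x) by rewrite ler_pM2l.
have : (1 - b) * (expR (b * L) * (1 - b * L)) <= (1 - b) * 1 by rewrite ler_wpM2l//; lra.
lra.
Qed.

Let powR_sub1 b (M : nat) : M.+1%:R `^ (b - 1) = M.+1%:R `^ b * M.+1%:R^-1 :> R.
Proof. by rewrite powRD ?pnatr_eq0 ?implybT// powRN powRr1. Qed.

(** Bernoulli's inequality at [- 1 / (M + 1)] bounds each term by an increment of [M ^ b]. With
    [b = 1 - alpha] the factor [b] on the left becomes the [1 - alpha] of the theorem. *)
Lemma power_sum_le b (M : nat) : 0 < b <= 1 ->
  b * \sum_(n < M) n.+1%:R `^ (b - 1) <= M%:R `^ b.
Proof.
move=> b01; have [b0 b1] := andP b01; elim: M => [|M IH].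
  by rewrite big_ord0 mulr0 powR_ge0.
rewrite big_ord_recr/= mulrDr; apply: le_trans (lerD IH (lexx _)) _.
have M0 : 0 < M.+1%:R :> R by rewrite ltr0n.
have /(powR_bernoulli b01) : -1 <= - M.+1%:R^-1 :> R.
  by rewrite lerN2 invf_le1// ler1n.
have -> : 1 - M.+1%:R^-1 = M%:R / M.+1%:R :> R.
  by rewrite -natr1; field; rewrite natr1 gt_eqF.
move=> h; have : M.+1%:R `^ b * (M%:R / M.+1%:R) `^ b <= M.+1%:R `^ b * (1 + b * - M.+1%:R^-1).
  by rewrite ler_wpM2l// powR_ge0.
rewrite -powRM ?divr_ge0// mulrCA mulfV ?gt_eqF// mulr1 => h'.
rewrite powR_sub1 -lerBrDr; apply: le_trans h' _.
by rewrite mulrDr mulr1 lerD2l mulrN mulrN lerN2 mulrCA.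
Qed.

Lemma power_sum_ge b (M : nat) : 0 < b <= 1 ->
  M.+1%:R `^ b - 1 <= b * \sum_(n < M) n.+1%:R `^ (b - 1).
Proof.
move=> b01; have [b0 b1] := andP b01; elim: M => [|M IH].
  by rewrite big_ord0 mulr0 powR1 subrr.
rewrite big_ord_recr/= mulrDr; apply: le_trans (lerD IH (lexx _)).
have M0 : 0 < M.+1%:R :> R by rewrite ltr0n.
have /(powR_bernoulli b01) : -1 <= M.+1%:R^-1 :> R.
  by apply: (@le_trans _ _ 0) => //; rewrite invr_ge0.
move=> h; have : M.+1%:R `^ b * (1 + M.+1%:R^-1) `^ b <= M.+1%:R `^ b * (1 + b * M.+1%:R^-1).
  by rewrite ler_wpM2l// powR_ge0.
rewrite -powRM ?addr_ge0 ?invr_ge0// mulrDr mulfV ?gt_eqF// mulr1 natr1 => h'.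
rewrite powR_sub1 addrAC lerD2r; apply: le_trans h' _.
by rewrite mulrDr mulr1 mulrCA.
Qed.

Lemma ln_le_harmonic (M : nat) : ln M.+1%:R <= \sum_(n < M) n.+1%:R^-1 :> R.
Proof.
elim: M => [|M IH]; first by rewrite big_ord0 ln1.
rewrite big_ord_recr/=; apply: le_trans (lerD IH (lexx _)).
have M0 : 0 < M.+1%:R :> R by rewrite ltr0n.
have -> : M.+2%:R = M.+1%:R * (1 + M.+1%:R^-1) :> R.
  by rewrite mulrDr mulfV ?gt_eqF// mulr1 natr1.
have i0 : 0 < M.+1%:R^-1 :> R by rewrite invr_gt0.
rewrite lnM ?posrE ?addr_gt0// lerD2l; apply: le_ln1Dx.
exact: lt_trans (ltrN10 R) i0.
Qed.

End power_sums.

(** * Marks, cells and their loads *)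

Section marks.
Context {R : realType} (law : probability R R) (C : R).
Hypothesis hlaw : law `]0, C]%classic = 1%E.
Implicit Types (a b r : R) (x : R * R) (g : R * R -> R).

(* On the support of the law this is [sinh]; the truncation makes it bounded. *)
Definition mark r : R := sinh (Num.max 0 (Num.min r C)).

Definition mark_max : R := sinh C.

Local Notation S := mark_max.

Lemma radius_gt0 : 0 < C.
Proof.
rewrite ltNge; apply/negP => C0; move: hlaw.
by rewrite set_itv_ge ?measure0 ?bnd_simp -?leNgt// => /eqP; rewrite eqe eq_sym oner_eq0.
Qed.

Lemma mark_max_gt0 : 0 < S. Proof. by rewrite sinh_gt0// radius_gt0. Qed.

Lemma mark_ge0 r : 0 <= mark r.
Proof. by rewrite sinh_ge0// le_max lexx. Qed.

Lemma mark_le r : mark r <= S.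
Proof. by rewrite le_sinh// ge_max (ltW radius_gt0) ge_min lexx orbT. Qed.

Lemma markE r : 0 < r <= C -> mark r = sinh r.
Proof. by move=> /andP[r0 rC]; rewrite /mark min_l// max_r// ltW. Qed.

Lemma measurable_mark : measurable_fun setT mark.
Proof.
apply: (@measurableT_comp _ _ _ _ _ _ (@sinh R)).
  by apply: continuous_measurable_fun; exact: continuous_sinh.
by apply: measurable_maxr => //; exact: measurable_minr.
Qed.

(** Marks never exceed the cap, so comparisons with them are unchanged in the disc. Outside the disc
    the threshold can be negative, and the truncation at 0 gives the global sign that [admissible]
    requires. *)
Definition capped a x : R := Num.min S (Num.max 0 (threshold a x)).

Lemma capped_ge0 a x : 0 <= capped a x.
Proof. by rewrite /capped le_min (ltW mark_max_gt0) le_max lexx. Qed.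

Lemma capped_le a x : capped a x <= S.
Proof. by rewrite /capped ge_min lexx. Qed.

Lemma measurable_capped a : measurable_fun setT (capped a).
Proof.
apply: measurable_minr => //; apply: measurable_maxr => //.
exact: measurable_threshold.
Qed.

Lemma mark_le_capped r a x : H2 x -> (mark r <= capped a x) = (mark r <= threshold a x).
Proof.
by move=> Hx; rewrite /capped le_min mark_le/= max_r// threshold_ge0.
Qed.

Lemma capped_quasiconvex a b c x : H2 x -> a <= b <= c -> c - a < pi ->
  capped b x <= Num.max (capped a x) (capped c x).
Proof.
move=> Hx abc ca; have := threshold_quasiconvex Hx abc ca.
have mono t1 t2 : t1 <= t2 -> Num.min S (Num.max 0 t1) <= Num.min S (Num.max 0 t2).
  by move=> t12; rewrite le_min !ge_min lexx/= orbC le_max2// orbT.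
by rewrite !le_max => /orP[] /mono h; rewrite /capped h ?orbT.
Qed.

Definition cell a b x : R := Num.max (capped a x) (capped b x).

Lemma cell_ge0 a b x : 0 <= cell a b x.
Proof. by rewrite /cell le_max capped_ge0. Qed.

Lemma cell_le a b x : cell a b x <= S.
Proof. by rewrite /cell ge_max !capped_le. Qed.

Lemma measurable_cell a b : measurable_fun setT (cell a b).
Proof. by apply: measurable_maxr; exact: measurable_capped. Qed.

Lemma mark_le_cell r a b x : H2 x ->
  (mark r <= cell a b x) = (mark r <= Num.max (threshold a x) (threshold b x)).
Proof. by move=> Hx; rewrite /cell !le_max !mark_le_capped. Qed.

Lemma hyp_area_cell_mark a b r :
  hyp_area [set x | cell a b x < mark r] = hyp_area (near_both a b (mark r)).
Proof.
rewrite -hyp_area_H2 -[RHS]hyp_area_H2; congr hyp_area.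
by apply/seteqP; split=> x [] /=; rewrite /near_both/= !ltNge => + Hx;
  rewrite mark_le_cell.
Qed.

Lemma mark_radius : mark C = S.
Proof. by rewrite markE// radius_gt0 lexx. Qed.

(** Up to the factor [lambda], the exponent of the probability that no marked point violates [g]. *)
Definition load g : R := fine (marked_area law mark g).

Lemma load_ge0 g : 0 <= load g.
Proof. exact/fine_ge0/marked_area_ge0. Qed.

Lemma load_minmax g1 g2 : admissible mark g1 -> admissible mark g2 ->
  load (fun x => Num.min (g1 x) (g2 x)) + load (fun x => Num.max (g1 x) (g2 x)) =
  load g1 + load g2.
Proof.
move=> a1 a2; have fin g (ag : admissible mark g) := marked_area_fin law measurable_mark ag.
have e := congr1 fine (marked_area_minmax law measurable_mark a1 a2).
apply: etrans (esym (fineD (fin _ (admissible_min a1 a2)) (fin _ (admissible_max a1 a2)))) _.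
exact: etrans e (fineD (fin _ a1) (fin _ a2)).
Qed.

Lemma eq_load g1 g2 : (forall x, H2 x -> g1 x = g2 x) -> load g1 = load g2.
Proof. by move=> g12; rewrite /load (eq_marked_area law mark g12). Qed.

Let integrable_mark : law.-integrable setT (EFin \o mark).
Proof.
apply: (@le_integrable _ _ _ _ setT _ _ (EFin \o cst S)) => //.
- by apply/measurable_EFinP; exact: measurable_mark.
- move=> r _; rewrite /comp lee_fin (ger0_norm (mark_ge0 r)).
  by rewrite /cst (ger0_norm (ltW mark_max_gt0)) mark_le.
- exact: finite_measure_integrable_cst.
Qed.

Let ae_radius : {ae law, forall r, 0 < r <= C}.
Proof.
exists (~` `]0, C]%classic); split.
- exact: measurableC.
- by rewrite probability_setC// hlaw subee.
- by move=> r /= nr ri; apply: nr; move: ri; rewrite in_itv.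
Qed.

Lemma integral_mark : (\int[law]_r (mark r)%:E = (mean_sinh law)%:E)%E.
Proof.
have e : (\int[law]_r (mark r)%:E = \int[law]_r (sinh r)%:E)%E.
  apply: ae_eq_integral => //.
  - by apply/measurable_EFinP; exact: measurable_mark.
  - apply/measurable_EFinP; apply: continuous_measurable_fun; exact: continuous_sinh.
  - by apply: filterS ae_radius => r rC _; rewrite markE.
rewrite /mean_sinh expectation.unlock -e fineK//.
exact: integrable_fin_num integrable_mark.
Qed.

Lemma mean_sinh_gt0 : 0 < mean_sinh law.
Proof.
rewrite lt_neqAle -lee_fin -integral_mark; apply/andP; split; last first.
  by apply: integral_ge0 => r _; rewrite lee_fin mark_ge0.
apply/eqP => m0.
have : (\int[law]_r `|(mark r)%:E| = 0)%E.
  by under eq_integral do rewrite gee0_abs ?lee_fin ?mark_ge0//; rewrite integral_mark -m0.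
move/(ae_eq_integral_abs law measurableT _) => /(_ _)[].
  by apply/measurable_EFinP; exact: measurable_mark.
move=> A [mA A0 sub].
have : (1 <= 0 :> \bar R)%E.
  rewrite -[leLHS]hlaw -A0; apply: le_measure; rewrite ?inE// => r /=; rewrite in_itv/= => r0.
  apply: sub => /= /(_ I)[] /eqP; rewrite markE// gt_eqF// sinh_gt0//.
  by case/andP: r0.
by rewrite lee_fin ler10.
Qed.

Variable C0 : R.
Hypothesis C00 : 0 <= C0.
Hypothesis area_cell : forall a b K,
  0 <= a -> a < b -> b - a < pi / 2 -> a + b < 2 * pi -> 0 < K <= S ->
  ((2 * K * ln (b - a)^-1 - C0)%:E <= hyp_area (near_both a b K))%E /\
  (hyp_area (near_both a b K) <= (2 * K * ln (b - a)^-1 + C0)%:E)%E.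

Section cell_load.
Variables (a b : R).
Hypotheses (a0 : 0 <= a) (ab : a < b) (ba2 : b - a < pi / 2) (ab2 : a + b < 2 * pi).

Lemma admissible_cell : admissible mark (cell a b).
Proof.
exists S; split; [exact: measurable_cell|exact: cell_ge0|exact: mark_le|].
rewrite -mark_radius hyp_area_cell_mark mark_radius.
have SS : 0 < S <= S by rewrite mark_max_gt0 lexx.
by have [_ /le_lt_trans] := area_cell a0 ab ba2 ab2 SS; apply; rewrite ltry.
Qed.

Let affine (t c : R) : (\int[law]_r (t * mark r + c)%:E = (t * mean_sinh law + c)%:E)%E /\
  law.-integrable setT (fun r => (t * mark r + c)%:E).
Proof.
have i1 : law.-integrable setT (fun r => t%:E * (mark r)%:E)%E.
  exact: integrableZl integrable_mark.
have i2 : law.-integrable setT (cst c%:E) by exact: finite_measure_integrable_cst.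
have e : (fun r => (t * mark r + c)%:E) = (fun r => t%:E * (mark r)%:E + c%:E)%E.
  by apply/funext => r; rewrite EFinD EFinM.
rewrite e; split; last exact: (integrableD measurableT i1 i2).
rewrite (integralD measurableT i1 i2).
have -> : (\int[law]_r (t%:E * (mark r)%:E) = t%:E * (mean_sinh law)%:E)%E.
  apply: etrans (integralZl measurableT integrable_mark _) _.
  by congr (_ * _)%E; exact: integral_mark.
by rewrite integral_cst//= probability_setT mule1 EFinD EFinM.
Qed.

(** The area estimate is affine in the mark, so it integrates to the same estimate with the mean of
    [sinh]. Multiplied by [lambda], the coefficient of the logarithm becomes [alpha]. *)
Lemma load_cell : 2 * mean_sinh law * ln (b - a)^-1 - C0 <= load (cell a b) /\
  load (cell a b) <= 2 * mean_sinh law * ln (b - a)^-1 + C0.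
Proof.
set l := ln (b - a)^-1.
have area r : ((2 * mark r * l - C0)%:E <= hyp_area [set x | (cell a b x < mark r)%R])%E /\
    (hyp_area [set x | (cell a b x < mark r)%R] <= (2 * mark r * l + C0)%:E)%E.
  have := mark_ge0 r; rewrite le_eqVlt => /predU1P[<-|r0]; last first.
    by rewrite hyp_area_cell_mark; apply: area_cell => //; rewrite r0 mark_le.
  rewrite (_ : [set x | _] = set0) ?hyp_area0; last first.
    by apply/seteqP; split=> x //=; rewrite ltNge cell_ge0.
  by rewrite mulr0 mul0r !add0r !lee_fin oppr_le0.
have ifin : law.-integrable setT (fun r => hyp_area [set x | (cell a b x < mark r)%R]).
  apply/integrableP; split; first exact: measurable_marked measurable_mark _ admissible_cell.
  under eq_integral do rewrite gee0_abs ?hyp_area_ge0//.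
  exact: marked_area_lty measurable_mark _ admissible_cell.
have fin := marked_area_fin law measurable_mark admissible_cell.
rewrite -!lee_fin /load fineK// /marked_area; split.
  have -> : 2 * mean_sinh law * l - C0 = 2 * l * mean_sinh law + - C0 by ring.
  have [<- i1] := affine (2 * l) (- C0).
  apply: le_integral => // r _; have [+ _] := area r.
  by rewrite (_ : 2 * mark r * l = 2 * l * mark r)//; ring.
have -> : 2 * mean_sinh law * l + C0 = 2 * l * mean_sinh law + C0 by ring.
have [<- i1] := affine (2 * l) C0.
apply: le_integral => // r _; have [_] := area r.
by rewrite (_ : 2 * mark r * l = 2 * l * mark r)//; ring.
Qed.

End cell_load.
End marks.

Section order_facts.
Context {R : realDomainType}.
Implicit Types a b c d : R.

Lemma le_max_minl a b c d :
  a <= Num.max b d -> a <= Num.max c d -> a <= Num.max (Num.min b c) d.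
Proof.
by rewrite !le_max le_min => /orP[->/=|->] => [/orP[->|->]|_]; rewrite ?orbT.
Qed.

(** The algebra of the Markov property: with [a] the past, [b] the present cell and [c] a later one,
    the hypothesis is quasi-convexity, and the past disappears from the maximum. *)
Lemma max_min_absorb a b c : b <= Num.max a c -> Num.max (Num.min a b) c = Num.max b c.
Proof.
move=> h; apply/le_anti/andP; split.
  by rewrite ge_max !le_max ge_min !lexx !orbT.
by rewrite ge_max le_max_minl// le_max lexx// orbT.
Qed.

End order_facts.

Lemma addB_exchange (F : zmodType) (a b c d : F) : a + b = c + d -> a - c = d - b.
Proof. by move/eqP => e; apply/eqP; rewrite subr_eq addrAC [d + c]addrC eq_sym subr_eq eq_sym. Qed.

Lemma subr_exchange (F : zmodType) (a b c d : F) : a - b = c - d -> b - d = a - c.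
Proof.
move/eqP; rewrite subr_eq => /eqP ->.
by rewrite [c - d]addrC -!addrA [c + (b - c)]addrCA subrr addr0 addrC.
Qed.

Lemma subr_telescope (F : zmodType) (x y z w a : F) :
  a - x = y - w -> x - z + (y - w) = a - z.
Proof. by move=> <-; rewrite addrC addrA subrK. Qed.

Lemma ratio_arith (F : realFieldType) (lambda a L1 L2 L3 y l c : F) : - c <= lambda * L2 - a * y <= c ->
  - c <= lambda * L3 - a * (y - l) <= c ->
  - (lambda * L1) + (- (2 * c) + - (a * l)) <= - (lambda * (L1 + L2 - L3)) <=
  - (lambda * L1) + (2 * c + - (a * l)).
Proof. by move=> /andP[? ?] /andP[? ?]; apply/andP; split; lra. Qed.

(** * Visibility *)

Section grid_events.
Context {R : realType} (law : probability R R) (C : R).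
Hypothesis hlaw : law `]0, C]%classic = 1%E.
Variable C0 : R.
Hypothesis C00 : 0 <= C0.
Hypothesis area_cell : forall a b K : R,
  0 <= a -> a < b -> b - a < pi / 2 -> a + b < 2 * pi -> 0 < K <= mark_max C ->
  ((2 * K * ln (b - a)^-1 - C0)%:E <= hyp_area (near_both a b K))%E /\
  (hyp_area (near_both a b K) <= (2 * K * ln (b - a)^-1 + C0)%:E)%E.
Variable eps : R.
Hypothesis heps : 0 < eps < pi / 2.
Context {d} {T : measurableType d} (P : probability T R) (lambda : R).
Variables (xi : nat -> T -> R * R) (rho : nat -> T -> R).
Hypothesis model : is_boolean_model P lambda law xi rho.
Hypothesis lambda0 : 0 <= lambda.
Variable c1 : R.
Hypothesis lambdaC0 : lambda * C0 <= c1.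
Hypothesis alpha1 : alpha law lambda <= 1.

Local Notation al := (alpha law lambda).
Local Notation mk := (mark C).
Local Notation cell := (cell C).
Local Notation load := (load law C).
Local Notation s := (grid eps).

Implicit Types (g : R * R -> R) (i j k n : nat).

Let p (A : set T) : R := fine (P A).

Definition event g : set T := below xi rho mk g.

Let mxi n : measurable_fun setT (xi n). Proof. by case: model => -[]. Qed.
Let mrho n : measurable_fun setT (rho n). Proof. by case: model. Qed.

Lemma measurable_event g : measurable_fun setT g -> measurable (event g).
Proof.
move=> mg; rewrite (_ : event g = \bigcap_n (~` (xi n @^-1` H2) `|`
    (fun w => mk (rho n w) - g (xi n w)) @^-1` `]-oo, 0])).
  apply: bigcapT_measurable => n; apply: measurableU.
    by apply: measurableC; apply: measurable_preimage => //; exact: measurable_H2.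
  apply: measurable_preimage => //; apply: measurable_funB.
    by apply: measurableT_comp => //; exact: measurable_mark.
  exact: measurableT_comp.
apply/seteqP; split=> w hw.
  move=> n _; have [Hn|Hn] := pselect (H2 (xi n w)); [right|by left].
  by rewrite /= in_itv/= subr_le0; exact: hw.
move=> n Hn; have [//|] := hw n I.
by rewrite /= in_itv/= subr_le0.
Qed.

Lemma event_prob g : admissible mk g -> p (event g) = expR (- (lambda * load g)).
Proof.
by move=> ag; have [_ e] := void_threshold model (measurable_mark C) ag; rewrite /p /event e.
Qed.

Lemma eventI g1 g2 : event g1 `&` event g2 = event (fun x => Num.min (g1 x) (g2 x)).
Proof.
apply/seteqP; split=> w.
  by move=> [h1 h2] n Hn; rewrite le_min h1// h2.
by move=> h; split=> n Hn; have := h n Hn; rewrite le_min => /andP[].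
Qed.

Section level.
Variable k : nat.

Let M : nat := (2 ^ k)%N.
(** The grid is continued up to [2 * eps] to provide the cells that [regeneration_upper] looks at;
    as [eps < pi / 2], all directions stay within an angle less than [pi], where quasi-convexity
    holds. *)
Let N : nat := (M + M)%N.

Definition grid_cell j : R * R -> R := cell (s k j) (s k j.+1).

Definition grid_event j : set T := event (grid_cell j).

Let eps0 : 0 < eps. Proof. by case/andP: heps. Qed.
Let epi : 0 < eps < pi.
Proof. by have := @pi_gt0 R; case/andP: heps => e0 e1; rewrite e0/=; lra. Qed.

Let M0 : 0 < M%:R :> R. Proof. by rewrite ltr0n expn_gt0. Qed.

Definition step : R := eps / M%:R.

Let step_gt0 : 0 < step. Proof. by rewrite divr_gt0. Qed.

Let gridE j : s k j = step * j%:R.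
Proof. by rewrite /grid /step /M natrX mulrAC. Qed.

Let grid_ge0 j : 0 <= s k j. Proof. by rewrite gridE mulr_ge0// ltW. Qed.

Let grid_le j : (j <= N)%N -> s k j <= 2 * eps.
Proof.
move=> jN; rewrite gridE; apply: (@le_trans _ _ (step * N%:R)).
  by rewrite ler_pM2l// ler_nat.
by rewrite /N natrD /step le_eqVlt; apply/orP; left; apply/eqP; field; rewrite gt_eqF.
Qed.

Let le_s i j : (i <= j)%N -> s k i <= s k j. Proof. exact: le_grid. Qed.

Let span i j : (i <= j < N)%N -> ((j - i).+1 <= M)%N ->
  [/\ s k i < s k j.+1, s k j.+1 - s k i < pi / 2, s k i + s k j.+1 < 2 * pi &
     s k j.+1 - s k i = step * (j - i).+1%:R].
Proof.
move=> /andP[ij jN] jiM.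
have e : s k j.+1 - s k i = step * (j - i).+1%:R.
  by rewrite !gridE -mulrBr -natrB ?leqW// subSn.
have [e0 e1] := andP heps.
have u : s k j.+1 - s k i <= eps.
  rewrite e; apply: (@le_trans _ _ (step * M%:R)); first by rewrite ler_pM2l// ler_nat.
  by rewrite /step divfK// gt_eqF.
have l : 0 < s k j.+1 - s k i by rewrite e mulr_gt0.
have g1 := grid_le jN.
split=> //; lra.
Qed.

Let span1 j : (j < N)%N -> [/\ s k j < s k j.+1, s k j.+1 - s k j < pi / 2,
  s k j + s k j.+1 < 2 * pi & s k j.+1 - s k j = step].
Proof.
move=> jN; have [|| h1 h2 h3 h4] := @span j j; first by rewrite leqnn.
  by rewrite subnn expn_gt0.
by split=> //; rewrite h4 subnn mulr1.
Qed.

Lemma admissible_grid_cell j : (j < N)%N -> admissible mk (grid_cell j).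
Proof.
move=> jN; have [? ? ? _] := span1 jN.
exact: (admissible_cell hlaw area_cell).
Qed.

Let pV j : (j < N)%N -> p (grid_event j) = expR (- (lambda * load (grid_cell j))).
Proof. by move=> jN; rewrite /grid_event event_prob//; exact: admissible_grid_cell. Qed.

Lemma grid_cell_quasiconvex i j j' x : (i <= j <= j')%N -> (j' < N)%N -> H2 x ->
  grid_cell j x <= Num.max (grid_cell i x) (grid_cell j' x).
Proof.
move=> /andP[ij jj'] j'N Hx; have [e0 e1] := andP heps.
have pi1 : s k j'.+1 - s k i < pi.
  by have := grid_ge0 i; have := grid_le j'N; lra.
have q b : s k i <= b <= s k j'.+1 -> capped C b x <= Num.max (grid_cell i x) (grid_cell j' x).
  move=> hb; apply: le_trans (capped_quasiconvex C Hx hb pi1) _.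
  by rewrite /grid_cell /cell !ge_max !le_max !lexx ?orbT.
move: q; set m := Num.max _ _ => q; rewrite /grid_cell /cell ge_max.
by rewrite !q// !le_s// ?leqW// ltnW.
Qed.

(** A ball that meets the two outer rays meets the rays between them, by quasi-convexity; so the
    balls that block both cells are those that block the large cell. *)
Let max_cell i j x : (i <= j < N)%N -> H2 x ->
  Num.max (grid_cell i x) (grid_cell j x) = cell (s k i) (s k j.+1) x.
Proof.
move=> /andP[ij jN] Hx; have [e0 e1] := andP heps.
have pi1 : s k j.+1 - s k i < pi.
  by have := grid_ge0 i; have := grid_le jN; lra.
have q b : s k i <= b <= s k j.+1 -> capped C b x <= cell (s k i) (s k j.+1) x.
  by move=> hb; exact: (capped_quasiconvex C Hx hb pi1).
apply/le_anti/andP; split.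
  by rewrite ge_max {1 2}/grid_cell /cell !ge_max -!/(cell _ _ x) !q// !le_s// ?leqW// ltnW.
by rewrite /grid_cell /cell ge_max !le_max !lexx ?orbT.
Qed.

(** The condition says that a marked point violating both [g] and a later cell also violates cell
    [i]. It is stable under minima with earlier cells, which is what the regeneration argument
    needs. *)
Let past i (A : set T) := exists g, [/\ admissible mk g, A = event g &
  forall j x, (i < j < N)%N -> H2 x -> grid_cell i x <= Num.max (g x) (grid_cell j x)].

Let measurable_grid_event j : measurable (grid_event j).
Proof. by apply: measurable_event; exact: measurable_cell. Qed.

Let past_measurable i A : past i A -> measurable A.
Proof. by move=> [g [[M' [mg _ _ _]] -> _]]; exact: measurable_event. Qed.

Let pastT i : past i setT.
Proof.
exists (cst (mark_max C)); split.
- exists (mark_max C); split=> //.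
  + by move=> x; exact: ltW (mark_max_gt0 hlaw).
  + by move=> r; exact: mark_le hlaw r.
  + by rewrite (_ : [set x | _] = set0) ?hyp_area0//; apply/seteqP; split=> x //=; rewrite ltxx.
- by apply/seteqP; split=> w // _ n _; exact: mark_le hlaw _.
- by move=> j x _ _; rewrite le_max cell_le.
Qed.

Let pastI i j A : (j < i < N)%N -> past i A -> past i (A `&` grid_event j).
Proof.
move=> /andP[ji iN] [g [ag -> hg]].
exists (fun x => Num.min (g x) (grid_cell j x)); split.
- by apply: admissible_min => //; apply: admissible_grid_cell; exact: ltn_trans ji iN.
- by rewrite eventI.
- move=> j' x ij' Hx; have [ij'' j'N] := andP ij'; apply: le_max_minl; first exact: hg.
  by apply: grid_cell_quasiconvex => //; apply/andP; split; exact: ltnW.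
Qed.

Let event_prob_minmax g1 g2 g3 : admissible mk g1 -> admissible mk g2 ->
  (forall x, H2 x -> Num.max (g1 x) (g2 x) = g3 x) ->
  p (event g1 `&` event g2) = expR (- (lambda * (load g1 + load g2 - load g3))).
Proof.
move=> a1 a2 e3; rewrite eventI event_prob; last exact: admissible_min.
have := load_minmax law a1 a2; rewrite (eq_load law C e3) => <-.
by rewrite addrK.
Qed.

(** All four probabilities are exponentials of loads. Since the past is absorbed in the maximum with
    cell [j], the same load of [max (grid_cell i) (grid_cell j)] occurs on both sides. *)
Let markov i j A : (i < j < N)%N -> past i A ->
  p (A `&` grid_event i `&` grid_event j) * p (grid_event i) =
  p (A `&` grid_event i) * p (grid_event i `&` grid_event j).
Proof.
move=> ijN [g [ag -> hg]]; have [ij jN] := andP ijN; have iN := ltn_trans ij jN.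
have ai := admissible_grid_cell iN; have aj := admissible_grid_cell jN.
have am := admissible_min ag ai.
have e x : H2 x -> Num.max (Num.min (g x) (grid_cell i x)) (grid_cell j x) =
    Num.max (grid_cell i x) (grid_cell j x).
  by move=> Hx; apply: max_min_absorb; exact: hg.
have E1 := event_prob_minmax am aj e.
have E2 := event_prob_minmax ai aj (fun x _ => erefl).
rewrite -!/(grid_event _) in E1 E2.
rewrite [_ `&` grid_event i]eventI E1 E2 pV// event_prob//.
rewrite -!expRD; congr expR.
set L1 := load (fun x => Num.min (g x) (grid_cell i x)).
set L2 := load (fun x => Num.max (grid_cell i x) (grid_cell j x)).
by move: L1 L2 (load (grid_cell i)) (load (grid_cell j)) => L1 L2 L3 L4; ring.
Qed.

Let V_gt0 i : (i < N)%N -> 0 < p (grid_event i).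
Proof. by move=> iN; rewrite pV// expR_gt0. Qed.

Let load_bound i j : (i <= j < N)%N -> ((j - i).+1 <= M)%N ->
  - c1 <= lambda * load (cell (s k i) (s k j.+1)) - al * ln (step * (j - i).+1%:R)^-1 <= c1.
Proof.
move=> ij jiM; have [h1 h2 h3 e] := span ij jiM.
have [l1 l2] := load_cell hlaw C00 area_cell (grid_ge0 i) h1 h2 h3.
rewrite e in l1 l2.
have := ler_wpM2l lambda0 l1; have := ler_wpM2l lambda0 l2.
by rewrite /alpha; set l := ln _; move: lambdaC0 => hc *; apply/andP; split; lra.
Qed.

Let load_step j : (j < N)%N ->
  - c1 <= lambda * load (grid_cell j) - al * ln step^-1 <= c1.
Proof.
move=> jN; have := @load_bound j j; rewrite leqnn jN subnn mulr1; apply=> //.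
by rewrite expn_gt0.
Qed.

Let expR_ln (x : R) : 0 < x -> expR (- (al * ln x^-1)) = x `^ al.
Proof. by move=> x0; rewrite /powR gt_eqF// lnV ?posrE// mulrN opprK. Qed.

Lemma grid_event_prob j : (j < N)%N ->
  expR (- c1) * step `^ al <= p (grid_event j) <= expR c1 * step `^ al.
Proof.
move=> jN; have /andP[h1 h2] := load_step jN.
by rewrite pV// -expR_ln// -!expRD !ler_expR; apply/andP; split; lra.
Qed.

(** The ratio to [p (grid_event i)] has exponent [lambda] times the load of the large cell minus
    that of cell [j]. Each is known up to [c1], whence [2 * c1], and the two logarithms differ by
    that of [j - i + 1]. *)
Lemma grid_event_probI i j : (i <= j < N)%N -> ((j - i).+1 <= M)%N ->
  p (grid_event i) * (expR (- (2 * c1)) * (j - i).+1%:R `^ (- al)) <=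
    p (grid_event i `&` grid_event j) <=
  p (grid_event i) * (expR (2 * c1) * (j - i).+1%:R `^ (- al)).
Proof.
move=> ijN jiM; have [ij jN] := andP ijN; have iN := leq_ltn_trans ij jN.
have ai := admissible_grid_cell iN; have aj := admissible_grid_cell jN.
rewrite (event_prob_minmax ai aj (fun x => max_cell ijN)) pV//.
have /andP[h1 h2] := load_step jN; have /andP[h3 h4] := load_bound ijN jiM.
have n0 : 0 < (j - i).+1%:R :> R by [].
have -> : (j - i).+1%:R `^ (- al) = expR (- (al * ln (j - i).+1%:R)) :> R.
  by rewrite /powR gt_eqF// mulNr.
have e : ln (step * (j - i).+1%:R)^-1 = ln step^-1 - ln (j - i).+1%:R.
  by rewrite invfM lnM ?posrE ?invr_gt0// (lnV (n0 : _ \in Num.pos)).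
rewrite e in h3 h4; set l := ln (j - i).+1%:R in h3 h4 *.
rewrite -!expRD !ler_expR.
exact: (ratio_arith _ (introT andP (conj h1 h2)) (introT andP (conj h3 h4))).
Qed.

Definition grid_union : set T := \big[setU/set0]_(j < M) grid_event j.

Lemma measurable_grid_union : measurable grid_union.
Proof. exact: bigsetU_measurable. Qed.

Let sumS : R := \sum_(n < M) n.+1%:R `^ (- al).

Let stepM (x : R) : x * (M%:R * step `^ al) = x * eps `^ al * M%:R `^ (1 - al).
Proof.
have a1 : step `^ al = eps `^ al / M%:R `^ al.
  by rewrite /step powRM ?invr_ge0// ?ltW// -[M%:R^-1]powR_inv1// -powRrM mulN1r powRN.
have a2 : M%:R `^ (1 - al) = M%:R / M%:R `^ al.
  by rewrite powRD ?(gt_eqF M0) ?implybT// powRr1 ?ltW// powRN.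
by rewrite a1 a2; ring.
Qed.

Lemma grid_union_ge : expR (- c1) * eps `^ al * M%:R `^ (1 - al) <=
  p grid_union * (expR (2 * c1) * sumS).
Proof.
have MN : (M <= N)%N by rewrite leq_addr.
have ltM j : (j < M)%N -> (j < N)%N by move=> jM; exact: leq_trans jM MN.
have b0 n : 0 <= expR (2 * c1) * n.+1%:R `^ (- al) by rewrite mulr_ge0 ?powR_ge0// expR_ge0.
rewrite mulr_sumr -stepM.
apply: le_trans _ (@regeneration_lower _ _ _ P grid_event past M measurable_grid_event
  past_measurable pastT _ _ _ _ b0 _).
- have -> : expR (- c1) * (M%:R * step `^ al) = \sum_(j < M) expR (- c1) * step `^ al.
    by rewrite sumr_const card_ord -[RHS]mulr_natr; ring.
  by apply: ler_sum => j _; case/andP: (grid_event_prob (ltM _ (ltn_ord j))).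
- by move=> i j A /andP[ji iM]; apply: pastI; rewrite ji ltM.
- by move=> i j A /andP[ij jM]; apply: markov; rewrite ij ltM.
- by move=> i iM; apply: V_gt0; exact: ltM.
- move=> i j /andP[ij jM].
  have ijN : (i <= j < N)%N by rewrite ij ltM.
  have [|_ +] := andP (@grid_event_probI i j ijN _); last by [].
  exact: leq_ltn_trans (leq_subr _ _) jM.
Qed.

Lemma grid_union_le : p grid_union * (expR (- (2 * c1)) * sumS) <=
  2 * (expR c1 * eps `^ al * M%:R `^ (1 - al)).
Proof.
have := @regeneration_upper _ _ _ P grid_event past N measurable_grid_event past_measurable
  pastT pastI markov V_gt0 (fun n => expR (- (2 * c1)) * n.+1%:R `^ (- al)) M (leqnn _).
rewrite -mulr_sumr; move=> /(_ _)/le_trans; apply.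
  move=> i j iM /andP[ij jiM].
  have jN : (i <= j < N)%N by rewrite ij (leq_trans jiM)// leq_add2r ltnW.
  have [|+ _] := andP (@grid_event_probI i j jN _); last by [].
  by rewrite -ltnS ltnS -subSn// leq_subLR.
rewrite -stepM mulrA.
have -> : 2 * expR c1 * (M%:R * step `^ al) = \sum_(j < M + M) expR c1 * step `^ al.
  by rewrite sumr_const card_ord -[RHS]mulr_natr natrD; ring.
by apply: ler_sum => j _; case/andP: (grid_event_prob (ltn_ord j)).
Qed.

Let al0 : 0 <= al.
Proof. by rewrite /alpha !mulr_ge0// ltW// (mean_sinh_gt0 hlaw). Qed.

Let expR3 : expR (3 * c1) = expR c1 * expR (2 * c1).
Proof. by rewrite -expRD; congr expR; ring. Qed.

Let sumSE b : b = 1 - al -> sumS = \sum_(n < M) n.+1%:R `^ (b - 1).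
Proof. by move=> ->; apply: eq_bigr => n _; congr powR; ring. Qed.

Let eps_al : 0 < eps `^ al. Proof. exact: powR_gt0. Qed.

(** The power of [M] in the expected number of visible cells cancels against [power_sum_le], so the
    bound is the same at all scales and passes to the limit. *)
Lemma grid_union_prob_ge : expR (- (3 * c1)) * eps `^ al * (1 - al) <= p grid_union.
Proof.
have pU : 0 <= p grid_union by exact: fine_ge0.
move: alpha1; rewrite le_eqVlt => /predU1P[->|a1]; first by rewrite subrr mulr0.
set b := 1 - al; have b01 : 0 < b <= 1 by rewrite subr_gt0 a1 gerBl.
have b0 : 0 < b by case/andP: b01.
have h1 := power_sum_le M b01; rewrite -sumSE// in h1.
have h2 := grid_union_ge; rewrite -/b in h2.
have Mb : 0 < M%:R `^ b :> R by exact: powR_gt0.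
rewrite -(ler_pM2r Mb); apply: (@le_trans _ _ (expR (- (2 * c1)) * b *
    (p grid_union * (expR (2 * c1) * sumS)))).
  have -> : - (3 * c1) = - (2 * c1) + - c1 by ring.
  rewrite expRD; have e0 : 0 < expR (- (2 * c1)) * b by rewrite mulr_gt0 ?expR_gt0.
  move: h2; rewrite -(ler_pM2l e0) => /(le_trans _); apply.
  by rewrite le_eqVlt; apply/orP; left; apply/eqP; ring.
have e : expR (- (2 * c1)) * expR (2 * c1) = 1 by rewrite -expRD addNr expR0.
have -> : expR (- (2 * c1)) * b * (p grid_union * (expR (2 * c1) * sumS)) =
   (expR (- (2 * c1)) * expR (2 * c1)) * (p grid_union * (b * sumS)) by ring.
by rewrite e mul1r ler_wpM2l.
Qed.

Let grid_union_le3 : p grid_union * sumS <=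
  2 * (expR (3 * c1) * eps `^ al * M%:R `^ (1 - al)).
Proof.
have h2 := grid_union_le; rewrite expR3.
have e0 : 0 < expR (2 * c1) by exact: expR_gt0.
have e : expR (2 * c1) * expR (- (2 * c1)) = 1 by rewrite -expRD subrr expR0.
move: h2; rewrite -(ler_pM2l e0) => h2.
have -> : p grid_union * sumS = expR (2 * c1) * (p grid_union * (expR (- (2 * c1)) * sumS)).
  transitivity ((expR (2 * c1) * expR (- (2 * c1))) * (p grid_union * sumS)); last by ring.
  by rewrite e mul1r.
by apply: le_trans h2 _; rewrite le_eqVlt; apply/orP; left; apply/eqP; ring.
Qed.

(** [power_sum_ge] carries a term [- 1]; the second hypothesis makes it cost at most half of the
    power of [M]. Together with the doubled number of cells this gives the factor 4. *)
Lemma grid_union_prob_le : al < 1 -> 2 <= M%:R `^ (1 - al) ->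
  p grid_union <= 4 * expR (3 * c1) * eps `^ al * (1 - al).
Proof.
move=> a1 M2; set b := 1 - al; have b01 : 0 < b <= 1 by rewrite subr_gt0 a1 gerBl.
have b0 : 0 < b by case/andP: b01.
have pU : 0 <= p grid_union by exact: fine_ge0.
have h1 := power_sum_ge M b01; rewrite -sumSE// in h1.
have h2 := grid_union_le3; rewrite -/b in h2 M2.
have MM : M%:R `^ b <= M.+1%:R `^ b :> R.
  by apply: ge0_ler_powR; rewrite ?nnegrE ?ler_nat// ltW.
have Mb : 0 < M%:R `^ b :> R by exact: powR_gt0.
have h3 : p grid_union * (M%:R `^ b / 2) <= p grid_union * (b * sumS).
  by apply: ler_wpM2l => //; lra.
have h4 : b * (p grid_union * sumS) <= b * (2 * (expR (3 * c1) * eps `^ al * M%:R `^ b)).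
  by rewrite ler_pM2l.
rewrite -(ler_pM2r (_ : 0 < M%:R `^ b / 2)) ?divr_gt0//.
apply: le_trans h3 _; rewrite mulrCA; apply: le_trans h4 _.
by rewrite le_eqVlt; apply/orP; left; apply/eqP; field.
Qed.

(** At criticality the power sum is harmonic, and the probability is at most of order [1 / k] at
    scale [k]. *)
Lemma grid_union_prob_critical : al = 1 ->
  p grid_union * ln M.+1%:R <= 2 * (expR (3 * c1) * eps).
Proof.
move=> a1; have h2 := grid_union_le3.
rewrite a1 subrr powRr0 mulr1 powRr1 ?(ltW eps0)// in h2.
apply: le_trans h2; apply: ler_wpM2l; first exact: fine_ge0.
apply: le_trans (@ln_le_harmonic R M) _; apply: ler_sum => n _.
by rewrite a1 powR_inv1.
Qed.

(** * Blocked sides of visible cells *)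

Section rims.
Variable q : R.
Hypothesis q1 : q < 1.

(* Only the points of a compact disc obstruct: their area is finite. *)
Definition rim (a : R) (x : R * R) : R :=
  if sqnorm x <= q then capped C a x else mark_max C.

Let disc_area : R := 16 / (1 - q) ^+ 2.

Let measurable_disc : measurable [set x : R * R | sqnorm x <= q].
Proof.
have := @measurable_sqr_sum R measurableT _ (measurable_itv `]-oo, q]).
by rewrite setTI.
Qed.

Let off_disc g := forall x, q < sqnorm x -> mark_max C <= g x.

Let rim_off a : off_disc (rim a).
Proof. by move=> x; rewrite ltNge => /negbTE xq; rewrite /rim xq. Qed.

Let admissible_off g : measurable_fun setT g -> (forall x, 0 <= g x) -> off_disc g ->
  admissible mk g.
Proof.
move=> mg g0 og; exists (mark_max C); split=> //; first exact: mark_le hlaw.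
apply: (@le_lt_trans _ _ (hyp_area [set x : R * R | sqnorm x <= q])).
  apply: (le_measure (@hyp_measure R)); rewrite ?inE//; first exact: measurable_sublevel.
  by move=> x /= gS; rewrite leNgt; apply/negP => /og; rewrite leNgt gS.
by apply: le_lt_trans (hyp_area_disc_le q1) _; rewrite ltry.
Qed.

Let load_off g : measurable_fun setT g -> (forall x, 0 <= g x) -> off_disc g ->
  load g <= disc_area.
Proof.
move=> mg g0 og; have ag := admissible_off mg g0 og.
have mark_meas := measurable_mark C.
rewrite -lee_fin /load fineK; last exact: marked_area_fin.
apply: (@le_trans _ _ (\int[law]_r (cst disc_area%:E) r)%E); last first.
  by rewrite integral_cst//= probability_setT mule1.
apply: ge0_le_integral => //.
- exact: measurable_marked.
- move=> r _; apply: le_trans (hyp_area_disc_le q1).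
  apply: (le_measure (@hyp_measure R)); rewrite ?inE//; first exact: measurable_sublevel.
  move=> x /= gS; rewrite leNgt; apply/negP => /og; rewrite leNgt (lt_le_trans gS)//.
  exact: mark_le hlaw r.
Qed.

Let measurable_rim a : measurable_fun setT (rim a).
Proof.
apply: measurable_fun_ifT => //; last exact: measurable_capped.
apply: (measurable_fun_bool true).
by rewrite setTI; exact: measurable_disc.
Qed.

Let rim_ge0 a x : 0 <= rim a x.
Proof. by rewrite /rim; case: ifP => _; [exact: capped_ge0 hlaw _ _|exact: ltW (mark_max_gt0 hlaw)]. Qed.

Let admissible_rim a : admissible mk (rim a).
Proof. by apply: admissible_off => //; exact: measurable_rim. Qed.

(** Encodes the event that none of the rays [0, ..., m] is crossed by a ball centred in the disc. *)
Fixpoint rim_min m : R * R -> R :=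
  if m is m'.+1 then fun x => Num.min (rim_min m' x) (rim (s k m) x) else rim (s k 0).

Let rim_min_off m : [/\ measurable_fun setT (rim_min m), forall x, 0 <= rim_min m x &
  off_disc (rim_min m)].
Proof.
elim: m => [|m [h1 h2 h3]] /=; first by split=> //; exact: measurable_rim.
split; first by apply: measurable_minr => //; exact: measurable_rim.
  by move=> x; rewrite le_min h2 rim_ge0.
by move=> x xq; rewrite le_min h3// rim_off.
Qed.

Let admissible_rim_min m : admissible mk (rim_min m).
Proof. by have [? ? ?] := rim_min_off m; exact: admissible_off. Qed.

Definition rim_cell j x : R := Num.max (rim (s k j) x) (rim (s k j.+1) x).

Let rim_quasiconvex i m x : (i <= m < N)%N -> H2 x ->
  rim (s k m) x <= Num.max (rim (s k i) x) (rim (s k m.+1) x).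
Proof.
move=> /andP[im mN] Hx; have [e0 e1] := andP heps.
have pi1 : s k m.+1 - s k i < pi.
  by have := grid_ge0 i; have := grid_le mN; lra.
rewrite /rim; case: ifP => _; last by rewrite le_max lexx.
by apply: (capped_quasiconvex C Hx _ pi1); rewrite !le_s.
Qed.

Local Arguments rim_min : simpl never.

(** A ball that crosses ray [m + 1] and some earlier ray also crosses ray [m]. Hence the overlap of
    the new ray with all the previous ones is its overlap with the last one. *)
Let max_rim_min m x : (m < N)%N -> H2 x ->
  Num.max (rim_min m x) (rim (s k m.+1) x) = rim_cell m x.
Proof.
move=> mN Hx.
have below_all i : (i <= m)%N -> rim (s k m) x <= Num.max (rim_min i x) (rim (s k m.+1) x).
  elim: i => [|i IH] im; first exact: rim_quasiconvex.
  by apply: le_max_minl; [exact/IH/ltnW|exact: rim_quasiconvex (introT andP (conj im mN)) Hx].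
case: m mN below_all => [//|m] mN below_all; apply: max_min_absorb.
exact: below_all.
Qed.

(* For minima the identity [load_minmax] makes the sums over the cells telescope. *)
Let load_rim_min m : (m < N)%N ->
  load (rim_min m.+1) - load (rim_min m) = load (rim (s k m.+1)) - load (rim_cell m).
Proof.
move=> mN; have := load_minmax law (admissible_rim_min m) (admissible_rim (s k m.+1)).
rewrite (eq_load law C (fun x => @max_rim_min m x mN)) => e.
exact: addB_exchange e.
Qed.

Let sum_load_rim1 m : (m <= N)%N ->
  \sum_(j < m) (load (rim (s k j.+1)) - load (rim_cell j)) =
  load (rim_min m) - load (rim (s k 0)).
Proof.
elim: m => [|m IH] mN; first by rewrite big_ord0 subrr.
rewrite big_ord_recr/= IH 1?ltnW//; have e := load_rim_min mN.
exact: subr_telescope e.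
Qed.

Let sum_load_rim0 m : (m <= N)%N ->
  \sum_(j < m) (load (rim (s k j)) - load (rim_cell j)) =
  load (rim_min m) - load (rim (s k m)).
Proof.
elim: m => [|m IH] mN; first by rewrite big_ord0 subrr.
rewrite big_ord_recr/= IH 1?ltnW// addrA subrK.
exact: subr_exchange (load_rim_min mN).
Qed.

Let load_rim_min_le m : load (rim_min m) <= disc_area.
Proof. by have [? ? ?] := rim_min_off m; exact: load_off. Qed.

(* No ball meets both sides of the [j]-th cell, but one centred in the disc
   meets the side [s k (j + b)]. *)
Definition grid_edge (b : bool) j : set T := grid_event j `\` event (rim (s k (j + b))).

Lemma measurable_grid_edge b j : measurable (grid_edge b j).
Proof. by apply: measurableD => //; apply: measurable_event; exact: measurable_rim. Qed.

(** The balls meeting the side but not the whole cell are independent of those blocking the cell.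
    Their load is the difference in parentheses, and some such ball exists with probability
    [1 - exp (- lambda * u) <= lambda * u]. *)
Let grid_edge_prob (b : bool) j : (j < N)%N -> p (grid_edge b j) <=
  expR c1 * step `^ al * (lambda * (load (rim (s k (j + b))) - load (rim_cell j))).
Proof.
move=> jN; set u := load (rim (s k (j + b))) - load (rim_cell j); have aj := admissible_grid_cell jN.
have ar := admissible_rim (s k (j + b)).
have mr := measurable_event (measurable_rim (s k (j + b))).
have mc x : H2 x -> Num.max (grid_cell j x) (rim (s k (j + b)) x) = rim_cell j x.
  move=> _; rewrite /rim_cell /rim /grid_cell /cell; case: ifP => _.
    by case: b {u ar mr}; rewrite ?addn1 ?addn0; apply/max_idPl; rewrite le_max lexx ?orbT.
  rewrite maxxx; apply/max_idPr; rewrite ge_max !capped_le//.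
have e : p (grid_edge b j) = p (grid_event j) * (1 - expR (- (lambda * u))).
  rewrite /grid_edge /p measureD//; last by rewrite (le_lt_trans (probability_le1 _ _))// ltry.
  rewrite fineB ?fin_num_measure//; last exact: measurableI.
  have := event_prob_minmax aj ar mc; rewrite /p -/(grid_event j) => ->.
  have := pV jN; rewrite /p => ->; rewrite [RHS]mulrBr mulr1 -expRD; congr (_ - expR _).
  by rewrite /u; move: (load _) (load _) (load _) => *; ring.
have pD : 0 <= p (grid_edge b j) by exact: fine_ge0.
have pV0 := V_gt0 jN.
have u1 : 1 - expR (- (lambda * u)) <= lambda * u.
  by have := expR_ge1Dx (- (lambda * u)); lra.
(* The sign is read off the probability itself: [1 - exp (- lambda * u)] is nonnegative and at most
   [lambda * u]. *)
have u0 : 0 <= lambda * u.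
  by apply: le_trans u1; move: pD; rewrite e pmulr_rge0.
have /andP[_ pVle] := grid_event_prob jN.
rewrite e; apply: ler_pM => //; first exact: ltW.
by move: pD; rewrite e pmulr_rge0.
Qed.

(** The sum over the [2 ^ k] cells does not accumulate: the load differences telescope to at most
    the load of a minimum, bounded by the area of the disc. The factor [step ^ alpha] remains and
    tends to 0 with the scale. *)
Lemma grid_edge_union_prob b : p (\big[setU/set0]_(j < M) grid_edge b j) <=
  expR c1 * step `^ al * (lambda * disc_area).
Proof.
have MN : (M <= N)%N by rewrite leq_addr.
apply: (@le_trans _ _ (\sum_(j < M) p (grid_edge b j))).
  have -> : \sum_(j < M) p (grid_edge b j) = fine (\sum_(j < M) P (grid_edge b j))%E.
    by rewrite sum_fine// => j _; rewrite fin_num_measure//; exact: measurable_grid_edge.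
  apply: fine_le; rewrite ?fin_num_measure//.
  - by apply: bigsetU_measurable => j _; exact: measurable_grid_edge.
  - by apply/sum_fin_numP => j _ _; rewrite fin_num_measure//; exact: measurable_grid_edge.
  - have := @Boole_inequality _ _ _ P (grid_edge b) M; apply => j _.
    exact: measurable_grid_edge.
apply: (@le_trans _ _ (\sum_(j < M) expR c1 * step `^ al *
    (lambda * (load (rim (s k (j + b))) - load (rim_cell j))))).
  by apply: ler_sum => j _; apply: grid_edge_prob; exact: leq_trans (ltn_ord j) MN.
rewrite -mulr_sumr -mulr_sumr; apply: ler_wpM2l.
  by rewrite mulr_ge0 ?powR_ge0// expR_ge0.
apply: ler_wpM2l => //.
have h := load_rim_min_le M.
case: b; under eq_bigr do rewrite ?addn1 ?addn0.
  rewrite sum_load_rim1//; have := load_ge0 law C (rim (s k 0)).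
  by move: (load (rim _)) (load (rim_min _)) h => *; lra.
rewrite sum_load_rim0//; have := load_ge0 law C (rim (s k M)).
by move: (load (rim _)) (load (rim_min _)) h => *; lra.
Qed.

End rims.

End level.
End grid_events.

(** * Limit over the scales and exceptional directions *)

Section visibility_probability.
Context {R : realType} (law : probability R R) (C : R).
Hypothesis hlaw : law `]0, C]%classic = 1%E.
Variable C0 : R.
Hypothesis C00 : 0 <= C0.
Hypothesis area_cell : forall a b K : R,
  0 <= a -> a < b -> b - a < pi / 2 -> a + b < 2 * pi -> 0 < K <= mark_max C ->
  ((2 * K * ln (b - a)^-1 - C0)%:E <= hyp_area (near_both a b K))%E /\
  (hyp_area (near_both a b K) <= (2 * K * ln (b - a)^-1 + C0)%:E)%E.
Variable eps : R.
Hypothesis heps : 0 < eps < pi / 2.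
Context {d} {T : measurableType d} (P : probability T R) (lambda : R).
Variables (xi : nat -> T -> R * R) (rho : nat -> T -> R).
Hypothesis model : is_boolean_model P lambda law xi rho.
Hypothesis lambda0 : 0 <= lambda.
Variable c1 : R.
Hypothesis lambdaC0 : lambda * C0 <= c1.
Hypothesis alpha1 : alpha law lambda <= 1.

Local Notation al := (alpha law lambda).
Local Notation event_at := (grid_event C eps xi rho).
Local Notation U := (grid_union C eps xi rho).

Implicit Types (w : T) (j k n : nat).

Let epi : 0 < eps < pi.
Proof. by have := @pi_gt0 R; case/andP: heps => e0 e1; rewrite e0/=; lra. Qed.

Let eps0 : 0 < eps. Proof. by case/andP: heps. Qed.

Let x w n : R * R := xi n w.
Let K w n : R := mark C (rho n w).

Let mxi n : measurable_fun setT (xi n). Proof. by case: model => -[]. Qed.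
Let mrho n : measurable_fun setT (rho n). Proof. by case: model. Qed.

Let grid_eventP k j w : event_at k j w <-> grid_visible eps (x w) (K w) k j.
Proof.
by split=> h n Hn; have := h n Hn; rewrite (mark_le_cell hlaw).
Qed.

Let grid_unionP k w : U k w <-> exists2 j, (j < 2 ^ k)%N & grid_visible eps (x w) (K w) k j.
Proof.
rewrite /grid_union -bigcup_mkord; split=> -[j /= jk].
  by move/grid_eventP; exists j.
by move=> h; exists j => //; exact/grid_eventP.
Qed.

(** The measurable event that stands for visibility: some direction is crossed by no open ball. The
    unions decrease with [k], because the half of a visible index is visible at the coarser
    scale. *)
Definition limit_union : set T := \bigcap_k U k.

Let measurable_U k : measurable (U k).
Proof. exact: (measurable_grid_union C eps model k). Qed.

Lemma measurable_limit_union : measurable limit_union.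
Proof. by apply: bigcapT_measurable => k. Qed.

Let limit_unionP w : limit_union w <-> exists2 theta, 0 <= theta <= eps &
  forall n, H2 (x w n) -> K w n <= threshold theta (x w n).
Proof.
rewrite (visibleP epi); split=> h k; first by apply/grid_unionP; exact: h.
by move=> _; apply/grid_unionP.
Qed.

Let cvg_union : fine (P (U k)) @[k --> \oo] --> fine (P limit_union).
Proof.
apply: fine_cvg; rewrite fineK ?fin_num_measure//; last exact: measurable_limit_union.
apply: nonincreasing_cvg_mu => //.
- by rewrite (le_lt_trans (probability_le1 _ _))// ltry.
- exact: measurable_limit_union.
- apply/nonincreasing_seqP => k; apply/subsetPset => w /grid_unionP[j jk vis].
  apply/grid_unionP; exists j./2; last exact: (grid_visible_half epi jk vis).
  by rewrite ltn_half_double -mul2n -expnS.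
Qed.

Let limit_le k : fine (P limit_union) <= fine (P (U k)).
Proof.
apply: fine_le; rewrite ?fin_num_measure//; first exact: measurable_limit_union.
by apply: le_measure; rewrite ?inE//; [exact: measurable_limit_union|move=> w; apply].
Qed.

Lemma limit_union_prob_ge :
  expR (- (3 * c1)) * eps `^ al * (1 - al) <= fine (P limit_union).
Proof.
apply: ler_cvg_to (cvg_cst _) cvg_union _; apply: nearW => k.
exact: (grid_union_prob_ge hlaw C00 area_cell heps model lambda0 lambdaC0 alpha1).
Qed.

Lemma limit_union_prob_le :
  fine (P limit_union) <= 4 * expR (3 * c1) * eps `^ al * (1 - al).
Proof.
have := alpha1; rewrite le_eqVlt => /predU1P[a1|a1].
  rewrite a1 subrr mulr0 leNgt; apply/negP => p0.
  have ln2 : 0 < ln 2 :> R by rewrite ln_gt0// ltr1n.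
  set D := 2 * (expR (3 * c1) * eps).
  have D0 : 0 <= D by rewrite !mulr_ge0 ?expR_ge0// ltW.
  (* Large enough that [k * ln 2 <= ln (2 ^ k + 1)] contradicts the critical bound if the limit has
     positive probability. *)
  pose k := (Num.truncn (D / (fine (P limit_union) * ln 2))).+1.
  have kD : D < fine (P limit_union) * (ln 2 *+ k).
    rewrite -[ln 2 *+ k]mulr_natr mulrA mulrC -ltr_pdivrMr ?mulr_gt0//.
    by have /andP[] : _ := truncn_itv (divr_ge0 D0 (ltW (mulr_gt0 p0 ln2))).
  have := grid_union_prob_critical hlaw C00 area_cell heps model lambda0 lambdaC0 k a1.
  apply/negP; rewrite -ltNge; apply: lt_le_trans kD _.
  apply: ler_pM => //; [exact: ltW|by rewrite mulrn_wge0// ltW|].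
  rewrite -lnXn// ler_ln ?posrE ?exprn_gt0 ?ltr0n//.
  by rewrite -natrX ler_nat.
pose b := 1 - al; have b0 : 0 < b by rewrite subr_gt0.
(* Then [k * b >= 1], that is [(2 ^ k) ^ b >= 2]. A single scale suffices, because the limit event
   is contained in every union. *)
pose k := (Num.truncn b^-1).+1.
apply: le_trans (limit_le k) _.
apply: (grid_union_prob_le hlaw C00 area_cell heps model lambda0 lambdaC0) => //.
rewrite natrX -powR_mulrn// -powRrM -/b -[leLHS]powRr1//.
apply: ler_powR; first by rewrite ler1n.
rewrite mulrC -ler_pdivrMl// mulr1.
by have /andP[_ /ltW] := truncn_itv (ltW (etrans (invr_gt0 b) b0)).
Qed.

Let all_radii : set T := \bigcap_n (rho n @^-1` `]0, C]).

Let all_radiiP w : all_radii w <-> forall n, 0 < rho n w <= C.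
Proof. by split=> h n; have := h n; rewrite /= in_itv/=; [apply|move=> h' _]. Qed.

Let negligible_radii : P.-negligible (~` all_radii).
Proof.
rewrite /all_radii setC_bigcap; apply: negligible_bigcup => n.
have [_ _ lawE _ _] := model.
exists (rho n @^-1` (~` `]0, C]%classic)); split => //.
- by apply: measurable_preimage => //; exact: measurableC.
- apply: etrans (lawE _ _ _) _; first exact: measurableC.
  by rewrite probability_setC// hlaw subee.
Qed.

Let step_decay k : step eps k `^ al = eps `^ al * ((2^-1) `^ al) ^+ k.
Proof.
rewrite /step natrX -exprVn powRM ?exprn_ge0 ?ltW// ?invr_gt0//.
congr (_ * _); transitivity ((2^-1 : R) `^ (k%:R * al)).
  by rewrite powRrM powR_mulrn.
by rewrite mulrC powRrM powR_mulrn// powR_ge0.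
Qed.

Let negligible_decay (A : set T) (B : nat -> set T) (D : R) k0 : 0 < al ->
  (forall k, measurable (B k)) -> (forall k, (k0 <= k)%N -> A `<=` B k) ->
  (forall k, fine (P (B k)) <= D * step eps k `^ al) -> P.-negligible A.
Proof.
move=> al0 mB AB PB.
pose E := \bigcap_k B (k0 + k)%N.
have mE : measurable E by apply: bigcapT_measurable => k.
exists E; split=> //; last by move=> w Aw k _; apply: AB Aw; rewrite leq_addr.
apply/eqP; rewrite eq_le measure_ge0 andbT -[P E]fineK ?fin_num_measure// lee_fin.
have r1 : `|(2^-1 : R) `^ al| < 1.
  have e1 : 1 = 1 `^ al :> R by rewrite powR1.
  rewrite ger0_norm ?powR_ge0// [ltRHS]e1; apply: gt0_ltr_powR; rewrite ?nnegrE//.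
  by rewrite invf_lt1// ltr1n.
have c : D * (eps `^ al * ((2^-1) `^ al) ^+ (k + k0)%N) @[k --> \oo] --> D * (eps `^ al * 0).
  apply: cvgM; first exact: cvg_cst.
  apply: cvgM; first exact: cvg_cst.
  by rewrite (cvg_shiftn k0); exact: cvg_expr.
rewrite !mulr0 in c; apply: ler_cvg_to (cvg_cst _) c _; apply: nearW => k.
rewrite -step_decay addnC; apply: le_trans (PB _).
apply: fine_le; rewrite ?fin_num_measure//.
by apply: le_measure; rewrite ?inE// => w; apply.
Qed.

(** Squared Euclidean radii of countably many compact discs that exhaust the plane. *)
Let radius_disc (l : nat) : R := 1 - l.+1%:R^-1.

Let in_disc z : H2 z -> exists l, sqnorm z <= radius_disc l.
Proof.
move=> Hz; have D0 : 0 < 1 - sqnorm z by rewrite subr_gt0.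
exists (Num.truncn (1 - sqnorm z)^-1); rewrite /radius_disc.
have /andP[_ /ltW h] := truncn_itv (ltW (etrans (invr_gt0 _) D0)).
rewrite lerBrDr -lerBrDl -[leRHS]invrK lef_pV2 ?posrE ?invr_gt0//.
Qed.

Let edge_at l b k := \big[setU/set0]_(j < 2 ^ k) grid_edge C eps xi rho k (radius_disc l) b j.

(** What a tangent direction leaves behind: for some disc, side and initial scale, a visible cell
    with that side blocked exists at every later scale. Each of these countably many intersections
    is null, since the probabilities at scale [k] tend to 0. *)
Let edge_event : set T := \bigcup_l \bigcup_k0 (
  (\bigcap_(k in [set k | (k0 <= k)%N]) edge_at l false k) `|`
  (\bigcap_(k in [set k | (k0 <= k)%N]) edge_at l true k)).

Let negligible_edge_event : 0 < al -> P.-negligible edge_event.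
Proof.
move=> al0; apply: negligible_bigcup => l; apply: negligible_bigcup => k0.
have q1 : radius_disc l < 1 by rewrite /radius_disc gtrBl invr_gt0.
have half b : P.-negligible (\bigcap_(k in [set k | (k0 <= k)%N]) edge_at l b k).
  pose D := expR c1 * (lambda * (16 / (1 - radius_disc l) ^+ 2)).
  apply: (@negligible_decay _ (edge_at l b) D k0) => //.
  - by move=> k; apply: bigsetU_measurable => j _; exact: (measurable_grid_edge C eps model).
  - by move=> k kk0 w; apply.
  - move=> k; have := grid_edge_union_prob hlaw C00 area_cell heps model lambda0 lambdaC0 k q1 b.
    by rewrite /D mulrAC.
by apply: negligibleU; exact: half.
Qed.

(** At [theta = 0] or [theta = eps] the cell needed by [endpoint_detect] may fall outside the grid.
    These directions lie in the first or the last cell at every scale, and a single cell is visible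
    with probability of order [step ^ alpha]. *)
Let end_event : set T := (\bigcap_k event_at k 0) `|` (\bigcap_k event_at k (2 ^ k).-1).

Let negligible_end_event : 0 < al -> P.-negligible end_event.
Proof.
move=> al0.
have side (f : nat -> nat) : (forall k, (f k < 2 ^ k)%N) ->
    P.-negligible (\bigcap_k event_at k (f k)).
  move=> fk; apply: (@negligible_decay _ (fun k => event_at k (f k)) (expR c1) 0%N) => //.
  - by move=> k; apply: (measurable_event C model); exact: measurable_cell.
  - by move=> k _ w; apply.
  - move=> k; have fN : (f k < 2 ^ k + 2 ^ k)%N by rewrite ltn_addr.
    by have /andP[_] := grid_event_prob hlaw C00 area_cell heps model lambda0 lambdaC0 fN.
apply: negligibleU; first by apply: side => k; rewrite expn_gt0.
by apply: (side (fun k => (2 ^ k).-1)) => k; rewrite ltn_predL expn_gt0.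
Qed.

Let sees w := Y_infty eps xi rho w !=set0.

Let sees_limit w : all_radii w -> sees w -> limit_union w.
Proof.
move=> /all_radiiP rw [theta [t01 vis]]; apply/limit_unionP; exists theta => // n Hn.
rewrite /K markE//; apply: (threshold_of_visible _ vis) => // m.
by case/andP: (rw m).
Qed.

(** The direction given by [limit_union] is crossed by no open ball, yet its ray is not vacant; so
    it is tangent to a ball, and the tangency is detected at all fine scales unless the direction is
    an end of the interval. *)
Let limit_not_sees w : all_radii w -> limit_union w -> ~ sees w -> (edge_event `|` end_event) w.
Proof.
move=> rw /limit_unionP[theta t01 vis] nsees; have [t0 t1] := andP t01.
have rw0 n : 0 < rho n w by have /andP[] := (all_radiiP w).1 rw n.
have KE n : K w n = sinh (rho n w) by rewrite /K markE//; exact: (all_radiiP w).1.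
have [n [Hn Ksinh d0]] : exists n, [/\ H2 (xi n w), sinh (rho n w) = threshold theta (xi n w)
    & 0 < dot theta (xi n w)].
  apply: endpoint_of_not_visible => //.
    by move=> m Hm; rewrite -KE; exact: vis.
  by move=> sub; apply: nsees; exists theta.
move: t0; rewrite le_eqVlt => /predU1P[t0|t0].
  right; left=> k _; apply/grid_eventP.
  apply: (grid_visible_of_visible epi _ _ vis); first by rewrite expn_gt0.
  by rewrite -t0 grid0 lexx/= -(grid0 eps k) le_grid.
move: t1; rewrite le_eqVlt => /predU1P[t1|t1].
  right; right=> k _; apply/grid_eventP; have k0 : (0 < 2 ^ k)%N by rewrite expn_gt0.
  apply: (grid_visible_of_visible epi _ _ vis); first by rewrite ltn_predL.
  by rewrite prednK// grid_max t1 lexx andbT -[leRHS](grid_max eps k) le_grid// leq_pred.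
left; have t01' : 0 < theta < eps by rewrite t0.
have [l xl] := in_disc Hn.
have K0 : 0 < K w n by rewrite KE sinh_gt0.
have KT : K w n = threshold theta (x w n) by rewrite KE.
have edge (b : bool) k j : (j < 2 ^ k)%N -> grid_visible eps (x w) (K w) k j ->
    threshold (grid eps k (j + b)) (x w n) < K w n -> edge_at l b k w.
  move=> jk gv lt; rewrite /edge_at -bigcup_mkord; exists j => //.
  split; first exact/grid_eventP.
  move=> /(_ n Hn); rewrite /rim xl (mark_le_capped hlaw)//.
  by apply/negP; rewrite -ltNge.
have [[k0 h]|[k0 h]] := endpoint_detect epi t01' vis Hn K0 KT d0;
    exists l => //; exists k0 => //; [left|right] => k kk0.
  have [j jk [gv /andP[lt _]]] := h k kk0.
  by apply: (edge false k j jk gv); rewrite addn0.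
have [j jk [gv /andP[lt _]]] := h k kk0.
by apply: (edge true k j jk gv); rewrite addn1.
Qed.

Let occupied_disc : set T := \bigcup_n (xi n @^-1` H2).

(** For [lambda = 0] the exponent [alpha] is 0 and the tangency estimates do not decay. There are
    then almost surely no points, and every direction is visible. *)
Let negligible_occupied : lambda = 0 -> P.-negligible occupied_disc.
Proof.
move=> l0; have [[_ pois _] _ _ _ _] := model.
have mo : measurable occupied_disc.
  by apply: bigcupT_measurable => n; apply: measurable_preimage => //; exact: measurable_H2.
exists occupied_disc; split=> //.
have := pois setT measurableT; rewrite l0 mul0e => /(_ 0%N).
rewrite expr0 fact0 divr1 oppr0 expR0 mulr1 => P1.
have e : [set w | point_count xi setT w = 0%:R%:E] = ~` occupied_disc.
  apply/seteqP; split=> w /=.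
    move=> c0 [n _ /= Hn].
    have : (1 <= point_count xi setT w)%E.
      rewrite /point_count; apply: le_trans (nneseries_lim_ge n.+1 _); last first.
        by move=> i _ _; rewrite lee_fin.
      rewrite big_nat_recr//= setTI [in leRHS]indicE mem_set//= leeDr//.
      by apply: sume_ge0 => i _; rewrite lee_fin.
    by rewrite c0 lee_fin ler10.
  move=> no; rewrite /point_count setTI eseries0// => n _ _.
  by rewrite indicE memNset// => Hn; apply: no; exists n.
rewrite e probability_setC// in P1.
move: P1; rewrite -(fineK (fin_num_measure P _ mo)) -EFinB => -[e1].
by congr EFin; lra.
Qed.

Lemma visibility_limit_union :
  P.-negligible ([set w | Y_infty eps xi rho w !=set0] `+` limit_union).
Proof.
have [l0|l0] := eqVneq lambda 0.
  apply: negligibleS (negligibleU negligible_radii (negligible_occupied l0)).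
  move=> w ss; apply: contrapT => nU.
  have rw : all_radii w by apply: contrapT => h; apply: nU; left.
  have no n : ~ H2 (xi n w) by move=> Hn; apply: nU; right; exists n.
  have lw : limit_union w.
    by apply/limit_unionP; exists 0; [rewrite lexx ltW|move=> n /no].
  have sw : sees w.
    exists 0; split; first by rewrite lexx ltW.
    by apply: visible_of_threshold => n; [have /andP[] := (all_radiiP w).1 rw n|move/no].
  by case: ss => -[].
have lam0 : 0 < lambda by rewrite lt_neqAle eq_sym l0.
have al0 : 0 < al by rewrite /alpha !mulr_gt0// (mean_sinh_gt0 hlaw).
apply: negligibleS (negligibleU negligible_radii
  (negligibleU (negligible_edge_event al0) (negligible_end_event al0))).
move=> w ss; have [rw|nr] := pselect (all_radii w); last by left.
right; case: ss => -[h1 h2]; last exact: limit_not_sees.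
by case: h2; exact: sees_limit.
Qed.

End visibility_probability.

Theorem proposition8 (R : realType) (law : probability R R) (C : R)
    (hlaw : law `]0, C]%classic = 1%E)
    (epsilon : R) (heps : 0 < epsilon < pi / 2) :
  exists c c' : R, [/\ 0 < c, c <= c' &
    forall (lambda : R), 0 <= lambda <= lambda_gv law ->
    forall (d : measure_display) (T : measurableType d) (P : probability T R)
      (xi : nat -> T -> R * R) (rho : nat -> T -> R),
      is_boolean_model P lambda law xi rho ->
      exists p : R,
        completed_prob P [set w | Y_infty epsilon xi rho w !=set0] p /\
        c * (1 - alpha law lambda) <= p <= c' * (1 - alpha law lambda)].
Proof.
have S0 : 0 <= mark_max C by exact: ltW (mark_max_gt0 hlaw).
have [C0 C00 area] := hyp_area_near_both S0.
have m0 := mean_sinh_gt0 hlaw.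
have [e0 _] := andP heps.
have gv0 : 0 < lambda_gv law by rewrite divr_gt0// mulr_gt0.
(* Bounds the error [lambda * C0] of the exponents for all intensities up to the critical one, so
   that the constants do not depend on [lambda]. *)
pose c1 := lambda_gv law * C0; have c10 : 0 <= c1 by rewrite mulr_ge0// ltW.
(* As [alpha] ranges over [[0, 1]], [epsilon ^ alpha] stays between [exp (- n)] and [exp n]. *)
pose n := `|ln epsilon|.
exists (expR (- (3 * c1 + n))), (4 * expR (3 * c1 + n)).
have n0 : 0 <= n by exact: normr_ge0.
split; first exact: expR_gt0.
  have : expR (- (3 * c1 + n)) <= expR (3 * c1 + n) by rewrite ler_expR; lra.
  by have := expR_gt0 (3 * c1 + n); lra.
move=> lambda /andP[l0 l1] d T P xi rho model.
have l0C : lambda * C0 <= c1 by rewrite ler_wpM2r.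
have a1 : alpha law lambda <= 1.
  rewrite /alpha mulrAC mulrC -ler_pdivlMr ?mulr_gt0//.
have a0 : 0 <= alpha law lambda by rewrite /alpha !mulr_ge0// ltW.
exists (fine (P (limit_union C epsilon xi rho))); split.
  exists (limit_union C epsilon xi rho); split.
  - exact: (measurable_limit_union C epsilon model).
  - exact: (visibility_limit_union hlaw C00 area heps model l0 l0C).
  - by rewrite fineK// fin_num_measure//; exact: (measurable_limit_union C epsilon model).
have b0 : 0 <= 1 - alpha law lambda by rewrite subr_ge0.
have epsE : epsilon `^ alpha law lambda = expR (alpha law lambda * ln epsilon).
  by rewrite /powR gt_eqF.
have [t1 t2] : - n <= alpha law lambda * ln epsilon /\ alpha law lambda * ln epsilon <= n.
  have : `|alpha law lambda * ln epsilon| <= n.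
    by rewrite normrM ger0_norm// ler_piMl.
  by rewrite ler_norml => /andP[].
have ge := limit_union_prob_ge hlaw C00 area heps model l0 l0C a1.
have le := limit_union_prob_le hlaw C00 area heps model l0 l0C a1.
rewrite epsE -expRD in ge; rewrite epsE -(mulrA 4) -expRD in le.
apply/andP; split.
  by apply: le_trans ge; rewrite ler_wpM2r// ler_expR; lra.
by apply: le_trans le _; rewrite ler_wpM2r// ler_pM2l// ler_expR; lra.
Qed.
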